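(* Let $\mathcal O$ be a DG-operad equipped with a strong pseudo-cylinder $(\mathcal P,i_0,i_1,p,h_{\mathcal O})$, let $V$ be a sequence of chain complexes, and let $\partial\colon V\to\mathcal O$ be a sequence of degree $-1$ maps with $\partial d_V+d_{\mathcal O}\partial=0$, so that the twisted coproduct $\mathcal O\amalg_\partial\mathcal F(V)$ is defined. Then there is a strong pseudo-cylinder of the DG-operad $\mathcal O\amalg_\partial\mathcal F(V)$ (called the canonical induced strong pseudo-cylinder) of the form $$\bigl(\mathcal P\amalg_{\partial_I}\mathcal F(IV),\; i_0=i_0\amalg\mathcal F(i_0),\; i_1=i_1\amalg\mathcal F(i_1),\; p=p\amalg\mathcal F(p),\; h_\partial\bigr),$$ where the degree $-1$ map $\partial_I\colon IV=V\oplus\Sigma V\oplus V\to\mathcal P$ is $\partial_I=(\,i_0\partial\;\;\;-h_{\mathcal O}i_1\partial\;\;\;i_1\partial\,)$, i.e. for $x\in V$ $$\partial_I(i_0x)=i_0\partial(x),\qquad \partial_I(\sigma x)=-h_{\mathcal O}i_1\partial(x),\qquad \partial_I(i_1x)=i_1\partial(x),$$ and the chain homotopy is $$h_\partial=\sum_{n\geq 0}(h_{\mathcal O,V}\,\partial_I)^n\,h_{\mathcal O,V},$$ where in this last formula $\partial_I$ denotes its extension to a self-map of $\mathcal P\amalg\mathcal F(IV)$.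
   Context: Conventions. $\Bbbk$ is a commutative ring; graded modules are $\mathbb Z$-graded $\Bbbk$-modules, differentials have degree $-1$, and tensor products use the Koszul sign rule. The suspension $\Sigma X$ of a chain complex has $(\Sigma X)_n=X_{n-1}$, $d_{\Sigma X}=-d_X$, and $\sigma\colon X\to\Sigma X$ is the degree $+1$ map which is the identity degreewise. A ''sequence'' is a family indexed by arity $n\geq 0$; constructions and maps on sequences are aritywise. Operads. All operads are non-symmetric, with arities $n\ge 0$. A graded operad $\mathcal O=\{\mathcal O(n)\}_{n\geq0}$ has compositions $\circ_i\colon\mathcal O(p)\otimes\mathcal O(q)\to\mathcal O(p+q-1)$, $1\le i\le p$, and $\mathrm{id}\in\mathcal O(1)_0$, with $x\circ_i(y\circ_jz)=(x\circ_iy)\circ_{i+j-1}z$; $(x\circ_iy)\circ_jz=(-1)^{|y||z|}(x\circ_jz)\circ_{i+n-1}y$ for $j<i$, $z\in\mathcal O(n)$; $\mathrm{id}\circ_1x=x=x\circ_i\mathrm{id}$. Write $x_0(x_1,\dots,x_n)$ for the full composition obtained by inserting $x_1,\dots,x_n$ successively from left to right. A DG-operad moreover has a differential with $d(x\circ_iy)=d(x)\circ_iy+(-1)^{|x|}x\circ_id(y)$. Strong pseudo-cylinders. A strong deformation retraction (SDR) consists of chain maps $i\colon X\to Y$, $p\colon Y\to X$ and a degree $+1$ map $h\colon Y\to Y$ with $ip-1_Y=dh+hd$, $pi=1_X$, $ph=0$, $hi=0$, $h^2=0$. A strong pseudo-cylinder $(C,i_0,i_1,p,h)$ of a chain complex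 $X$ consists of chain maps $i_0,i_1\colon X\to C$, $p\colon C\to X$ and $h\colon C\to C$ such that $(i_0,p,h)$ is an SDR and $pi_1=1_X$. The canonical one is $IX=X\oplus\Sigma X\oplus X$, where $i_0,i_1$ are the inclusions of the first and third summands, $d(\sigma x)=i_0x-i_1x-\sigma d(x)$, $p(i_0x)=p(i_1x)=x$, $p(\sigma x)=0$, with homotopy $h_I(i_1x)=\sigma x$, $h_I(i_0x)=h_I(\sigma x)=0$. A strong pseudo-cylinder of a DG-operad $\mathcal O$ is a DG-operad $\mathcal P$ with DG-operad maps $i_0,i_1\colon\mathcal O\to\mathcal P$, $p\colon\mathcal P\to\mathcal O$ and a sequence of degree $+1$ maps $h_{\mathcal O}\colon\mathcal P\to\mathcal P$ which aritywise form a strong pseudo-cylinder of chain complexes (no compatibility of $h_{\mathcal O}$ with compositions is required). Trees and coproducts. A tree is a planted planar tree with leaves; its inner vertices (those other than the bottom vertex of the root edge and the top vertices of the leaves) are ordered by the path order: $v\le w$ if the path from the root to $v$ is contained in the path to $w$ or branches off to the left of it. Levels count distance from the bottom of the root edge, so the bottommost inner vertex has level $1$; a leaf has the level of its top vertex. The arity $\tilde v$ of an inner vertex $v$ is the number of edges adjacent from above. For a sequence $V$, $\mathcal F(V)$ is the free operad on $V$. For an operad $\mathcal O$ and a sequence $V$, the coproduct of operads decomposes as $(\mathcal O\amalg\mathcal F(V))(n)=\bigoplus_T(\mathcal O,V)(T)$, over trees $T$ with $n$ leaves, all of even level, where $(\mathcal O,V)(T)$ is the tensor product, in the path order, of $\mathcal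 O(\tilde u)$ for $u$ inner of odd level and $V(\tilde v)$ for $v$ inner of even level; a tensor (labeled tree) corresponds to the iterated composition of its labels nested according to $T$ and written in the path order. The homotopy $h_{\mathcal O,V}$. Given the strong pseudo-cylinder $(\mathcal P,i_0,i_1,p,h_{\mathcal O})$, $h_{\mathcal O,V}$ is the degree $+1$ self-map of $\mathcal P\amalg\mathcal F(IV)$ preserving each summand $(\mathcal P,IV)(T)$ and given there, on a tensor $y_1\otimes\cdots\otimes y_m$ of labels in path order, by $$\sum_{k=1}^m(-1)^{|y_1|+\cdots+|y_{k-1}|}\,i_0p(y_1)\otimes\cdots\otimes i_0p(y_{k-1})\otimes h(y_k)\otimes y_{k+1}\otimes\cdots\otimes y_m,$$ where $h$ is $h_{\mathcal O}$ on labels in $\mathcal P$ and $h_I$ on labels in $IV$. Twisted coproducts. For a degree $-1$ map of sequences $\partial\colon V\to\mathcal O$ with $\partial d_V+d_{\mathcal O}\partial=0$, the twisted coproduct $\mathcal O\amalg_\partial\mathcal F(V)$ is the DG-operad with the same underlying graded operad as $\mathcal O\amalg\mathcal F(V)$ and differential $d_\partial$ determined by $d_\partial(x)=d_{\mathcal O}(x)$ for $x\in\mathcal O$, $d_\partial(y)=d_V(y)+\partial(y)$ for $y\in V$. The extension of $\partial$ to $\mathcal O\amalg\mathcal F(V)$ is the unique degree $-1$ self-map that vanishes on $\mathcal O$, is the given $\partial$ on $V$, and satisfies the operadic Leibniz rule; it equals $d_\partial-d_{\mathcal O\amalg\mathcal F(V)}$. *)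

(* Defs.v *)
From HB Require Import structures.
From mathcomp Require Import all_boot all_order all_algebra.
From mathcomp Require Import boolp.
Set Implicit Arguments.
Unset Strict Implicit.
Unset Printing Implicit Defensive.
Import GRing.Theory.
Local Open Scope ring_scope.
Local Open Scope quotient_scope.

(* A sequence of graded modules M = {M(n)_a}, n : nat the arity and a : int the
   degree, is encoded internally: one k-module, the direct sum of all the
   M(n)_a, together with the projections onto the summands.  An element is in
   M(n)_a when it is fixed by the corresponding projection, so no transport
   along equalities of arities or degrees is ever needed. *)
Record dgSeq (k : comPzRingType) := DgSeq {
  car :> lmodType k;
  proj : nat -> int -> car -> car;
  diff : car -> car }.

(* Positions are numbered from 0: circ i is the composition o_(i+1).  It is a
   total function, constrained only on x in O(p), y in O(q) with i < p. *)
Record opSeq (k : comPzRingType) := OpSeq {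
  op_seq :> dgSeq k;
  circ : nat -> op_seq -> op_seq -> op_seq;
  op_id : op_seq }.

Definition sg (k : comPzRingType) (e : int) : k := (-1) ^+ absz e.

Definition homog (k : comPzRingType) (M : dgSeq k) (n : nat) (a : int)
    (x : M) : bool :=
  proj n a x == x.

Record is_graded (k : comPzRingType) (M : dgSeq k) : Prop := IsGraded {
  proj_linear : forall n a, linear (@proj k M n a);
  proj_proj : forall n a m b (x : M),
    proj n a (proj m b x) = if (n == m) && (a == b) then proj m b x else 0;
  proj_sum : forall x : M, exists s : seq (nat * int),
    uniq s /\ x = \sum_(j <- s) proj j.1 j.2 x }.

Definition is_deg_map (k : comPzRingType) (M N : dgSeq k) (r : int)
    (f : M -> N) : Prop :=
  linear f /\
  forall n a (x : M), homog n a x -> homog n (a + r) (f x).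

Record is_dg_seq (k : comPzRingType) (M : dgSeq k) : Prop := IsDgSeq {
  dg_graded : is_graded M;
  dg_deg : is_deg_map (-1) (@diff k M);
  dg_diff2 : forall x : M, diff (diff x) = 0 }.

Definition is_chain_map (k : comPzRingType) (M N : dgSeq k) (f : M -> N) : Prop :=
  is_deg_map 0 f /\ forall x, f (diff x) = diff (f x).

Record is_dg_operad (k : comPzRingType) (O : opSeq k) : Prop := IsDgOperad {
  operad_seq : is_dg_seq O;
  circ_linearl : forall i (y : O), linear (fun x : O => circ i x y);
  circ_linearr : forall i (x : O), linear (fun y : O => circ i x y);
  circ_homog : forall i p q a b (x y : O), (i < p)%N ->
    homog p a x -> homog q b y -> homog (p + q).-1 (a + b) (circ i x y);
  op_id_homog : homog 1 0 (op_id O);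
  circ_seq : forall i j p q r a b c (x y z : O), (i < p)%N -> (j < q)%N ->
    homog p a x -> homog q b y -> homog r c z ->
    circ i x (circ j y z) = circ (i + j) (circ i x y) z;
  circ_par : forall i j p q n a b c (x y z : O), (j < i)%N -> (i < p)%N ->
    homog p a x -> homog q b y -> homog n c z ->
    circ j (circ i x y) z = sg k (b * c) *: circ (i + n).-1 (circ j x z) y;
  circ_idl : forall n a (x : O), homog n a x -> circ 0 (op_id O) x = x;
  circ_idr : forall i n a (x : O), (i < n)%N -> homog n a x ->
    circ i x (op_id O) = x;
  diff_circ : forall i p q a b (x y : O), (i < p)%N ->
    homog p a x -> homog q b y ->
    diff (circ i x y) = circ i (diff x) y + sg k a *: circ i x (diff y) }.

Record is_operad_map (k : comPzRingType) (O P : opSeq k) (f : O -> P) : Prop :=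
  IsOperadMap {
  opmap_chain : is_chain_map f;
  opmap_id : f (op_id O) = op_id P;
  opmap_circ : forall i p q a b (x y : O), (i < p)%N ->
    homog p a x -> homog q b y -> f (circ i x y) = circ i (f x) (f y) }.

Record is_sdr (k : comPzRingType) (X Y : dgSeq k)
    (i : X -> Y) (p : Y -> X) (h : Y -> Y) : Prop := IsSdr {
  sdr_i : is_chain_map i;
  sdr_p : is_chain_map p;
  sdr_h : is_deg_map 1 h;
  sdr_homotopy : forall y, i (p y) - y = diff (h y) + h (diff y);
  sdr_pi : forall x, p (i x) = x;
  sdr_ph : forall y, p (h y) = 0;
  sdr_hi : forall x, h (i x) = 0;
  sdr_hh : forall y, h (h y) = 0 }.

Record is_pseudo_cylinder (k : comPzRingType) (X C : dgSeq k)
    (i0 i1 : X -> C) (p : C -> X) (h : C -> C) : Prop := IsPseudoCylinder {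
  cyl_sdr : is_sdr i0 p h;
  cyl_i1 : is_chain_map i1;
  cyl_pi1 : forall x, p (i1 x) = x }.

Record is_operad_cylinder (k : comPzRingType) (O P : opSeq k)
    (i0 i1 : O -> P) (p : P -> O) (h : P -> P) : Prop := IsOperadCylinder {
  opcyl_operad : is_dg_operad P;
  opcyl_i0 : is_operad_map i0;
  opcyl_i1 : is_operad_map i1;
  opcyl_p : is_operad_map p;
  opcyl_cyl : is_pseudo_cylinder i0 i1 p h }.

Section CanonicalCylinder.
Variables (k : comPzRingType) (V : dgSeq k).

(* (x, s, y) stands for i0 x + sigma s + i1 y. *)
Definition cyl : dgSeq k := {|
  car := (V * V * V)%type : lmodType k;
  proj := fun n a u =>
    (proj n a u.1.1, proj n (a - 1) u.1.2, proj n a u.2);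
  diff := fun u =>
    (diff u.1.1 + u.1.2, - diff u.1.2, diff u.2 - u.1.2) |}.

Definition cyl_in0 (x : V) : cyl := (x, 0, 0).
Definition cyl_sigma (x : V) : cyl := (0, x, 0).
Definition cyl_in1 (x : V) : cyl := (0, 0, x).
Definition cyl_p (u : cyl) : V := u.1.1 + u.2.
Definition cyl_h (u : cyl) : cyl := cyl_sigma u.2.

End CanonicalCylinder.

Section Trees.
Variable X : Type.

(* The root edge is implicit: Leaf is the bare edge, and Node x cs has its
   bottommost inner vertex labeled by x, of arity size cs. *)
Inductive ltree := Leaf | Node of X & seq ltree.

Fixpoint nleaves (t : ltree) : nat :=
  if t is Node _ cs then sumn (map nleaves cs) else 1.

(* The labels in the path order. *)
Fixpoint labels (t : ltree) : seq X :=
  if t is Node x cs then x :: flatten (map labels cs) else [::].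

(* slot cs i = (j, i') when the i-th leaf of the forest cs is the i'-th leaf of
   its j-th tree. *)
Fixpoint slot (cs : seq ltree) (i : nat) : nat * nat :=
  if cs is c :: cs' then
    if (i < nleaves c)%N then (0%N, i)
    else let: (j, i') := slot cs' (i - nleaves c) in (j.+1, i')
  else (0%N, i).

End Trees.
Arguments Leaf {X}.

(* Applies f to every label, given also its rank in the path order (from k on)
   and the arity of its vertex. *)
Fixpoint relabel (X Y : Type) (f : nat -> nat -> X -> Y) (k : nat)
    (t : ltree X) {struct t} : ltree Y :=
  match t with
  | Leaf => Leaf
  | Node x cs => Node (f k (size cs) x)
      ((fix go (k : nat) (cs : seq (ltree X)) {struct cs} : seq (ltree Y) :=
          if cs is c :: cs' then
            relabel f k c :: go (k + size (labels c))%N cs'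
          else [::]) k.+1 cs)
  end.

(* The iterated composition of a tree of elements of C, nested according to the
   tree; on each vertex it is x_0(x_1,...,x_n), inserted from left to right. *)
Fixpoint compose (C : Type) (circ : nat -> C -> C -> C)
    (id : C) (t : ltree C) {struct t} : C :=
  match t with
  | Leaf => id
  | Node x cs =>
      (fix go (i : nat) (acc : C) (cs : seq (ltree C)) {struct cs} : C :=
         if cs is c :: cs' then
           go (i + nleaves c)%N (circ i acc (compose circ id c)) cs'
         else acc) 0%N x cs
  end.

Section Coproduct.
Variables (k : comPzRingType) (O : opSeq k) (V : dgSeq k).

(* A label comes with its degree. *)
Definition label : Type := (int * (O + V))%type.

Implicit Types (t s : ltree label) (cs : seq (ltree label)).

Definition label_ok (odd_level : bool) (n : nat) (l : label) : bool :=
  match l.2 with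
  | inl x => odd_level && homog n l.1 x
  | inr v => ~~ odd_level && homog n l.1 v
  end.

Fixpoint admissible_at (odd_level : bool) (t : ltree label) : bool :=
  match t with
  | Leaf => ~~ odd_level
  | Node l cs => label_ok odd_level (size cs) l
                 && all (admissible_at (~~ odd_level)) cs
  end.

Definition admissible : ltree label -> bool := admissible_at true.

Definition tdeg t : int := \sum_(l <- labels t) l.1.
Definition fdeg cs : int := \sum_(c <- cs) tdeg c.

(* lin_label c t1 t2 t: t1, t2 and t differ in one label only, the one of t
   being c times the one of t1 plus the one of t2. *)
Inductive lin_label (c : k) :
    ltree label -> ltree label -> ltree label -> Prop :=
| LinO a (x y : O) cs :
    lin_label c (Node (a, inl x) cs) (Node (a, inl y) cs)
                (Node (a, inl (c *: x + y)) cs)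
| LinV a (x y : V) cs :
    lin_label c (Node (a, inr x) cs) (Node (a, inr y) cs)
                (Node (a, inr (c *: x + y)) cs)
| LinSub l lft t1 t2 t rgt : lin_label c t1 t2 t ->
    lin_label c (Node l (lft ++ t1 :: rgt)) (Node l (lft ++ t2 :: rgt))
                (Node l (lft ++ t :: rgt)).

Definition multilinear (M : lmodType k) (f : ltree label -> M) : Prop :=
  forall c t1 t2 t, admissible t1 -> admissible t2 -> lin_label c t1 t2 t ->
    f t = c *: f t1 + f t2.

(* The direct sum over the trees T of the tensor products (O,V)(T): formal
   linear combinations of admissible labeled trees, two of them being identified
   when no multilinear map separates them. *)
Definition fsum : Type := seq (k * ltree label).

Definition eval (M : lmodType k) (f : ltree label -> M) (u : fsum) : M :=
  \sum_(e <- u | admissible e.2) e.1 *: f e.2.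

HB.instance Definition _ := gen_eqMixin fsum.
HB.instance Definition _ := gen_choiceMixin fsum.

Definition fsum_eq (u v : fsum) : bool :=
  `[< forall (M : lmodType k) (f : ltree label -> M),
        multilinear f -> eval f u = eval f v >].

Lemma fsum_eq_refl : reflexive fsum_eq.
Proof. by move=> u; apply/asboolP. Qed.

Lemma fsum_eq_sym : symmetric fsum_eq.
Proof.
by move=> u v; apply/asboolP/asboolP => H M f mf; rewrite H.
Qed.

Lemma fsum_eq_trans : transitive fsum_eq.
Proof.
move=> v u w /asboolP Huv /asboolP Hvw.
by apply/asboolP => M f mf; rewrite Huv // Hvw.
Qed.

Canonical fsum_equiv :=
  EquivRel fsum_eq fsum_eq_refl fsum_eq_sym fsum_eq_trans.

Definition coprod : Type := {eq_quot fsum_equiv}.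

HB.instance Definition _ := Choice.on coprod.

Definition cls (u : fsum) : coprod := \pi_({eq_quot fsum_equiv}) u.
Definition rep (q : coprod) : fsum := repr (q : {eq_quot fsum_equiv}).

(* The class of a labeled tree, 0 if it is not admissible. *)
Definition tcls t : coprod := cls [:: (1, t)].

(* The linear map given by f on admissible labeled trees (f multilinear). *)
Definition ext (M : lmodType k) (f : ltree label -> M) (q : coprod) : M :=
  eval f (rep q).

Lemma ext_cls (M : lmodType k) (f : ltree label -> M) u :
  multilinear f -> ext f (cls u) = eval f u.
Proof.
move=> mf; rewrite /ext /rep /cls.
have /eqP := reprK (\pi_({eq_quot fsum_equiv}) u).
by rewrite eqmodE => /asboolP; apply.
Qed.

Lemma coprodP (q r : coprod) :
  (forall (M : lmodType k) (f : ltree label -> M),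
     multilinear f -> ext f q = ext f r) -> q = r.
Proof.
move=> H; rewrite -[q]reprK -[r]reprK; apply/eqP.
by rewrite eqmodE; apply/asboolP => M f mf; apply: H.
Qed.

Definition fsum_scale (c : k) (u : fsum) : fsum :=
  [seq (c * e.1, e.2) | e <- u].

Lemma eval_cat (M : lmodType k) (f : ltree label -> M) u v :
  eval f (u ++ v) = eval f u + eval f v.
Proof. exact: big_cat. Qed.

Lemma eval_scale (M : lmodType k) (f : ltree label -> M) c u :
  eval f (fsum_scale c u) = c *: eval f u.
Proof.
rewrite /eval big_map scaler_sumr.
by apply: eq_bigr => e _; rewrite scalerA.
Qed.

Definition coprod_zero : coprod := cls [::].
Definition coprod_add (q r : coprod) : coprod := cls (rep q ++ rep r).
Definition coprod_scale (c : k) (q : coprod) : coprod :=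
  cls (fsum_scale c (rep q)).
Definition coprod_opp : coprod -> coprod := coprod_scale (-1).

Lemma ext_zero (M : lmodType k) (f : ltree label -> M) :
  multilinear f -> ext f coprod_zero = 0.
Proof. by move=> mf; rewrite ext_cls // /eval big_nil. Qed.

Lemma ext_add (M : lmodType k) (f : ltree label -> M) q r :
  multilinear f -> ext f (coprod_add q r) = ext f q + ext f r.
Proof. by move=> mf; rewrite ext_cls // eval_cat. Qed.

Lemma ext_scale (M : lmodType k) (f : ltree label -> M) c q :
  multilinear f -> ext f (coprod_scale c q) = c *: ext f q.
Proof. by move=> mf; rewrite ext_cls // eval_scale. Qed.

Fact coprod_addA : associative coprod_add.
Proof. by move=> q r s; apply: coprodP => M f mf; rewrite !ext_add // addrA. Qed.

Fact coprod_addC : commutative coprod_add.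
Proof. by move=> q r; apply: coprodP => M f mf; rewrite !ext_add // addrC. Qed.

Fact coprod_add0 : left_id coprod_zero coprod_add.
Proof.
by move=> q; apply: coprodP => M f mf; rewrite ext_add // ext_zero // add0r.
Qed.

Fact coprod_addN : left_inverse coprod_zero coprod_opp coprod_add.
Proof.
move=> q; apply: coprodP => M f mf.
by rewrite ext_add // ext_scale // ext_zero // scaleN1r addNr.
Qed.

HB.instance Definition _ :=
  GRing.isZmodule.Build coprod coprod_addA coprod_addC coprod_add0 coprod_addN.

Fact coprod_scaleA c d q :
  coprod_scale c (coprod_scale d q) = coprod_scale (c * d) q.
Proof. by apply: coprodP => M f mf; rewrite !ext_scale // scalerA. Qed.

Fact coprod_scale1 : left_id 1 coprod_scale.
Proof. by move=> q; apply: coprodP => M f mf; rewrite ext_scale // scale1r. Qed.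

Fact coprod_scaleDr : right_distributive coprod_scale +%R.
Proof.
move=> c q r; apply: coprodP => M f mf.
by rewrite ext_scale // !ext_add // !ext_scale // scalerDr.
Qed.

Fact coprod_scaleDl q : {morph coprod_scale^~ q : c d / c + d}.
Proof.
move=> c d; apply: coprodP => M f mf.
by rewrite ext_scale // ext_add // !ext_scale // scalerDl.
Qed.

HB.instance Definition _ :=
  GRing.Zmodule_isLmodule.Build k coprod
    coprod_scaleA coprod_scale1 coprod_scaleDr coprod_scaleDl.

Definition join_labels (j : nat) (l m : label) : label :=
  (l.1 + m.1, if (l.2, m.2) is (inl x, inl z) then inl (circ j x z) else l.2).

(* Inserts s in the i-th leaf of t: the bottom label of s, which lies in O, is
   composed with the label in O under that leaf.  The first component is the
   exponent of the Koszul sign.  Labels are kept in the path order: s jumps over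
   the labels of t to the right of the leaf, and its bottom label moreover jumps
   over the labels between that of the vertex under the leaf and the leaf. *)
Fixpoint graft (s : ltree label) (i : nat) (t : ltree label) {struct t} :
    int * ltree label :=
  match t with
  | Leaf => (0, s)
  | Node l cs =>
      let: (j, i') := slot cs i in
      let lft := take j cs in
      let rgt := drop j.+1 cs in
      match nth Leaf cs j, s with
      | Leaf, Node m ds =>
          (tdeg s * fdeg rgt + m.1 * fdeg lft,
           Node (join_labels j l m) (lft ++ ds ++ rgt))
      | _, _ =>
          let: (e, c) := nth (0, Leaf) (map (graft s i') cs) j in
          (e + tdeg s * fdeg rgt, Node l (lft ++ c :: rgt))
      end
  end.

Definition coprod_circ (i : nat) (q r : coprod) : coprod :=
  ext (fun t => ext (fun s =>
    if (i < nleaves t)%N then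
      sg k (graft s i t).1 *: tcls (graft s i t).2
    else 0) r) q.

Definition id_tree : ltree label := Node (0, inl (op_id O)) [:: Leaf].

Definition coprod_id : coprod := tcls id_tree.

(* The images in the coproduct of x in O(n)_a and of v in V(n)_a; all leaves
   having even level, the latter is id(v(id, ..., id)). *)
Definition inO (n : nat) (a : int) (x : O) : coprod :=
  tcls (Node (a, inl x) (nseq n Leaf)).
Definition inV (n : nat) (a : int) (v : V) : coprod :=
  tcls (Node (0, inl (op_id O)) [:: Node (a, inr v) (nseq n id_tree)]).

Definition in_label (n : nat) (l : label) : coprod :=
  match l.2 with inl x => inO n l.1 x | inr v => inV n l.1 v end.

(* The degree -1 derivation of the graded operad coprod equal to D n l on a
   generator l of arity n: the Leibniz rule on iterated compositions. *)
Definition derivation (D : nat -> label -> coprod) : coprod -> coprod :=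
  ext (fun t => \sum_(j < size (labels t))
    sg k (\sum_(l <- take j (labels t)) l.1) *:
    compose coprod_circ coprod_id
      (relabel (fun r n l => if r == j then D n l else in_label n l) 0 t)).

Variable del : V -> O.

Definition del_ext : coprod -> coprod :=
  derivation (fun n l => match l.2 with
    | inl x => 0
    | inr v => inO n (l.1 - 1) (del v)
    end).

Definition twisted_diff : coprod -> coprod :=
  derivation (fun n l => match l.2 with
    | inl x => inO n (l.1 - 1) (diff x)
    | inr v => inV n (l.1 - 1) (diff v) + inO n (l.1 - 1) (del v)
    end).

Definition twisted_coprod : opSeq k := {|
  op_seq := {|
    car := coprod : lmodType k;
    proj := fun n a =>
      ext (fun t => if (nleaves t == n) && (tdeg t == a) then tcls t else 0);
    diff := twisted_diff |};
  circ := coprod_circ;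
  op_id := coprod_id |}.

Definition is_twisting : Prop :=
  is_deg_map (-1) del /\ forall v, del (diff v) + diff (del v) = 0.

End Coproduct.

(* f \amalg F(g), for f, g of degree 0. *)
Definition coprod_map (k : comPzRingType) (O P : opSeq k) (V W : dgSeq k)
    (f : O -> P) (g : V -> W) : coprod O V -> coprod P W :=
  ext (fun t => tcls (relabel (fun _ _ (l : label O V) =>
    ((l.1, match l.2 with inl x => inl (f x) | inr v => inr (g v) end)
       : label P W)) 0 t)).

Section InducedCylinder.
Variables (k : comPzRingType) (O P : opSeq k) (V : dgSeq k).
Variables (i0 i1 : O -> P) (p : P -> O) (h : P -> P) (del : V -> O).

Definition label_i0p (l : label P (cyl V)) : label P (cyl V) :=
  (l.1, match l.2 with
        | inl x => inl (i0 (p x))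
        | inr u => inr (cyl_in0 (cyl_p u))
        end).

Definition label_h (l : label P (cyl V)) : label P (cyl V) :=
  (l.1 + 1, match l.2 with
            | inl x => inl (h x)
            | inr u => inr (cyl_h u)
            end).

Definition h_coprod : coprod P (cyl V) -> coprod P (cyl V) :=
  ext (fun t => \sum_(j < size (labels t))
    sg k (\sum_(l <- take j (labels t)) l.1) *:
    tcls (relabel (fun r _ l =>
      if (r < j)%N then label_i0p l else if r == j then label_h l else l) 0 t)).

Definition del_cyl (u : cyl V) : P :=
  i0 (del u.1.1) - h (i1 (del u.1.2)) + i1 (del u.2).

(* hd is the sum over n >= 0 of (h_coprod \o del_ext del_cyl)^n \o h_coprod:
   on every element only finitely many terms are nonzero, and hd is their sum. *)
Definition is_perturbed_homotopy
    (hd : coprod P (cyl V) -> coprod P (cyl V)) : Prop :=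
  let term n q := iter n (h_coprod \o del_ext del_cyl) (h_coprod q) in
  forall q, exists N : nat,
    (forall n, (N <= n)%N -> term n q = 0) /\ hd q = \sum_(n < N) term n q.

End InducedCylinder.

(* Main.v *)
(* A map of the generators to a graded operad Q which is an operad map on O
   extends to the coproduct, by composing the labels along each tree.  For the
   operad of dual numbers over the coproduct this extends derivations from the
   generators, with the Leibniz rule.  As O and V generate the coproduct, the
   identities between derivations and operad maps (the twisted differential
   squares to zero, i0, i1 and p commute with the differentials and with the
   extensions of the twisting maps) are then checked on generators only.

   On the trees of a fixed shape, h_{O,V} is the usual homotopy of a tensor
   product of deformation retracts, so one gets a strong pseudo-cylinder for the
   untwisted differentials.  The extension of del_I removes one label in IV,
   hence h_{O,V} del_I is locally nilpotent; as h_{O,V} del_I i0 = 0 and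
   p del_I h_{O,V} = 0, the perturbation lemma leaves i0 and p unchanged and
   replaces the homotopy by the sum of the (h_{O,V} del_I)^n h_{O,V}. *)
Require Import Defs.
From HB Require Import structures.
From mathcomp Require Import all_boot all_order all_algebra.
From mathcomp Require Import boolp zify ring.
Set Implicit Arguments.
Unset Strict Implicit.
Unset Printing Implicit Defensive.
Import GRing.Theory.
Local Open Scope ring_scope.

(** * Signs, graded modules and trees *)

(** The coproduct is a quotient seen only through multilinear functionals, so identities are
    extended linearly from classes of admissible trees, where they must hold with their exact Koszul
    signs. Grafting two trees at different leaves in either order gives the same tree except when
    both leaves hang from one vertex: there the results differ by a scalar inside a label.

    Dual numbers serve because x -> x + e D(x) is multiplicative exactly when D satisfies the
    Leibniz rule; linearity, degree and Leibniz rule of a derivation thus come together from one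
    universal property.

    The component -h i1 del of the twisting map comes from i0 p - 1 = d h + h d evaluated on i1 del:
    as p i1 = 1, this is exactly the compatibility with d(sigma x) = i0 x - i1 x - sigma d(x).

    The signs of the tensor product homotopy are settled on lists of labels, by induction on the
    first factor; trees enter only when such a list is filled into a fixed shape. *)

Section Sign.
Variable k : comPzRingType.

Lemma sg0 : sg k 0 = 1. Proof. by []. Qed.

Lemma sgD a b : sg k (a + b) = sg k a * sg k b.
Proof.
rewrite /sg -exprD -signr_odd -[in RHS]signr_odd; congr (_ ^+ (nat_of_bool _)).
by lia.
Qed.

Lemma sg2 a : sg k a * sg k a = 1.
Proof. by rewrite /sg -exprD addnn -signr_odd odd_double. Qed.

(** Exponents are polynomials in degrees and [ring] proves only integer equalities, so the even
    discrepancy is given explicitly through [x]. *)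
Lemma sg_even x a b : a = b + x * 2 -> sg k a = sg k b.
Proof.
move=> ->; rewrite /sg -signr_odd -[in RHS]signr_odd; congr (_ ^+ (nat_of_bool _)).
by lia.
Qed.

Lemma sgS a : sg k (a + 1) = - sg k a.
Proof. by rewrite sgD /(sg k 1) expr1 mulrN1. Qed.

Lemma sgB1 a : sg k (a - 1) = - sg k a.
Proof. by rewrite sgD /(sg k (-1)) expr1 mulrN1. Qed.

End Sign.

Section Linear.
Variables (k : comPzRingType) (U W : lmodType k) (f : U -> W).
Hypothesis lf : linear f.

Lemma lin0 : f 0 = 0.
Proof. by have := lf (-1) 0 0; rewrite scaler0 addr0 scaleN1r addNr. Qed.

Lemma linD x y : f (x + y) = f x + f y.
Proof. by have := lf 1 x y; rewrite !scale1r. Qed.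

Lemma linZ c x : f (c *: x) = c *: f x.
Proof. by have := lf c x 0; rewrite !addr0 lin0 addr0. Qed.

Lemma linN x : f (- x) = - f x.
Proof. by rewrite -scaleN1r linZ scaleN1r. Qed.

Lemma linB x y : f (x - y) = f x - f y.
Proof. by rewrite linD linN. Qed.

Lemma lin_sum I (r : seq I) (P : pred I) (F : I -> U) :
  f (\sum_(i <- r | P i) F i) = \sum_(i <- r | P i) f (F i).
Proof. by apply: (big_morph f linD lin0). Qed.

End Linear.

Section Grading.
Variables (k : comPzRingType) (M : dgSeq k).
Hypothesis gM : is_graded M.

Lemma homog0 n a : homog n a (0 : M).
Proof. by rewrite /homog (lin0 (proj_linear gM n a)). Qed.

Lemma homogZD n a c (x y : M) : homog n a x -> homog n a y ->
  homog n a (c *: x + y).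
Proof. by rewrite /homog => /eqP hx /eqP hy; rewrite (proj_linear gM) hx hy. Qed.

Lemma homogD n a (x y : M) : homog n a x -> homog n a y -> homog n a (x + y).
Proof. by move=> hx hy; rewrite -[x]scale1r homogZD. Qed.

Lemma homogZ n a c (x : M) : homog n a x -> homog n a (c *: x).
Proof. by move=> hx; rewrite -[c *: x]addr0 homogZD ?homog0. Qed.

Lemma homogN n a (x : M) : homog n a x -> homog n a (- x).
Proof. by rewrite -scaleN1r; apply: homogZ. Qed.

Lemma homog_sum n a I (r : seq I) (F : I -> M) :
  (forall i, homog n a (F i)) -> homog n a (\sum_(i <- r) F i).
Proof. by move=> H; elim/big_ind: _ => //; [exact: homog0 | exact: homogD]. Qed.

(** Outside [s1] the projections of [x] vanish by orthogonality, so the index list may grow. This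
    puts the components of a pair or a triple over a common list. *)
Lemma graded_sub (x : M) (s1 s : seq (nat * int)) : uniq s1 -> uniq s ->
  x = \sum_(j <- s1) proj j.1 j.2 x -> {subset s1 <= s} ->
  x = \sum_(j <- s) proj j.1 j.2 x.
Proof.
move=> us1 us xE sub.
have z j : j \notin s1 -> proj j.1 j.2 x = 0.
  move=> nj; rewrite xE (lin_sum (proj_linear gM _ _)) big_seq big1 // => j' j's.
  rewrite (proj_proj gM) -xpair_eqE -!surjective_pairing.
  by case: eqP => // jj; rewrite jj j's in nj.
rewrite (bigID [in s1]) /= [X in _ = _ + X]big1 // addr0 -big_filter.
rewrite [LHS]xE; apply: perm_big; apply: uniq_perm; rewrite ?filter_uniq //.
by move=> j; rewrite mem_filter; case: (boolP (j \in s1)) => // /sub ->.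
Qed.

End Grading.

Lemma deg_map_homog (k : comPzRingType) (M N : dgSeq k) r (f : M -> N) n a (x : M) :
  is_deg_map r f -> homog n a x -> homog n (a + r) (f x).
Proof. by case=> _; apply. Qed.

Section Trees.
Variable X : Type.
Implicit Types (t : ltree X) (cs : seq (ltree X)).

Fixpoint All_trees (Q : ltree X -> Prop) cs : Prop :=
  if cs is c :: cs' then Q c /\ All_trees Q cs' else True.

(** The generated principle gives no hypothesis on the subtrees inside a [seq]. [All_trees] is a
    fixpoint so that these hypotheses unfold along the forest. *)
Lemma ltree_nested_ind (Q : ltree X -> Prop) :
  Q Leaf -> (forall x cs, All_trees Q cs -> Q (Node x cs)) -> forall t, Q t.
Proof.
move=> Ql Qn; fix IH 1; case=> [//|x cs]; apply: Qn.
by elim: cs => //= c cs' IHcs; split.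
Qed.

Definition nlv cs : nat := sumn (map (@nleaves X) cs).

Lemma nlv_cat cs ds : nlv (cs ++ ds) = (nlv cs + nlv ds)%N.
Proof. by rewrite /nlv map_cat sumn_cat. Qed.

Lemma nlv_cons c cs : nlv (c :: cs) = (nleaves c + nlv cs)%N.
Proof. by []. Qed.

Lemma nlv_cat_rcons cs c : nlv (rcons cs c) = (nlv cs + nleaves c)%N.
Proof. by rewrite -cats1 nlv_cat nlv_cons addn0. Qed.

Lemma nleaves_node x cs : nleaves (Node x cs) = nlv cs. Proof. by []. Qed.

Lemma slot_cat lft c rgt i : (i < nleaves c)%N ->
  slot (lft ++ c :: rgt) (nlv lft + i) = (size lft, i).
Proof.
move=> ic; elim: lft => [|d lft IH] /=; first by rewrite ic.
by rewrite nlv_cons -addnA ltnNge leq_addr /= addKn IH.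
Qed.

(** Turns a leaf number into a splitting of the forest around the tree that carries the leaf;
    arguments about grafting then use such splittings instead of [slot]. *)
Lemma leaf_split cs i : (i < nlv cs)%N -> exists lft c rgt i',
  [/\ cs = lft ++ c :: rgt, i = (nlv lft + i')%N & (i' < nleaves c)%N].
Proof.
elim: cs i => // c cs IH i; rewrite nlv_cons => ilt.
have [ic|ci] := ltnP i (nleaves c); first by exists [::], c, cs, i.
have /IH[lft [d [rgt [i' [-> iE i'd]]]]] : (i - nleaves c < nlv cs)%N by lia.
by exists (c :: lft), d, rgt, i'; split=> //; rewrite nlv_cons; lia.
Qed.

Lemma drop_size_catS (lft rgt : seq (ltree X)) c :
  drop (size lft).+1 (lft ++ c :: rgt) = rgt.
Proof. by elim: lft => //=; rewrite drop0. Qed.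

(** Compares two positions in one forest: equal, or one on either side of the other. It drives the
    case analyses on two changes made to the same forest. *)
Lemma cat_cons_eq (l1 l2 r1 r2 : seq (ltree X)) c1 c2 :
  l1 ++ c1 :: r1 = l2 ++ c2 :: r2 ->
  [\/ [/\ l1 = l2, c1 = c2 & r1 = r2],
      exists mid, l1 = l2 ++ c2 :: mid /\ r2 = mid ++ c1 :: r1 |
      exists mid, l2 = l1 ++ c1 :: mid /\ r1 = mid ++ c2 :: r2].
Proof.
elim: l1 l2 => [|a l1 IH] [|b l2] /=.
- by case=> -> ->; constructor 1.
- by case=> -> ->; constructor 3; exists l2.
- by case=> <- <-; constructor 2; exists l1.
- by case=> -> /IH[[-> -> ->]|[m [-> ->]]|[m [-> ->]]];
    [constructor 1 | constructor 2; exists m | constructor 3; exists m].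
Qed.

End Trees.

(** * Grafting as an inductive relation *)

Section Graft.
Variables (k : comPzRingType) (O : opSeq k) (V : dgSeq k).
Hypothesis grO : is_graded O.
Hypothesis grV : is_graded V.
Local Notation T := (ltree (label O V)).
Implicit Types (t s u : T) (cs ds lft rgt : seq T) (l m : label O V).

Lemma tdeg_node l cs : tdeg (Node l cs) = l.1 + fdeg cs.
Proof.
rewrite /tdeg /= big_cons; congr (_ + _).
by elim: cs => [|c cs IH]; rewrite /fdeg ?big_nil //= big_cat big_cons /= IH.
Qed.

Lemma fdeg_cat cs ds : fdeg (cs ++ ds) = fdeg cs + fdeg ds.
Proof. exact: big_cat. Qed.

Lemma fdeg_cons c cs : fdeg (c :: cs) = tdeg c + fdeg cs.
Proof. exact: big_cons. Qed.

Lemma fdeg_nil : fdeg ([::] : seq T) = 0.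
Proof. exact: big_nil. Qed.

Lemma tdeg_leaf : tdeg (Leaf : T) = 0.
Proof. exact: big_nil. Qed.

Definition tdegE := (tdeg_node, fdeg_cat, fdeg_cons, fdeg_nil, tdeg_leaf).

Lemma admissible_node b l cs : admissible_at b (Node l cs) =
  label_ok b (size cs) l && all (admissible_at (~~ b)) cs.
Proof. by []. Qed.

(* The graph of [graft], on which one can argue by induction: either the grafted
   leaf hangs from the root, and then the root of [s] is composed with it, or
   the leaf lies in a proper subtree. *)
Inductive grafted (s : T) : nat -> T -> int -> T -> Prop :=
| GraftRoot l lft rgt m ds : s = Node m ds ->
    grafted s (nlv lft) (Node l (lft ++ Leaf :: rgt))
      (tdeg s * fdeg rgt + m.1 * fdeg lft)
      (Node (join_labels (size lft) l m) (lft ++ ds ++ rgt))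
| GraftSub l lft x xs rgt i e c : (i < nlv xs)%N ->
    grafted s i (Node x xs) e c ->
    grafted s (nlv lft + i) (Node l (lft ++ Node x xs :: rgt))
      (e + tdeg s * fdeg rgt) (Node l (lft ++ c :: rgt)).

Lemma grafted_graft s i t e t' : grafted s i t e t' -> graft s i t = (e, t').
Proof.
elim=> {i t e t'} [l lft rgt m ds -> | l lft x xs rgt i e c ilt _ IH].
  rewrite -{1}[nlv lft]addn0 [LHS]/= slot_cat // nth_cat ltnn subnn /=.
  by rewrite take_size_cat // drop_size_catS.
rewrite [LHS]/= slot_cat // nth_cat ltnn subnn [nth _ (_ :: _) 0]/=.
rewrite map_cat nth_cat size_map ltnn subnn.
rewrite [nth _ (map _ _) 0]/= -/(graft s i (Node x xs)) IH.
by rewrite take_size_cat // drop_size_catS.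
Qed.

(** The bare edge is excluded because [graft] returns [s] there, a case without constructor; being
    of odd root level it is not admissible anyway. *)
Lemma graftP m ds t i : t <> Leaf -> (i < nleaves t)%N ->
  exists e t', grafted (Node m ds) i t e t'.
Proof.
move: t i; elim/ltree_nested_ind => // l cs IH i _ /= /leaf_split.
case=> lft [c [rgt [i' [E -> i'c]]]]; rewrite {}E in IH *.
case: c i'c IH => [|x xs] i'c IH.
  case: i' i'c => // _; rewrite addn0.
  by do 2 eexists; apply: (GraftRoot l lft rgt (m := m) (ds := ds)).
suff [e [c gc]] : exists e c, grafted (Node m ds) i' (Node x xs) e c.
  by do 2 eexists; apply: GraftSub gc.
elim: lft IH => [|d lft IHl] /= [Qd Ql]; [exact: Qd | exact: IHl].
Qed.

Lemma grafted_tdeg s i t e t' : grafted s i t e t' -> tdeg t' = tdeg t + tdeg s.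
Proof.
elim=> {i t e t'} [l lft rgt m ds -> | l lft x xs rgt i e c ilt _ IH].
  by rewrite !tdegE /=; ring.
by rewrite !tdegE IH !tdegE; ring.
Qed.

Lemma grafted_nleaves s i t e t' : grafted s i t e t' ->
  (nleaves t').+1 = (nleaves t + nleaves s)%N.
Proof.
elim=> {i t e t'} [l lft rgt m ds -> | l lft x xs rgt i e c ilt _ IH];
  rewrite !nleaves_node !nlv_cat !nlv_cons ?nlv_cat /=; last first.
  by rewrite /= -/(nlv _) in IH; rewrite -/(nlv _); lia.
by rewrite -/(nlv _); lia.
Qed.

Lemma grafted_lt s i t e t' : grafted s i t e t' -> (i < nleaves t)%N.
Proof.
case=> *; rewrite nleaves_node nlv_cat nlv_cons /= -/(nlv _); lia.
Qed.

(** Arity, degree and admissibility depend on the shape and on the recorded degrees, not on the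
    vectors; functions defined by cases on them therefore remain multilinear. *)
Lemma lin_label_shape c t1 t2 t : lin_label c t1 t2 t ->
  [/\ nleaves t1 = nleaves t, nleaves t2 = nleaves t, tdeg t1 = tdeg t,
      tdeg t2 = tdeg t & forall b, admissible_at b t1 -> admissible_at b t2 ->
                                   admissible_at b t].
Proof.
elim=> {t1 t2 t} [a x y cs|a x y cs|l lft t1 t2 t rgt _ [n1 n2 d1 d2 adm]].
- split=> // [||b]; rewrite ?tdegE // !admissible_node /label_ok /=.
  by case/andP=> /andP[-> h1] -> /andP[/andP[_ h2] _]; rewrite homogZD.
- split=> // [||b]; rewrite ?tdegE // !admissible_node /label_ok /=.
  by case/andP=> /andP[-> h1] -> /andP[/andP[_ h2] _]; rewrite homogZD.
split=> [||||b]; rewrite ?tdegE ?d1 ?d2 // ?nleaves_node ?nlv_cat ?nlv_cons ?n1 ?n2 //.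
rewrite !admissible_node !all_cat /= !size_cat /=.
case/andP=> -> /andP[-> /andP[a1 ->]] /andP[_ /andP[_ /andP[a2 _]]].
by rewrite adm.
Qed.

End Graft.

(** * Associativity of grafting *)

Section GraftLaws.
Variables (k : comPzRingType) (O : opSeq k) (V : dgSeq k).
Hypothesis opO : is_dg_operad O.
Hypothesis grV : is_graded V.
Let grO : is_graded O := dg_graded (operad_seq opO).
Local Notation T := (ltree (label O V)).
Implicit Types (t s u : T) (cs ds lft rgt : seq T) (l m : label O V).

(** Here and in [grafted_sub] the computed indices of the constructors become equations, so that
    they apply up to associativity of [++] and up to arithmetic. *)
Lemma grafted_root s i t e t' l lft rgt m ds : s = Node m ds ->
  t = Node l (lft ++ Leaf :: rgt) -> i = nlv lft ->
  e = tdeg s * fdeg rgt + m.1 * fdeg lft ->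
  t' = Node (join_labels (size lft) l m) (lft ++ ds ++ rgt) ->
  grafted s i t e t'.
Proof. by move=> sE -> -> -> ->; apply: GraftRoot. Qed.

Lemma grafted_sub s i t e t' l lft d rgt i' e' c :
  grafted s i' d e' c ->
  t = Node l (lft ++ d :: rgt) -> i = (nlv lft + i')%N ->
  e = e' + tdeg s * fdeg rgt -> t' = Node l (lft ++ c :: rgt) ->
  grafted s i t e t'.
Proof.
move=> g -> -> -> ->; have := grafted_lt g.
by case: d g => [|x xs] g /=; [inversion g | move=> ?; apply: GraftSub].
Qed.

Lemma grafted_inv s i l cs e t' : grafted s i (Node l cs) e t' ->
  (exists lft rgt m ds, [/\ s = Node m ds, cs = lft ++ Leaf :: rgt, i = nlv lft,
     e = tdeg s * fdeg rgt + m.1 * fdeg lft &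
     t' = Node (join_labels (size lft) l m) (lft ++ ds ++ rgt)]) \/
  (exists lft x xs rgt i' e' c, [/\ cs = lft ++ Node x xs :: rgt,
     i = (nlv lft + i')%N, e = e' + tdeg s * fdeg rgt,
     t' = Node l (lft ++ c :: rgt) & grafted s i' (Node x xs) e' c]).
Proof.
move=> g; inversion g; subst.
  by left; exists lft, rgt, m, ds; split.
by right; exists lft, x, xs, rgt, i0, e0, c; split.
Qed.

Lemma admissible_root s : admissible s -> exists d z ds,
  [/\ s = Node (d, inl z) ds, homog (size ds) d z & all (admissible_at false) ds].
Proof.
case: s => [//|[d [z|//]] ds] /andP[/= hz ads].
by exists d, z, ds; split.
Qed.

(** Leaves have even level, so the vertex under a leaf has odd level and its label lies in [O]. This
    is why the composition made by a grafting is always one in [O]. *)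
Lemma admissible_leaf_parent b l lft rgt :
  admissible_at b (Node l (lft ++ Leaf :: rgt)) -> exists d z,
  [/\ l = (d, inl z), homog (size lft + size rgt).+1 d z, b = true,
      all (admissible_at false) lft & all (admissible_at false) rgt].
Proof.
rewrite admissible_node all_cat size_cat /= addnS.
case: b => /=; last by rewrite /= !andbF.
by case: l => d [z|v] /andP[//= h /andP[-> ->]]; exists d, z; split.
Qed.

Lemma admissible_child b l lft c rgt :
  admissible_at b (Node l (lft ++ c :: rgt)) ->
  [/\ label_ok b (size lft + size rgt).+1 l, all (admissible_at (~~ b)) lft,
      admissible_at (~~ b) c & all (admissible_at (~~ b)) rgt].
Proof.
rewrite admissible_node all_cat size_cat /= addnS.
by case/andP=> -> /andP[-> /andP[-> ->]].
Qed.

(** The root of [s] merges with a vertex of odd level, so the children of that root keep their even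
    level. *)
Lemma grafted_admissible b s i t e t' : admissible s -> admissible_at b t ->
  grafted s i t e t' -> admissible_at b t'.
Proof.
move=> ads adt g; elim: g b adt => {i t e t'}
  [l lft rgt m ds sE b | l lft x xs rgt i e c ilt _ IH b].
  rewrite sE in ads; have [d [z [ds' [[-> <-] hz adds]]]] := admissible_root ads.
  case/admissible_leaf_parent=> a [y [-> hy -> al ar]].
  rewrite admissible_node !all_cat al ar adds !size_cat /= andbT.
  have -> : (size lft + (size ds + size rgt) = ((size lft + size rgt).+1 + size ds).-1)%N.
    by lia.
  by apply: (circ_homog opO _ hy hz); lia.
case/admissible_child=> hl al adx ar.
by rewrite admissible_node all_cat size_cat /= addnS hl al ar IH.
Qed.

Corollary grafted_admissibleT s i t e t' : admissible s -> admissible t ->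
  grafted s i t e t' -> admissible t'.
Proof. exact: (@grafted_admissible true). Qed.

(** The exponent involves degrees only, hence is common to the three graftings. Linearity of [circ]
    enters only when the altered label is the one under the leaf; that label cannot be in [V]. *)
Lemma grafted_linl b c s t1 t2 t i e t' : lin_label c t1 t2 t ->
  admissible s -> admissible_at b t1 -> grafted s i t e t' ->
  exists t1' t2', [/\ grafted s i t1 e t1', grafted s i t2 e t2' &
                      lin_label c t1' t2' t'].
Proof.
move=> L ads; elim: L b i e t' => {t1 t2 t}
  [a x y cs|a x y cs|l lft t1 t2 t rgt L IH] b i e t' ad1.
- case/grafted_inv=> [[lft [rgt [m [ds [sE csE iE eE ->]]]]]|
      [lft [v [vs [rgt [i' [e' [d [csE iE eE -> g]]]]]]]]].
    rewrite sE in ads; have [d [z [ds' [[mE _] hz _]]]] := admissible_root ads.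
    do 2 eexists; split.
    + by apply: grafted_root sE _ iE eE (erefl _); rewrite csE.
    + by apply: grafted_root sE _ iE eE (erefl _); rewrite csE.
    rewrite mE /join_labels /= (circ_linearl opO (size lft) z).
    exact: LinO.
  do 2 eexists; split.
  + by apply: grafted_sub g _ iE eE (erefl _); rewrite csE.
  + by apply: grafted_sub g _ iE eE (erefl _); rewrite csE.
  exact: LinO.
- case/grafted_inv=> [[lft [rgt [m [ds [sE csE iE eE ->]]]]]|
      [lft [v [vs [rgt [i' [e' [d [csE iE eE -> g]]]]]]]]].
    by rewrite csE in ad1; have [? [? []]] := admissible_leaf_parent ad1.
  do 2 eexists; split.
  + by apply: grafted_sub g _ iE eE (erefl _); rewrite csE.
  + by apply: grafted_sub g _ iE eE (erefl _); rewrite csE.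
  exact: LinV.
(* The altered subtree has a vertex, so it is not the leaf that receives [s]. *)
have tE : exists x xs, t = Node x xs by inversion L; do 2 eexists.
have [n1 n2 d1 d2 _] := lin_label_shape grO grV L.
case/grafted_inv=> [[lf' [rg' [m [ds [sE csE iE eE ->]]]]]|
    [lf' [v [vs [rg' [i' [e' [d [csE iE eE -> g]]]]]]]]].
- case: (cat_cons_eq csE) => [[lE tL rE]|[mid [lE rE]]|[mid [lE rE]]].
  + by case: tE => x [xs]; rewrite tL.
  + rewrite {}lE {}rE in ad1 eE csE *; do 2 eexists; split.
    * by apply: grafted_root sE _ iE _ (erefl _);
        rewrite -?catA // eE !(fdeg_cat, fdeg_cons) d1.
    * by apply: grafted_root sE _ iE _ (erefl _);
        rewrite -?catA // eE !(fdeg_cat, fdeg_cons) d2.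
    by rewrite !catA; apply: LinSub.
  rewrite {}lE {}rE in ad1 iE eE csE *; do 2 eexists; split.
  + apply: (grafted_root (lft := lft ++ t1 :: mid) sE _ _ _ (erefl _));
      rewrite -?catA // ?iE ?eE !(nlv_cat, fdeg_cat, nlv_cons, fdeg_cons) ?d1 ?n1 //.
  + apply: (grafted_root (lft := lft ++ t2 :: mid) sE _ _ _ (erefl _));
      rewrite -?catA // ?iE ?eE !(nlv_cat, fdeg_cat, nlv_cons, fdeg_cons) ?d2 ?n2 //.
  by rewrite !size_cat /= -!catA; apply: LinSub.
case: (cat_cons_eq csE) => [[lE tL rE]|[mid [lE rE]]|[mid [lE rE]]].
- subst lf' rg' t; have [_ _ adx _] := admissible_child ad1.
  have [t1' [t2' [g1 g2 L']]] := IH _ _ _ _ adx g.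
  exists (Node l (lft ++ t1' :: rgt)), (Node l (lft ++ t2' :: rgt)); split.
  + exact: grafted_sub g1 _ iE eE (erefl _).
  + exact: grafted_sub g2 _ iE eE (erefl _).
  exact: LinSub.
- rewrite {}lE {}rE in ad1 eE csE *; do 2 eexists; split.
  + by apply: grafted_sub g _ iE _ (erefl _);
      rewrite -?catA // eE !(fdeg_cat, fdeg_cons) d1.
  + by apply: grafted_sub g _ iE _ (erefl _);
      rewrite -?catA // eE !(fdeg_cat, fdeg_cons) d2.
  by rewrite -!cat_cons !catA; apply: LinSub.
rewrite {}lE {}rE in ad1 iE eE csE *; do 2 eexists; split.
- apply: (grafted_sub (lft := lft ++ t1 :: mid) g _ _ eE (erefl _));
    rewrite -?catA // iE !(nlv_cat, nlv_cons) n1 //.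
- apply: (grafted_sub (lft := lft ++ t2 :: mid) g _ _ eE (erefl _));
    rewrite -?catA // iE !(nlv_cat, nlv_cons) n2 //.
by rewrite -!catA; apply: LinSub.
Qed.

(** The altered label is either the root of [s], where [circ] is linear on the right, or lies in the
    forest above it, which is moved unchanged. *)
Lemma grafted_linr b c s1 s2 s t i e t' : lin_label c s1 s2 s ->
  admissible s1 -> admissible_at b t -> grafted s i t e t' ->
  exists t1' t2', [/\ grafted s1 i t e t1', grafted s2 i t e t2' &
                      lin_label c t1' t2' t'].
Proof.
move=> L ads; have [n1 n2 d1 d2 _] := lin_label_shape grO grV L.
move=> adt g; elim: g b adt => {i t e t'}
  [l lft rgt m ds sE b | l lft x xs rgt i e d ilt _ IH b].
  case/admissible_leaf_parent=> a [y [-> _ _ _ _]].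
  have [z [zs [z' [s1E _ _]]]] := admissible_root ads.
  inversion L; subst; try by [].
  - case: H => ? ? ?; subst a0 x z'; case: H1 => ? ?; subst m ds; do 2 eexists; split.
    + by apply: grafted_root (erefl _) _ (erefl _) _ (erefl _); rewrite ?d1.
    + by apply: grafted_root (erefl _) _ (erefl _) _ (erefl _); rewrite ?d2.
    rewrite /join_labels /= (circ_linearr opO); exact: LinO.
  case: H0 => ? ?; subst l0 z'; case: H2 => ? ?; subst m ds; do 2 eexists; split.
  - by apply: grafted_root (erefl _) _ (erefl _) _ (erefl _); rewrite ?d1.
  - by apply: grafted_root (erefl _) _ (erefl _) _ (erefl _); rewrite ?d2.
  by rewrite -!catA /= !(catA lft); apply: LinSub.
case/admissible_child=> _ _ /IH[t1' [t2' [g1 g2 L']]] _.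
do 2 eexists; split; last by apply: LinSub L'.
- by apply: grafted_sub g1 _ _ _ (erefl _); rewrite ?d1.
- by apply: grafted_sub g2 _ _ _ (erefl _); rewrite ?d2.
Qed.

(** The sequential axiom of [O] is used when [u] sits on the root of [s] and [s] on the vertex
    reached in [t]; otherwise both orders build literally the same tree. The exponents agree as
    integers. *)
Lemma grafted_seq b s u t i j e1 e2 t1 s1 :
  admissible s -> admissible u -> admissible_at b t ->
  grafted s i t e1 t1 -> grafted u j s e2 s1 ->
  exists e3 e4 t2, [/\ grafted u (i + j) t1 e3 t2, grafted s1 i t e4 t2 &
                       e1 + e3 = e2 + e4].
Proof.
move=> ads adu adt g1 g2; have dS := grafted_tdeg g2.
elim: g1 b adt => {i t e1 t1} [l lft rgt m ds sE b | l lft x xs rgt i e c ilt g1 IH b].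
  case/admissible_leaf_parent=> a [y [-> hy _ _ _]].
  rewrite sE in ads g2 dS *; have [d [z [ds' [[mE dsE] hz _]]]] := admissible_root ads.
  subst ds'.
  rewrite {}mE in sE g2 ads hz dS *.
  case/grafted_inv: g2 => [[lf' [rg' [n [us [uE csE jE -> s1E]]]]]|
      [lf' [v [vs [rg' [j' [e' [q [csE jE -> s1E g]]]]]]]]].
    rewrite uE in adu; have [du [w [us' [[nE usE] hw _]]]] := admissible_root adu.
    subst us'.
    rewrite {}nE in uE s1E hw *.
    (* Both exponents are those of [GraftRoot]; in the second one the grafted tree is [s1], of
       degree [tdeg u + tdeg s]. *)
    exists (tdeg u * fdeg (rg' ++ rgt) + du * fdeg (lft ++ lf')),
      ((tdeg u + tdeg s) * fdeg rgt + (d + du) * fdeg lft); eexists; split.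
    - apply: (grafted_root (lft := lft ++ lf') 
        (rgt := rg' ++ rgt) (l := join_labels (size lft) (a, inl y) (d, inl z))
        uE _ _ (erefl _) (erefl _)).
        by rewrite csE -!catA.
      by rewrite nlv_cat jE.
    - apply: (grafted_root s1E (erefl _) (erefl _)).
        by rewrite dS -sE [tdeg u + _]addrC.
      rewrite -!catA /join_labels /= size_cat; congr (Node (_, inl _) _).
        by rewrite addrA.
      symmetry; apply: (circ_seq opO _ _ hy hz hw); first by lia.
      by rewrite csE size_cat /=; lia.
    by rewrite sE csE !tdegE /=; ring.
  have dq := grafted_tdeg g.
  exists (e' + tdeg u * fdeg (rg' ++ rgt)),
    ((tdeg u + tdeg s) * fdeg rgt + d * fdeg lft); eexists; split.
  - apply: (grafted_sub (lft := lft ++ lf') 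
      (rgt := rg' ++ rgt) (l := join_labels (size lft) (a, inl y) (d, inl z)) g _ _ (erefl _) (erefl _)).
      by rewrite csE -!catA.
    by rewrite nlv_cat jE addnA.
  - apply: (grafted_root s1E (erefl _) (erefl _)).
      by rewrite dS -sE [tdeg u + _]addrC.
    by rewrite -!catA.
  by rewrite sE csE !tdegE /=; ring.
case/admissible_child=> _ _ adx _.
have [e3 [e4 [t2 [g3 g4 E]]]] := IH _ adx.
exists (e3 + tdeg u * fdeg rgt), (e4 + tdeg s1 * fdeg rgt); eexists; split.
- by apply: grafted_sub g3 (erefl _) _ (erefl _) (erefl _); rewrite addnA.
- exact: grafted_sub g4 (erefl _) (erefl _) (erefl _) (erefl _).
by rewrite addrACA E dS; ring.
Qed.

(* With t1 = t2, [lin_label (c - 1)] expresses that a label is multiplied by c. *)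
Lemma lin_label_scale c a x cs :
  lin_label (c - 1) (Node (a, inl x) cs : T) (Node (a, inl x) cs)
    (Node (a, inl (c *: x)) cs).
Proof.
have -> : c *: x = (c - 1) *: x + x by rewrite scalerBl scale1r subrK.
exact: LinO.
Qed.

(** The coefficient is 0, written so as to match the exponent [e = 0] in [grafted_par], where the
    two trees coincide. *)
Lemma lin_label_refl l cs : lin_label (sg k 0 - 1) (Node l cs : T) (Node l cs) (Node l cs).
Proof.
rewrite sg0 subrr; case: l => a [x|v].
  by have := LinO 0 a x x cs; rewrite scale0r add0r.
by have := LinV 0 a v v cs; rewrite scale0r add0r.
Qed.

(* When both leaves hang from the same vertex, the two results differ by the
   sign of the parallel axiom in O, which is carried by the label there. *)
Lemma grafted_par b s u t i j e1 e2 t1 t2 :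
  admissible s -> admissible u -> admissible_at b t -> (j < i)%N ->
  grafted s i t e1 t1 -> grafted u j t e2 t2 ->
  exists e3 e4 e t3 t4 x, [/\ grafted u j t1 e3 t3,
    grafted s (i + nleaves u).-1 t2 e4 t4, lin_label (sg k e - 1) t4 t4 t3 &
    e1 + e3 + e = tdeg s * tdeg u + e2 + e4 + x * 2].
Proof.
move=> ads adu + + g1; elim: g1 b j e2 t2 => {i t e1 t1}
  [l lft rgt m ds sE|l lft v vs rgt i e c ilt g1 IH] b j e2 t2 adt ji.
- case/admissible_leaf_parent: adt => a [y [lE hy _ _ _]]; subst l.
  have [d [z [ds' [sE' hz _]]]] := admissible_root ads.
  move: sE'; rewrite {1}sE => -[mE dsE]; subst m ds'.
  case/grafted_inv=> [[lf' [rg' [n [us [uE csE jE -> ->]]]]]|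
      [lf' [v [vs [rg' [j' [e' [q [csE jE -> -> g]]]]]]]]].
  + have [lE rE] : exists mid, lft = lf' ++ Leaf :: mid /\ rg' = mid ++ Leaf :: rgt.
      case: (cat_cons_eq csE) => [[lE _ rE]|//|[mid [lE rE]]]; move: ji; rewrite jE lE.
        by rewrite ltnn.
      by rewrite nlv_cat; lia.
    case: rE => lE' rE; subst rg' lft.
    have [du [w [us' [uE' hw _]]]] := admissible_root adu.
    move: uE'; rewrite {1}uE => -[nE usE]; subst n us'.
    (* [d * du] is the exponent in the parallel axiom of [O]; the last witness is half of the
       discrepancy between the two sides, which agree only modulo 2. *)
    do 2 eexists; exists (d * du); do 2 eexists; exists (- d * fdeg us); split.
    * apply: (grafted_root (lft := lf') (rgt := lE ++ ds ++ rgt)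
        (l := join_labels (size (lf' ++ Leaf :: lE)) (a, inl y) (d, inl z))
        uE _ jE (erefl _) (erefl _)).
      by rewrite -catA.
    * apply: (grafted_root (lft := lf' ++ us ++ lE) (rgt := rgt)
        (l := join_labels (size lf') (a, inl y) (du, inl w))
        sE _ _ (erefl _) (erefl _)).
        by rewrite -!catA.
      by rewrite uE !(nlv_cat, nlv_cons, nleaves_node) /=; lia.
    * rewrite /join_labels /= -!catA -addrA [du + d]addrC addrA.
      have -> : circ (size lf') (circ (size (lf' ++ Leaf :: lE)) y z) w =
        sg k (d * du) *: circ (size (lf' ++ us ++ lE)) (circ (size lf') y w) z.
        rewrite (circ_par opO _ _ hy hz hw) ?size_cat /=; [|lia|lia].
        by congr (_ *: circ _ _ _); rewrite ?size_cat /=; lia.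
      exact: lin_label_scale.
    by rewrite uE sE !tdegE /=; ring.
  have [mid [lE rE]] : exists mid, lft = lf' ++ Node v vs :: mid /\ rg' = mid ++ Leaf :: rgt.
    case: (cat_cons_eq csE) => [[_ //]|//|[mid [lE rE]]]; move: ji; rewrite jE lE.
    by rewrite nlv_cat; lia.
  subst rg' lft; have dq := grafted_tdeg g; have nq := grafted_nleaves g.
  do 2 eexists; exists 0; do 2 eexists; exists (- d * tdeg u); split.
  + apply: (grafted_sub (lft := lf') (rgt := mid ++ ds ++ rgt)
      (l := join_labels (size (lf' ++ Node v vs :: mid)) (a, inl y) (d, inl z))
      g _ jE (erefl _) (erefl _)).
    by rewrite -catA.
  + apply: (grafted_root (lft := lf' ++ q :: mid) (rgt := rgt) (l := (a, inl y))
      sE _ _ (erefl _) (erefl _)).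
      by rewrite -!catA.
    by rewrite !(nlv_cat, nlv_cons); lia.
  + by rewrite !size_cat /= -!catA; apply: lin_label_refl.
  by rewrite sE !tdegE dq /= !tdegE; ring.
have dc := grafted_tdeg g1; have nc := grafted_nleaves g1.
case/admissible_child: (adt) => _ _ adv _.
case/grafted_inv=> [[lf' [rg' [n [us [uE csE jE -> ->]]]]]|
    [lf' [w [ws [rg' [j' [e' [q [csE jE -> -> g]]]]]]]]].
- have [mid [lE rE]] : exists mid, lft = lf' ++ Leaf :: mid /\ rg' = mid ++ Node v vs :: rgt.
    case: (cat_cons_eq csE) => [[_ //]|//|[mid [lE rE]]]; move: ji; rewrite jE lE.
    by rewrite nlv_cat nlv_cons nleaves_node; lia.
  subst rg' lft.
  do 2 eexists; exists 0; do 2 eexists; exists 0; split.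
  + apply: (grafted_root (lft := lf') (rgt := mid ++ c :: rgt) (l := l)
      uE _ jE (erefl _) (erefl _)).
    by rewrite -catA.
  + apply: (grafted_sub (lft := lf' ++ us ++ mid) (rgt := rgt)
      (l := join_labels (size lf') l n) g1 _ _ (erefl _) (erefl _)).
      by rewrite -!catA.
    by rewrite uE !(nlv_cat, nlv_cons, nleaves_node) /=; lia.
  + by rewrite -!catA; apply: lin_label_refl.
  by rewrite !tdegE dc !tdegE; ring.
have dq := grafted_tdeg g; have nq := grafted_nleaves g.
case: (cat_cons_eq csE) => [[lE vE rE]|[mid [lE rE]]|[mid [lE rE]]].
- case: vE => ? ?; subst w ws lf' rg'; rewrite jE in ji *.
  have j'i : (j' < i)%N by lia.
  have [e3 [e4 [e0 [t3 [t4 [x [g3 g4 L E]]]]]]] := IH _ _ _ _ adv j'i g.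
  exists (e3 + tdeg u * fdeg rgt), (e4 + tdeg s * fdeg rgt), e0.
  exists (Node l (lft ++ t3 :: rgt)), (Node l (lft ++ t4 :: rgt)), x; split.
  + exact: grafted_sub g3 (erefl _) (erefl _) (erefl _) (erefl _).
  + by apply: grafted_sub g4 (erefl _) _ (erefl _) (erefl _); lia.
  + exact: LinSub L.
  transitivity ((e + e3 + e0) + (tdeg s + tdeg u) * fdeg rgt); first by ring.
  by rewrite E; ring.
- subst rg' lft.
  do 2 eexists; exists 0; do 2 eexists; exists 0; split.
  + apply: (grafted_sub (lft := lf') (rgt := mid ++ c :: rgt) (l := l)
      g _ jE (erefl _) (erefl _)).
    by rewrite -catA.
  + apply: (grafted_sub (lft := lf' ++ q :: mid) (rgt := rgt) (l := l)
      g1 _ _ (erefl _) (erefl _)).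
      by rewrite -!catA.
    by rewrite !(nlv_cat, nlv_cons, nleaves_node) /=; move: nq; rewrite nleaves_node; lia.
  + by rewrite -!catA; apply: lin_label_refl.
  by rewrite !tdegE dc !tdegE; ring.
by move: ji; rewrite jE lE nlv_cat nlv_cons nleaves_node; lia.
Qed.

End GraftLaws.

(** * The coproduct as a graded operad *)

(** The axioms of [is_dg_operad] that do not mention the differential: they are shared by all
    twistings of one coproduct and make sense for the dual numbers. *)
Record is_graded_operad (k : comPzRingType) (Q : opSeq k) : Prop := IsGradedOperad {
  go_graded : is_graded Q;
  go_linl : forall i (y : Q), linear (fun x : Q => circ i x y);
  go_linr : forall i (x : Q), linear (fun y : Q => circ i x y);
  go_homog : forall i p q a b (x y : Q), (i < p)%N ->
    homog p a x -> homog q b y -> homog (p + q).-1 (a + b) (circ i x y);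
  go_id : homog 1 0 (op_id Q);
  go_seq : forall i j p q r a b c (x y z : Q), (i < p)%N -> (j < q)%N ->
    homog p a x -> homog q b y -> homog r c z ->
    circ i x (circ j y z) = circ (i + j) (circ i x y) z;
  go_par : forall i j p q n a b c (x y z : Q), (j < i)%N -> (i < p)%N ->
    homog p a x -> homog q b y -> homog n c z ->
    circ j (circ i x y) z = sg k (b * c) *: circ (i + n).-1 (circ j x z) y;
  go_idl : forall n a (x : Q), homog n a x -> circ 0 (op_id Q) x = x;
  go_idr : forall i n a (x : Q), (i < n)%N -> homog n a x ->
    circ i x (op_id Q) = x }.

(** The zero differential is a placeholder. The other fields are convertible with those of every
    [twisted_coprod], so the operad axioms transfer as they are. *)
Definition graded_coprod (k : comPzRingType) (O : opSeq k) (V : dgSeq k) : opSeq k := {|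
  op_seq := {|
    car := coprod O V : lmodType k;
    proj := fun n a =>
      ext (fun t => if (nleaves t == n) && (tdeg t == a) then tcls t else 0);
    diff := fun=> 0 |};
  circ := @coprod_circ k O V;
  op_id := coprod_id O V |}.

Section CoprodOperad.
Variables (k : comPzRingType) (O : opSeq k) (V : dgSeq k).
Hypothesis opO : is_dg_operad O.
Hypothesis grV : is_graded V.
Let grO : is_graded O := dg_graded (operad_seq opO).
Local Notation T := (ltree (label O V)).
Local Notation C := (graded_coprod O V).
Implicit Types (t s u : T) (cs ds lft rgt : seq T) (l m : label O V).

Lemma eval_tree (M : lmodType k) (f : T -> M) t :
  eval f [:: (1, t)] = if admissible t then f t else 0.
Proof. by rewrite /eval big_cons big_nil /=; case: ifP; rewrite // addr0 scale1r. Qed.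

Lemma ext_tcls (M : lmodType k) (f : T -> M) t :
  multilinear f -> admissible t -> ext f (tcls t) = f t.
Proof. by move=> mf adt; rewrite ext_cls // eval_tree adt. Qed.

Lemma tcls_nadm t : ~~ admissible t -> tcls t = 0.
Proof.
move=> nad; apply: coprodP => M f mf.
by rewrite [RHS]ext_zero // ext_cls // eval_tree (negbTE nad).
Qed.

Lemma ext_linear (M : lmodType k) (f : T -> M) : multilinear f -> linear (ext f).
Proof. by move=> mf c q r; rewrite [LHS]ext_add // ext_scale. Qed.

Lemma ext_eq (M : lmodType k) (f g : T -> M) (q : coprod O V) :
  (forall t, admissible t -> f t = g t) -> ext f q = ext g q.
Proof. by move=> fg; apply: eq_bigr => e /fg ->. Qed.

Lemma ext_lincomb (M : lmodType k) c (f g : T -> M) (q : coprod O V) :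
  ext (fun t => c *: f t + g t) q = c *: ext f q + ext g q.
Proof.
rewrite /ext /eval scaler_sumr -big_split; apply: eq_bigr => e _ /=.
by rewrite scalerDr !scalerA mulrC.
Qed.

Lemma multilinear_tcls : multilinear (@tcls k O V).
Proof.
move=> c t1 t2 t ad1 ad2 L; have [_ _ _ _ adm] := lin_label_shape grO grV L.
apply: coprodP => M f mf; have /= lf := ext_linear mf.
rewrite lf !ext_tcls //; [exact: mf ad1 ad2 L | exact: adm].
Qed.

(** Multilinear functionals separate elements, and each gives on both sides the same sum over the
    representative. Hence tree classes span, which is [coprod_ind]. *)
Lemma ext_tclsK (q : coprod O V) : ext (@tcls k O V) q = q.
Proof.
apply: coprodP => M f mf.
have -> : ext (@tcls k O V) q = \sum_(e <- rep q | admissible e.2) e.1 *: tcls e.2 by [].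
rewrite (lin_sum (ext_linear mf)).
by apply: eq_bigr => e ade; rewrite (linZ (ext_linear mf)) ext_tcls.
Qed.

Lemma coprod_ind (Q : coprod O V -> Prop) :
  Q 0 -> (forall c x y, Q x -> Q y -> Q (c *: x + y)) ->
  (forall t, admissible t -> Q (tcls t)) -> forall x, Q x.
Proof.
move=> Q0 QD Qt x; rewrite -[x]ext_tclsK; apply: (big_ind Q) => // [y z Qy Qz|e ade].
  by rewrite -[y]scale1r; apply: QD.
by rewrite -[_ *: _]addr0; apply: QD => //; apply: Qt.
Qed.

Lemma multilinear_proj n a : multilinear (fun t : T =>
  if (nleaves t == n) && (tdeg t == a) then tcls t else 0 : coprod O V).
Proof.
move=> c t1 t2 t ad1 ad2 L; have [-> -> -> -> _] := lin_label_shape grO grV L.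
by case: ifP => _; [exact: multilinear_tcls | rewrite scaler0 addr0].
Qed.

Lemma coprod_proj_linear n a : linear (@proj k C n a).
Proof. exact: ext_linear (multilinear_proj n a). Qed.

Lemma coprod_proj_tcls n a t :
  @proj k C n a (tcls t) = if (nleaves t == n) && (tdeg t == a) then tcls t else 0.
Proof.
case: (boolP (admissible t)) => [adt|/tcls_nadm ->].
  by rewrite [LHS]ext_tcls //; apply: multilinear_proj.
by rewrite (lin0 (coprod_proj_linear n a)) if_same.
Qed.

(** A homogeneous element is its own projection, and the projection of a tree class is that class or
    0. *)
Lemma homog_ind n a (Q : coprod O V -> Prop) :
  Q 0 -> (forall c x y, Q x -> Q y -> Q (c *: x + y)) ->
  (forall t, admissible t -> nleaves t = n -> tdeg t = a -> Q (tcls t)) ->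
  forall x : C, homog n a x -> Q x.
Proof.
move=> Q0 QD Qt x /eqP <-; move: x; apply: coprod_ind => [|c x y Qx Qy|t adt].
- by rewrite (lin0 (coprod_proj_linear n a)).
- by rewrite coprod_proj_linear; apply: QD.
rewrite coprod_proj_tcls; case: ifP => // /andP[/eqP ? /eqP ?]; exact: Qt.
Qed.

Lemma coprod_graded : is_graded C.
Proof.
split=> [|n a m b x|x]; first exact: coprod_proj_linear.
  move: x; apply: coprod_ind => [|c x y Qx Qy|t adt].
  - by rewrite !(lin0 (coprod_proj_linear _ _)) if_same.
  - rewrite !coprod_proj_linear Qx Qy.
    by case: ifP => // _; rewrite scaler0 addr0.
  rewrite coprod_proj_tcls; case: (boolP ((nleaves t == m) && _)) => [/andP[/eqP <- /eqP <-]|_].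
    by rewrite coprod_proj_tcls [n == _]eq_sym [a == _]eq_sym.
  by rewrite (lin0 (coprod_proj_linear _ _)) if_same.
(* The index list collects the arities and degrees of the terms of the representative; the induction
   runs over the terms with the list generalized to any duplicate-free one covering them. *)
pose deg (e : k * T) := (nleaves e.2, tdeg e.2).
exists (undup (map deg (rep x))); split; first exact: undup_uniq.
rewrite -[LHS]ext_tclsK /proj /= /ext /eval.
have sub : all (fun d => d \in undup (map deg (rep x))) (map deg (rep x)).
  by apply/allP => d dx; rewrite mem_undup.
elim: (rep x) (undup _) (undup_uniq (map deg (rep x))) sub => [|e u IH] s us /=.
  by rewrite big_nil big1 // => j _; rewrite big_nil.
case/andP=> es sub; rewrite big_cons.
under [RHS]eq_bigr do rewrite big_cons.
case: ifP => ade; last exact: IH.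
rewrite big_split -(IH _ us sub) /=; congr (_ + _).
rewrite (bigD1_seq (deg e)) //= !eqxx /= big1 ?addr0 // => j nj.
case: ifP; last by rewrite scaler0.
by case/andP=> /eqP nE /eqP dE; rewrite /deg nE dE -surjective_pairing eqxx in nj.
Qed.

Lemma homog_tcls t : @homog k C (nleaves t) (tdeg t) (tcls t).
Proof. by rewrite /homog coprod_proj_tcls !eqxx. Qed.

Lemma homog_tclsE n a t : nleaves t = n -> tdeg t = a -> @homog k C n a (tcls t).
Proof. by move=> <- <-; apply: homog_tcls. Qed.

Lemma grafted_ex i t s : admissible t -> admissible s -> (i < nleaves t)%N ->
  exists e t', grafted s i t e t' /\ admissible t'.
Proof.
move=> adt ads it; have [d [z [ds [sE _ _]]]] := admissible_root ads.
have [] := graftP (d, inl z) ds (t := t) (i := i) _ it; first by move=> tE; rewrite tE in adt.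
rewrite -sE => e [t' g]; exists e, t'; split=> //.
exact: (grafted_admissibleT opO ads adt g).
Qed.

Let graft_cls i t s : coprod O V :=
  if (i < nleaves t)%N then sg k (graft s i t).1 *: tcls (graft s i t).2 else 0.

Let graft_cls_linr i t : admissible t -> multilinear (graft_cls i t).
Proof.
move=> adt c s1 s2 s ad1 ad2 L; rewrite /graft_cls.
case: ifP => it; last by rewrite scaler0 addr0.
have [_ _ _ _ adm] := lin_label_shape grO grV L.
have [e [t' [g _]]] := grafted_ex adt (adm _ ad1 ad2) it.
have [t1 [t2 [g1 g2 L']]] := grafted_linr opO grV L ad1 adt g.
rewrite (grafted_graft g) (grafted_graft g1) (grafted_graft g2) /=.
rewrite (multilinear_tcls _ _ L'); first by rewrite scalerDr !scalerA mulrC.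
  exact: (grafted_admissibleT opO ad1 adt g1).
exact: (grafted_admissibleT opO ad2 adt g2).
Qed.

Let graft_cls_linl i (r : coprod O V) : multilinear (fun t => ext (graft_cls i t) r).
Proof.
move=> c t1 t2 t ad1 ad2 L; rewrite -ext_lincomb; apply: ext_eq => s ads.
have [n1 n2 _ _ adm] := lin_label_shape grO grV L; rewrite /graft_cls n1 n2.
case: ifP => it; last by rewrite scaler0 addr0.
have [e [t' [g _]]] := grafted_ex (adm _ ad1 ad2) ads it.
have [t1' [t2' [g1 g2 L']]] := grafted_linl opO grV L ads ad1 g.
rewrite (grafted_graft g) (grafted_graft g1) (grafted_graft g2) /=.
rewrite (multilinear_tcls _ _ L'); first by rewrite scalerDr !scalerA mulrC.
  exact: (grafted_admissibleT opO ads ad1 g1).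
exact: (grafted_admissibleT opO ads ad2 g2).
Qed.

Lemma circ_tcls i t s e t' : admissible t -> admissible s -> grafted s i t e t' ->
  @circ k C i (tcls t) (tcls s) = sg k e *: tcls t'.
Proof.
move=> adt ads g; rewrite [LHS](ext_tcls (graft_cls_linl i (tcls s)) adt).
rewrite (ext_tcls (graft_cls_linr i adt) ads) /graft_cls (grafted_lt g).
by rewrite (grafted_graft g).
Qed.

(** [circ] is total; this covers the remaining indices in the weight estimate [wspan_circ]. *)
Lemma circ_tcls_out i t s : admissible t -> admissible s -> (nleaves t <= i)%N ->
  @circ k C i (tcls t) (tcls s) = 0.
Proof.
move=> adt ads ti; rewrite [LHS](ext_tcls (graft_cls_linl i (tcls s)) adt).
by rewrite (ext_tcls (graft_cls_linr i adt) ads) /graft_cls ltnNge ti.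
Qed.

Lemma coprod_circ_linearl i (y : C) : linear (fun x : C => circ i x y).
Proof. exact: ext_linear (graft_cls_linl i y). Qed.

Lemma coprod_circ_linearr i (x : C) : linear (fun y : C => circ i x y).
Proof.
move=> c y z; move: x; apply: coprod_ind => [|d x x' Hx Hx'|t adt].
- by rewrite !(lin0 (coprod_circ_linearl i _)) scaler0 addr0.
- rewrite (coprod_circ_linearl i (c *: y + z)) Hx Hx'.
  rewrite (coprod_circ_linearl i y) (coprod_circ_linearl i z).
  by rewrite !scalerDr !scalerA addrACA [c * d]mulrC.
rewrite /circ /= /coprod_circ !(ext_tcls (graft_cls_linl i _) adt).
exact: (ext_linear (graft_cls_linr i adt)).
Qed.

Lemma admissible_id : admissible (id_tree O V).
Proof. by rewrite /admissible /= /label_ok /= (op_id_homog opO). Qed.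

Lemma coprod_circ_homog i p q a b (x y : C) : (i < p)%N ->
  homog p a x -> homog q b y -> homog (p + q).-1 (a + b) (circ i x y).
Proof.
move=> ip hx hy; move: x hx; apply: homog_ind => [|c x z|t adt tn td].
- by rewrite (lin0 (coprod_circ_linearl i _)) homog0 //; apply: coprod_graded.
- by rewrite coprod_circ_linearl; apply: homogZD; apply: coprod_graded.
move: y hy; apply: homog_ind => [|c x z|s ads sn sd].
- by rewrite (lin0 (coprod_circ_linearr i _)) homog0 //; apply: coprod_graded.
- by rewrite coprod_circ_linearr; apply: homogZD; apply: coprod_graded.
subst p a q b; have [e [t' [g adt']]] := grafted_ex adt ads ip.
rewrite (circ_tcls adt ads g); apply: homogZ; first exact: coprod_graded.
by rewrite -(grafted_nleaves g) -(grafted_tdeg g) homog_tcls.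
Qed.

Lemma coprod_operad : is_graded_operad C.
Proof.
have ZD (M : lmodType k) c (x y x' y' : M) : x = x' -> y = y' -> c *: x + y = c *: x' + y'.
  by move=> -> ->.
have ll := coprod_circ_linearl; have lr := coprod_circ_linearr.
split; [exact: coprod_graded|exact: ll|exact: lr|exact: coprod_circ_homog|..].
- by apply: homog_tclsE => //; rewrite !tdegE.
- move=> i j p q r a b c x y z ip jq hx hy hz.
  move: x hx; apply: homog_ind => [|d x x' Hx Hx'|t adt tn td].
  + by rewrite !(lin0 (ll _ _)).
  + by rewrite !(ll i) ll Hx Hx'.
  move: y hy; apply: homog_ind => [|d x x' Hx Hx'|s ads sn sd].
  + by rewrite (lin0 (ll _ _)) !(lin0 (lr _ _)) (lin0 (ll _ _)).
  + by rewrite ll !(lr i) ll Hx Hx'.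
  move: z hz; apply: homog_ind => [|d x x' Hx Hx'|u adu un ud].
  + by rewrite !(lin0 (lr _ _)).
  + by rewrite !(lr j) !(lr i) !lr Hx Hx'.
  subst p q r a b c.
  have [e1 [t1 [g1 ad1]]] := grafted_ex adt ads ip.
  have [e2 [s1 [g2 ad2]]] := grafted_ex ads adu jq.
  have [e3 [e4 [t2 [g3 g4 E]]]] := grafted_seq opO ads adu adt g1 g2.
  rewrite (circ_tcls adt ads g1) (circ_tcls ads adu g2) (linZ (lr i _)).
  rewrite (linZ (ll (i + j)%N _)) (circ_tcls adt ad2 g4) (circ_tcls ad1 adu g3).
  by rewrite !scalerA -!sgD E.
- move=> i j p q n a b c x y z ji ip hx hy hz.
  move: x hx; apply: homog_ind => [|d x x' Hx Hx'|t adt tn td].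
  + by rewrite !(lin0 (ll _ _)) scaler0.
  + by rewrite (ll i) !(ll j) ll Hx Hx' scalerDr !scalerA mulrC.
  move: y hy; apply: homog_ind => [|d x x' Hx Hx'|s ads sn sd].
  + by rewrite !(lin0 (lr _ _)) (lin0 (ll _ _)) scaler0.
  + by rewrite !lr ll Hx Hx' scalerDr !scalerA mulrC.
  move: z hz; apply: homog_ind => [|d x x' Hx Hx'|u adu un ud].
  + by rewrite !(lin0 (lr _ _)) (lin0 (ll _ _)) scaler0.
  + by rewrite !(lr j) ll Hx Hx' scalerDr !scalerA mulrC.
  subst p q n a b c.
  have [e1 [t1 [g1 ad1]]] := grafted_ex adt ads ip.
  have [e2 [t2 [g2 ad2]]] := grafted_ex adt adu (ltn_trans ji ip).
  have [e3 [e4 [e [t3 [t4 [x [g3 g4 L E]]]]]]] := grafted_par opO ads adu adt ji g1 g2.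
  have ad4 := grafted_admissibleT opO ads ad2 g4.
  rewrite (circ_tcls adt ads g1) (circ_tcls adt adu g2) !(linZ (ll _ _)).
  rewrite (circ_tcls ad1 adu g3) (circ_tcls ad2 ads g4) !scalerA -!sgD.
  (* The relation with coefficient [sg k e - 1] says that the class of [t3] is [sg k e] times that
     of [t4]. *)
  rewrite (multilinear_tcls ad4 ad4 L) scalerBl scale1r subrK scalerA -sgD.
  by rewrite (sg_even k E).
- move=> n a; apply: homog_ind => [|d x x' Hx Hx'|t adt tn td].
  + by rewrite (lin0 (lr _ _)).
  + by rewrite (lr 0%N) Hx Hx'.
  have [d [z [ds [tE hz _]]]] := admissible_root adt.
  have g : grafted t 0 (id_tree O V) 0 t.
    apply: (grafted_root (lft := [::]) (rgt := [::]) tE (erefl _) (erefl _)).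
      by rewrite !tdegE; ring.
    by rewrite cats0 /join_labels /= add0r (circ_idl opO hz).
  by rewrite [LHS](circ_tcls admissible_id adt g) scale1r.
move=> i n a x iN; move: x; apply: homog_ind => [|d x x' Hx Hx'|t adt tn td].
- by rewrite (lin0 (ll _ _)).
- by rewrite (ll i) Hx Hx'.
rewrite -tn in iN.
have [e [t' [g _]]] := grafted_ex adt admissible_id iN.
rewrite [LHS](circ_tcls adt admissible_id g).
suff [-> ->] : e = 0 /\ t' = t by rewrite scale1r.
(* The induction descends to subtrees, whose root level alternates; hence the generalization over
   [b]. *)
rewrite /admissible in adt; move: true adt g => b.
have sd0 : tdeg (id_tree O V) = 0 by rewrite !tdegE.
have sE : id_tree O V = id_tree O V by [].
rewrite {2}/id_tree in sE; move: (id_tree O V) sE sd0 => s sE sd0 + g.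
elim: g b => {i t e t' iN tn td} [l lft rgt m ds sE' b|l lft v vs rgt i e c _ _ IH b].
  case/admissible_leaf_parent=> d [z [-> hz _ _ _]].
  move: sE'; rewrite sE => -[<- <-] /=; rewrite -sE sd0 !mul0r; split=> //.
  rewrite /join_labels /= addr0 (circ_idr opO _ hz) //; lia.
by case/admissible_child=> _ _ /IH[-> ->] _; rewrite sd0 mul0r.
Qed.

End CoprodOperad.

(** * The universal property of the coproduct *)

Section Gamma.
Variables (k : comPzRingType) (Q : opSeq k).
Hypothesis opQ : is_graded_operad Q.
Implicit Types (acc m z : Q) (ys zs lft rgt : seq (nat * int * Q)).

(* The entries to be inserted into an operation come with arity and degree. *)
Fixpoint gamma (i : nat) acc ys : Q :=
  if ys is y :: ys' then gamma (i + y.1.1)%N (circ i acc y.2) ys' else acc.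

Definition arity ys : nat := sumn [seq y.1.1 | y <- ys].
Definition degree ys : int := \sum_(y <- ys) y.1.2.
Definition homogs ys : bool := all (fun y => homog y.1.1 y.1.2 y.2) ys.

Lemma arity_nil : arity [::] = 0%N. Proof. by []. Qed.

Lemma arity_cons y ys : arity (y :: ys) = (y.1.1 + arity ys)%N.
Proof. by []. Qed.

Lemma degree_cons y ys : degree (y :: ys) = y.1.2 + degree ys.
Proof. exact: big_cons. Qed.

Lemma gamma_cat i acc ys zs :
  gamma i acc (ys ++ zs) = gamma (i + arity ys) (gamma i acc ys) zs.
Proof.
elim: ys i acc => [|y ys IH] i acc /=; first by rewrite arity_nil addn0.
by rewrite IH arity_cons addnA.
Qed.

Lemma gamma_linear i ys : linear (fun acc => gamma i acc ys).
Proof.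
by elim: ys i => [|y ys IH] i c x x' //=; rewrite (go_linl opQ) IH.
Qed.

Lemma gamma_homog i p a acc ys : (i + size ys <= p)%N -> homogs ys ->
  homog p a acc ->
  homog (p + arity ys - size ys) (a + degree ys) (gamma i acc ys).
Proof.
elim: ys i p a acc => [|[[n b] y] ys IH] i p a acc /=.
  by rewrite arity_nil !addn0 subn0 /degree big_nil addr0.
move=> ip /andP[/= hy hys] hacc; rewrite degree_cons arity_cons /= addrA.
have -> : (p + (n + arity ys) - (size ys).+1 = (p + n).-1 + arity ys - size ys)%N.
  lia.
by apply: IH => //; [lia | apply: go_homog => //; lia].
Qed.

(** [z] enters to the left of all the entries: the parallel axiom moves it past each of them, with
    the product of the degrees as exponent. *)
Lemma gamma_circ_before i q p n a c acc z ys : (q < i)%N ->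
  (i + size ys <= p)%N -> homogs ys -> homog p a acc -> homog n c z ->
  circ q (gamma i acc ys) z =
  sg k (c * degree ys) *: gamma (i + n).-1 (circ q acc z) ys.
Proof.
elim: ys i p a acc => [|[[m b] y] ys IH] i p a acc qi /= ip.
  by rewrite /degree big_nil mulr0 scale1r.
case/andP=> /= hy hys hacc hz.
rewrite (IH (i + m)%N (p + m).-1 (a + b)) //; try lia; last first.
  by apply: go_homog => //; lia.
rewrite (go_par opQ qi _ hacc hy hz); last by lia.
rewrite (linZ (gamma_linear _ _)) scalerA -sgD degree_cons /=.
rewrite mulrDr [b * c]mulrC addrC.
by rewrite (_ : (i + m + n).-1 = ((i + n).-1 + m)%N) //; lia.
Qed.

(** The mirror case: the slot of [z] lies to the right of those filled by [ys], and its number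
    shifts as they are filled. *)
Lemma gamma_circ_after i r p n a c acc z ys :
  (i + size ys + r < p)%N -> homogs ys -> homog p a acc -> homog n c z ->
  gamma i (circ (i + size ys + r) acc z) ys =
  sg k (c * degree ys) *: circ (i + arity ys + r) (gamma i acc ys) z.
Proof.
elim: ys i p a acc => [|[[m b] y] ys IH] i p a acc ip /=.
  by rewrite /degree big_nil mulr0 scale1r.
case/andP=> /= hy hys hacc hz; rewrite /= in ip.
rewrite (go_par opQ _ _ hacc hz hy); [|lia|lia].
rewrite (linZ (gamma_linear _ _)).
rewrite (_ : (i + (size ys).+1 + r + m).-1 = (i + m + size ys + r)%N); last by lia.
rewrite (IH _ (p + m).-1 (a + b)) //; [|lia|by apply: go_homog => //; lia].
by rewrite scalerA -sgD degree_cons arity_cons /= mulrDr !addnA.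
Qed.

Lemma circ_gamma i j p q a b acc m ys : (i < p)%N -> (j + size ys <= q)%N ->
  homogs ys -> homog p a acc -> homog q b m ->
  circ i acc (gamma j m ys) = gamma (i + j) (circ i acc m) ys.
Proof.
elim: ys j q b m => [|[[n c] y] ys IH] j q b m ip jq //=.
case/andP=> /= hy hys hacc hm; rewrite /= in jq.
rewrite (IH _ (q + n).-1 (b + c)) //; [|lia|by apply: go_homog => //; lia].
by rewrite (go_seq opQ ip _ hacc hm hy) ?addnA //; lia.
Qed.

(** The counterpart of [GraftSub]: [z] jumps over the entries to the right of the one that receives
    it, then the sequential axiom puts it into that entry. *)
Lemma gamma_insert j p n a b c nz acc y z lft rgt :
  (size lft + (size rgt).+1 <= p)%N -> (j < n)%N ->
  homogs lft -> homogs rgt -> homog p a acc -> homog n b y -> homog nz c z ->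
  circ (arity lft + j) (gamma 0 acc (lft ++ (n, b, y) :: rgt)) z =
  sg k (c * degree rgt) *:
    gamma 0 acc (lft ++ ((n + nz).-1, b + c, circ j y z) :: rgt).
Proof.
move=> ip jn hl hr hacc hy hz; rewrite !gamma_cat /= !add0n.
have hg : homog (p + arity lft - size lft) (a + degree lft) (gamma 0 acc lft).
  by apply: gamma_homog => //; lia.
rewrite (gamma_circ_before (p := (p + arity lft - size lft + n).-1)
  (a := a + degree lft + b) _ _ hr _ hz); [|lia|lia|by apply: go_homog => //; lia].
rewrite (go_seq opQ _ jn hg hy hz); last by lia.
by rewrite (_ : (arity lft + n + nz).-1 = (arity lft + (n + nz).-1)%N) //; lia.
Qed.

(** The counterpart of [GraftRoot]: [m] moves past the entries of [lft], then takes [ys] as its own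
    entries. The degree [d] recorded in the new entry is free, as [gamma] reads only arities and
    elements. *)
Lemma gamma_merge p a b d acc m ys lft rgt :
  (size lft + (size rgt).+1 <= p)%N ->
  homogs lft -> homogs ys -> homogs rgt -> homog p a acc -> homog (size ys) b m ->
  gamma 0 (circ (size lft) acc m) (lft ++ ys ++ rgt) =
  sg k (b * degree lft) *:
    gamma 0 acc (lft ++ (arity ys, d, gamma 0 m ys) :: rgt).
Proof.
move=> ip hl hy hr hacc hm; rewrite !gamma_cat /= !add0n.
rewrite (_ : size lft = (0 + size lft + 0)%N); last by rewrite addn0.
rewrite (gamma_circ_after _ hl hacc hm); last by lia.
rewrite !(linZ (gamma_linear _ _)) !addn0 add0n; congr (_ *: _).
rewrite (circ_gamma (p := p + arity lft - size lft) (a := a + degree lft) _ _ hy _ hm)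
  ?addn0 //; first by lia.
by apply: gamma_homog => //; lia.
Qed.

Lemma gamma_entry_linear i acc n b lft rgt :
  linear (fun z => gamma i acc (lft ++ (n, b, z) :: rgt)).
Proof.
by move=> c y z; rewrite !gamma_cat /= (go_linr opQ) (gamma_linear _ _).
Qed.

End Gamma.

Section Compose.

Fixpoint tmap (X Y : Type) (f : nat -> X -> Y) (t : ltree X) : ltree Y :=
  if t is Node x cs then Node (f (size cs) x) (map (tmap f) cs) else Leaf.

(** A named copy of the anonymous inner fixpoint of [relabel], for inductions on forests;
    [compose_forest] plays this role for [compose]. *)
Fixpoint relabel_forest (X Y : Type) (f : nat -> nat -> X -> Y) (k : nat)
    (cs : seq (ltree X)) : seq (ltree Y) :=
  if cs is c :: cs' then
    relabel f k c :: relabel_forest f (k + size (labels c))%N cs'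
  else [::].

Lemma relabel_node (X Y : Type) (f : nat -> nat -> X -> Y) k x cs :
  relabel f k (Node x cs) = Node (f k (size cs) x) (relabel_forest f k.+1 cs).
Proof. by rewrite /=; congr Node; elim: cs k.+1 => //= c cs IH j; rewrite IH. Qed.

Lemma relabel_tmap (X Y : Type) (f : nat -> X -> Y) k t :
  relabel (fun=> f) k t = tmap f t.
Proof.
elim/ltree_nested_ind: t k => // x cs IH k; rewrite relabel_node /=; congr Node.
elim: cs k.+1 IH => {k} //= c cs IHcs k [Hc Hcs].
by rewrite Hc IHcs.
Qed.

Fixpoint compose_forest (C : Type) (circ : nat -> C -> C -> C) (id : C)
    (i : nat) (acc : C) (cs : seq (ltree C)) : C :=
  if cs is c :: cs' then
    compose_forest circ id (i + nleaves c)%N (circ i acc (compose circ id c)) cs'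
  else acc.

Lemma compose_node (C : Type) (circ : nat -> C -> C -> C) (id : C) x cs :
  compose circ id (Node x cs) = compose_forest circ id 0 x cs.
Proof. by rewrite /=; elim: cs 0%N x => //= c cs IH i x; rewrite IH. Qed.

Lemma nleaves_tmap (X Y : Type) (f : nat -> X -> Y) t : nleaves (tmap f t) = nleaves t.
Proof.
elim/ltree_nested_ind: t => //= x cs; elim: cs => //= c cs IH [-> Hcs].
by rewrite IH.
Qed.

Lemma tmap_tmap (X Y Z : Type) (m : nat -> X -> Y) (m' : nat -> Y -> Z) t :
  tmap m' (tmap m t) = tmap (fun n x => m' n (m n x)) t.
Proof.
elim/ltree_nested_ind: t => //= x cs IH; rewrite size_map; congr Node.
by elim: cs IH => //= c cs IHcs [-> Hcs]; rewrite IHcs.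
Qed.

Lemma tmap_id (X : Type) (f : X -> X) t : (forall x, f x = x) -> tmap (fun=> f) t = t.
Proof.
move=> fE; elim/ltree_nested_ind: t => //= x cs IH; rewrite fE; congr Node.
by elim: cs IH => //= c cs IHcs [-> /IHcs ->].
Qed.

End Compose.

(** The data of the universal property: a graded operad map on [O] and a degree 0 map on [V]. They
    are given separately for each arity and degree, as for [in_label], and linearity is asked within
    one homogeneous component. *)
Record is_generator_map (k : comPzRingType) (O : opSeq k) (V : dgSeq k)
    (Q : opSeq k) (phi : nat -> label O V -> Q) : Prop := IsGeneratorMap {
  gen_homog : forall b n l, label_ok b n l -> homog n l.1 (phi n l);
  gen_linO : forall n a c (x y : O), homog n a x -> homog n a y ->
    phi n (a, inl (c *: x + y)) = c *: phi n (a, inl x) + phi n (a, inl y);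
  gen_linV : forall n a c (x y : V), homog n a x -> homog n a y ->
    phi n (a, inr (c *: x + y)) = c *: phi n (a, inr x) + phi n (a, inr y);
  gen_circ : forall i p q a b (x y : O), (i < p)%N ->
    homog p a x -> homog q b y ->
    phi (p + q).-1 (a + b, inl (circ i x y)) =
    circ i (phi p (a, inl x)) (phi q (b, inl y));
  gen_id : phi 1 (0, inl (op_id O)) = op_id Q }.

Section Universal.
Variables (k : comPzRingType) (O : opSeq k) (V : dgSeq k) (Q : opSeq k).
Hypothesis opO : is_dg_operad O.
Hypothesis grV : is_graded V.
Hypothesis opQ : is_graded_operad Q.
Variable phi : nat -> label O V -> Q.
Hypothesis genphi : is_generator_map phi.
Let grO : is_graded O := dg_graded (operad_seq opO).
Let grQ := go_graded opQ.
Local Notation T := (ltree (label O V)).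
Local Notation C := (graded_coprod O V).
Implicit Types (t s : T) (cs : seq T).

Definition ucomp t : Q := compose (@circ k Q) (op_id Q) (tmap phi t).
Definition entries cs := [seq (nleaves c, tdeg c, ucomp c) | c <- cs].

Lemma size_entries cs : size (entries cs) = size cs. Proof. exact: size_map. Qed.

Lemma entries_cat cs ds : entries (cs ++ ds) = entries cs ++ entries ds.
Proof. exact: map_cat. Qed.

Lemma arity_entries cs : arity (entries cs) = nlv cs.
Proof. by rewrite /arity /entries -map_comp. Qed.

Lemma degree_entries cs : degree (entries cs) = fdeg cs.
Proof. by rewrite /degree /fdeg big_map. Qed.

Lemma ucomp_node l cs : ucomp (Node l cs) = gamma 0 (phi (size cs) l) (entries cs).
Proof.
rewrite /ucomp compose_node; move: 0%N (phi _ _) => i acc.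
by elim: cs i acc => //= c cs IH i acc; rewrite nleaves_tmap IH.
Qed.

Lemma ucomp_homog b t : admissible_at b t -> homog (nleaves t) (tdeg t) (ucomp t).
Proof.
elim/ltree_nested_ind: t b => [|l cs IH] b; first by rewrite tdegE => _; apply: (go_id opQ).
rewrite admissible_node => /andP[hl hcs].
have hent : homogs (entries cs).
  elim: cs IH hcs {hl} => //= c cs IHcs [Hc Hcs] /andP[adc adcs].
  by rewrite IHcs // andbT (Hc _ adc).
have := gamma_homog opQ (i := 0) _ hent (gen_homog genphi hl).
rewrite ucomp_node size_entries arity_entries degree_entries tdegE addKn.
by apply.
Qed.

Lemma homogs_entries b cs : all (admissible_at b) cs -> homogs (entries cs).
Proof.
by elim: cs => //= c cs IH /andP[/ucomp_homog -> /IH ->].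
Qed.

Lemma ucomp_leaf : ucomp Leaf = op_id Q. Proof. by []. Qed.

(** This compatibility makes the induced map an operad map. At a root grafting, [gen_circ] splits
    the composed label, [gamma_merge] regroups the children of [s], and [s] is then inserted into
    the identity that stands for the leaf. *)
Lemma ucomp_grafted b s i t e t' : admissible s -> admissible_at b t ->
  grafted s i t e t' -> ucomp t' = sg k e *: circ i (ucomp t) (ucomp s).
Proof.
move=> ads + g; elim: g b => {i t e t'} [l lft rgt m ds sE|l lft x xs rgt i e c ix g IH] b.
  have [d [z [ds' [+ hz hds]]]] := admissible_root ads; rewrite {1}sE => -[mE dsE].
  subst m ds'; case/admissible_leaf_parent=> a [y [-> hy _ hl hr]].
  have hs := ucomp_homog ads.
  rewrite !ucomp_node !entries_cat /join_labels /=.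
  rewrite (_ : size (lft ++ ds ++ rgt) = ((size lft + size rgt).+1 + size ds).-1); last first.
    by rewrite !size_cat; lia.
  rewrite (gen_circ genphi _ hy hz); last by lia.
  have hy' := gen_homog genphi (b := true) (l := (a, inl y)) hy.
  have hz' : homog (size (entries ds)) d (phi (size ds) (d, inl z)).
    by rewrite size_entries; apply: (gen_homog genphi (b := true) (l := (d, inl z)) hz).
  have sl : size lft = size (entries lft) by rewrite size_entries.
  rewrite [in circ (size lft)]sl.
  rewrite (gamma_merge opQ (tdeg s) _ _ _ _ hy' hz') ?size_entries //;
    [|by lia|exact: homogs_entries hl|exact: homogs_entries hds|exact: homogs_entries hr].
  rewrite size_cat /= addnS ucomp_leaf tdeg_leaf.
  rewrite -[nlv lft]addn0 -arity_entries.
  rewrite (gamma_insert opQ _ _ _ _ hy' (go_id opQ) hs) ?size_entries //;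
    [|by lia|exact: homogs_entries hl|exact: homogs_entries hr].
  rewrite (go_idl opQ hs) scalerA -sgD !degree_entries.
  rewrite (_ : (1 + nleaves s).-1 = arity (entries ds)) ?arity_entries ?sE // -sE add0r.
  congr (_ *: _); last by rewrite sE ucomp_node.
  (* The exponent [tdeg s * fdeg rgt] occurs twice on the right, once from the grafting and once
     from [gamma_insert]. *)
  by apply: (sg_even _ (x := - (tdeg s * fdeg rgt))); ring.
move=> adt; case/admissible_child: (adt) => hl al adx ar.
have hl' := gen_homog genphi hl; have hx := ucomp_homog adx; have hs := ucomp_homog ads.
have nc : nleaves c = (nleaves (Node x xs) + nleaves s).-1 by rewrite -(grafted_nleaves g).
rewrite !ucomp_node !entries_cat [entries (c :: _)]/= [entries (_ :: _)]/= (IH _ adx).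
rewrite !size_cat [size (_ :: _)]/= [size (_ :: _)]/= !addnS nc (grafted_tdeg g).
rewrite (linZ (gamma_entry_linear opQ _ _ _ _ _ _)) -arity_entries.
rewrite (gamma_insert opQ _ ix _ _ hl' hx hs) ?size_entries //;
  [|by rewrite addnS|exact: homogs_entries al|exact: homogs_entries ar].
rewrite scalerA -sgD degree_entries.
by congr (_ *: _); apply: (sg_even _ (x := - (tdeg s * fdeg rgt))); ring.
Qed.

Lemma ucomp_linear b c t1 t2 t : admissible_at b t1 -> admissible_at b t2 ->
  lin_label c t1 t2 t -> ucomp t = c *: ucomp t1 + ucomp t2.
Proof.
move=> + + L; elim: L b => {t1 t2 t} [a x y cs|a x y cs|l lft t1 t2 t rgt L IH] b.
- rewrite !admissible_node /label_ok /= => /andP[/andP[_ hx] _] /andP[/andP[_ hy] _].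
  by rewrite !ucomp_node (gen_linO genphi _ hx hy) (gamma_linear opQ).
- rewrite !admissible_node /label_ok /= => /andP[/andP[_ hx] _] /andP[/andP[_ hy] _].
  by rewrite !ucomp_node (gen_linV genphi _ hx hy) (gamma_linear opQ).
have [n1 n2 d1 d2 _] := lin_label_shape grO grV L.
case/admissible_child=> _ _ ad1 _ /admissible_child[_ _ ad2 _].
rewrite !ucomp_node !entries_cat !size_cat /= (IH _ ad1 ad2) n1 n2 d1 d2.
exact: (gamma_entry_linear opQ).
Qed.

Definition umap : coprod O V -> Q := ext ucomp.

Lemma ucomp_multilinear : multilinear ucomp.
Proof. by move=> c t1 t2 t ad1 ad2; apply: ucomp_linear ad1 ad2. Qed.

Lemma umap_linear : linear umap.
Proof. exact: (ext_linear ucomp_multilinear). Qed.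

Lemma umap_tcls t : admissible t -> umap (tcls t) = ucomp t.
Proof. exact: (ext_tcls ucomp_multilinear). Qed.

Lemma umap_homog n a (x : C) : homog n a x -> homog n a (umap x).
Proof.
move: x; apply: (homog_ind opO grV) => [|c x y hx hy|t adt <- <-].
- by rewrite (lin0 umap_linear) homog0.
- by rewrite umap_linear homogZD.
by rewrite umap_tcls //; apply: ucomp_homog adt.
Qed.

Lemma umap_circ i p q a b (x y : C) : (i < p)%N -> homog p a x -> homog q b y ->
  umap (circ i x y) = circ i (umap x) (umap y).
Proof.
have opC := coprod_operad opO grV.
move=> ip hx hy; move: x hx; apply: (homog_ind opO grV) => [|c x x' Hx Hx'|t adt tn _].
- by rewrite (lin0 (go_linl opC _ _)) (lin0 umap_linear) (lin0 (go_linl opQ _ _)).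
- by rewrite (go_linl opC) !umap_linear (go_linl opQ) Hx Hx'.
move: y hy; apply: (homog_ind opO grV) => [|c x x' Hx Hx'|s ads sn _].
- by rewrite (lin0 (go_linr opC _ _)) (lin0 umap_linear) (lin0 (go_linr opQ _ _)).
- by rewrite (go_linr opC) !umap_linear (go_linr opQ) Hx Hx'.
rewrite -tn in ip; have [e [t' [g adt']]] := grafted_ex opO adt ads ip.
rewrite (circ_tcls opO grV adt ads g) (linZ umap_linear) !umap_tcls //.
by rewrite (ucomp_grafted ads adt g) scalerA sg2 scale1r.
Qed.

Lemma gamma_ids n acc a : homog n a acc ->
  gamma 0 acc (nseq n (1%N, 0, op_id Q)) = acc.
Proof.
move=> hacc; suff H i j : (i + j <= n)%N ->
  gamma i acc (nseq j (1%N, 0 : int, op_id Q)) = acc by apply: H.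
elim: j i => //= j IH i ij; rewrite (go_idr opQ _ hacc); last by lia.
by apply: IH; lia.
Qed.

Lemma umap_inO n a (x : O) : homog n a x ->
  umap (inO V n a x) = phi n (a, inl x).
Proof.
move=> hx; rewrite /inO umap_tcls; last first.
  by rewrite /admissible admissible_node /label_ok /= size_nseq hx all_nseq orbT.
rewrite ucomp_node size_nseq /entries map_nseq tdegE /=; apply: (@gamma_ids n _ a).
exact: (gen_homog genphi (b := true) (l := (a, inl x)) hx).
Qed.

Lemma ucomp_id : ucomp (id_tree O V) = op_id Q.
Proof.
by rewrite ucomp_node /= ucomp_leaf (gen_id genphi) (go_idl opQ (go_id opQ)).
Qed.

Lemma umap_id : umap (coprod_id O V) = op_id Q.
Proof. by rewrite umap_tcls ?ucomp_id //; apply: admissible_id. Qed.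

Lemma umap_inV n a (v : V) : homog n a v ->
  umap (inV O n a v) = phi n (a, inr v).
Proof.
move=> hv; have ok : label_ok false n ((a, inr v) : label O V) by [].
have hphi := gen_homog genphi ok.
have adI : admissible_at true (id_tree O V) := admissible_id V opO.
rewrite /inV umap_tcls; last first.
  rewrite /admissible !admissible_node /label_ok /= (op_id_homog opO) size_nseq ok.
  by rewrite all_nseq adI orbT.
rewrite ucomp_node /= (gen_id genphi) ucomp_node size_nseq /entries map_nseq.
rewrite ucomp_id (_ : (_, _, _) = (1%N, 0 : int, op_id Q)); last by rewrite !tdegE.
by rewrite (gamma_ids hphi) (go_idl opQ hphi).
Qed.

End Universal.

(** * Generation of the coproduct by [O] and [V] *)

Section Generators.
Variables (k : comPzRingType) (O : opSeq k) (V : dgSeq k).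
Hypothesis opO : is_dg_operad O.
Hypothesis grV : is_graded V.
Local Notation T := (ltree (label O V)).
Local Notation C := (graded_coprod O V).
Let opC : is_graded_operad C := coprod_operad opO grV.
Implicit Types (t s : T) (cs ds : seq T).

Lemma fdeg_leaves n : fdeg (nseq n (Leaf : T)) = 0.
Proof. by elim: n => [|n IH]; [exact: fdeg_nil | rewrite /= fdeg_cons IH !tdegE]. Qed.

Lemma fdeg_ids n : fdeg (nseq n (id_tree O V)) = 0.
Proof. by elim: n => [|n IH]; [exact: fdeg_nil | rewrite /= fdeg_cons IH !tdegE]. Qed.

Lemma nlv_leaves n : nlv (nseq n (Leaf : T)) = n.
Proof. by elim: n => //= n IH; rewrite nlv_cons IH. Qed.

Lemma nlv_ids n : nlv (nseq n (id_tree O V)) = n.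
Proof. by elim: n => //= n IH; rewrite nlv_cons IH. Qed.

Lemma admissible_inO n a (x : O) : homog n a x ->
  admissible (Node ((a, inl x) : label O V) (nseq n Leaf)).
Proof.
by move=> hx; rewrite /admissible admissible_node /label_ok /= size_nseq hx all_nseq orbT.
Qed.

Lemma admissible_inV n a (v : V) : homog n a v ->
  admissible (Node ((0, inl (op_id O)) : label O V)
                   [:: Node (a, inr v) (nseq n (id_tree O V))]).
Proof.
move=> hv; have ok : label_ok false n ((a, inr v) : label O V) by [].
rewrite /admissible !admissible_node /label_ok /= (op_id_homog opO) size_nseq ok.
by rewrite all_nseq (admissible_id V opO : admissible_at true _) orbT.
Qed.

(** The universal property can now be applied to the coproduct itself; the resulting map is the
    identity, by [ucomp_in_label]. *)
Lemma in_label_generator : is_generator_map (Q := C) (@in_label k O V).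
Proof.
split=> [b n [a [x|v]] /= ok|n a c x y hx hy|n a c x y hx hy|i p q a b x y ip hx hy|].
- by apply: (homog_tclsE opO grV); rewrite ?nleaves_node ?nlv_leaves ?tdegE ?fdeg_leaves //= addr0.
- apply: (homog_tclsE opO grV); first by rewrite nleaves_node nlv_cons nleaves_node nlv_ids addn0.
  by rewrite !tdegE fdeg_ids /= !addr0 add0r.
- apply: (multilinear_tcls opO grV); [exact: admissible_inO|exact: admissible_inO|].
  exact: LinO.
- apply: (multilinear_tcls opO grV); [exact: admissible_inV|exact: admissible_inV|].
  by apply: (LinSub _ [::] [::]); apply: LinV.
- rewrite [RHS](circ_tcls opO grV (e := 0) (t' := Node (a + b, inl (circ i x y))
    (nseq i Leaf ++ nseq q Leaf ++ nseq (p - i.+1) Leaf))).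
  + rewrite scale1r /in_label /= /inO -!nseqD.
    by congr (tcls (Node _ (nseq _ _))); lia.
  + exact: admissible_inO.
  + exact: admissible_inO.
  + apply: (grafted_root (lft := nseq i Leaf) (rgt := nseq (p - i.+1) Leaf)
      (l := (a, inl x)) (erefl _)).
    * by rewrite -[Leaf :: _]/(nseq (p - i.+1).+1 Leaf) -nseqD;
        congr (Node _ (nseq _ _)); lia.
    * by rewrite nlv_leaves.
    * by rewrite !fdeg_leaves !mulr0.
    by rewrite size_nseq.
by [].
Qed.

(** A subtree whose root is labeled in [V] gives an element of the coproduct only after a vertex
    labeled by the identity is put under it, as in [inV]. *)
Let wrap t : T := Node (0, inl (op_id O)) [:: t].

(** Both root levels are treated at once, because the induction alternates between them. *)
Let ucomp_in t :
  (admissible_at true t -> ucomp (Q := C) (@in_label k O V) t = tcls t) /\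
  (admissible_at false t -> ucomp (Q := C) (@in_label k O V) t = tcls (wrap t)).
Proof.
have okid : label_ok true 1 ((0, inl (op_id O)) : label O V).
  by rewrite /label_ok /= (op_id_homog opO).
have adI : admissible_at true (id_tree O V) := admissible_id V opO.
elim/ltree_nested_ind: t => [|[a [x|v]] cs IH]; first by split.
  split=> //; rewrite admissible_node => /andP[hx hcs].
  rewrite ucomp_node /= /inO.
  (* The children are inserted from left to right: [done] is in place and leaves stand for the
     others. No sign arises, as only leaves lie to the right and the bottom label of the inserted
     tree is the identity, of degree 0. *)
  have H done : all (admissible_at false) done ->
      label_ok true (size (done ++ cs)) ((a, inl x) : label O V) ->
      gamma (Q := C) (nlv done) (tcls (Node (a, inl x) (done ++ nseq (size cs) Leaf)))
        (entries (Q := C) (@in_label k O V) cs) = tcls (Node (a, inl x) (done ++ cs)).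
    elim: cs IH hcs {hx} done => [|c cs IHcs] //= [[_ Hc] Hcs] /andP[adc adcs] done ad hx.
    rewrite (Hc adc).
    rewrite [coprod_circ _ _ _](circ_tcls opO grV (e := 0) (t' := Node (a, inl x) (rcons done c ++ nseq (size cs) Leaf))).
    - rewrite scale1r -nlv_cat_rcons IHcs //; rewrite ?all_rcons ?adc ?cat_rcons //.
    - rewrite /admissible admissible_node all_cat ad /= all_nseq orbT andbT.
      by move: hx; rewrite !size_cat /= size_nseq.
    - by rewrite /admissible admissible_node okid /= adc.
    - apply: (grafted_root (lft := done) (rgt := nseq (size cs) Leaf) (l := (a, inl x))
        (erefl _) (erefl _) (erefl _)).
        by rewrite fdeg_leaves mulr0 mul0r.
      rewrite cat_rcons /join_labels /= addr0 (circ_idr opO (n := size (done ++ c :: cs)) (a := a)) //.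
      by rewrite size_cat /=; lia.
  exact: (H [::]).
split=> // /andP[hv hcs]; rewrite ucomp_node /= /inV.
(* Here identity trees stand for the children still to be inserted, again of degree 0. *)
have H done : all (admissible_at true) done ->
    label_ok false (size (done ++ cs)) ((a, inr v) : label O V) ->
    gamma (Q := C) (nlv done) (tcls (wrap (Node (a, inr v) (done ++ nseq (size cs) (id_tree O V)))))
      (entries (Q := C) (@in_label k O V) cs) = tcls (wrap (Node (a, inr v) (done ++ cs))).
  elim: cs IH hcs {hv} done => [|c cs IHcs] //= [[Hc _] Hcs] /andP[adc adcs] done ad hv.
  rewrite (Hc adc).
  rewrite [coprod_circ _ _ _](circ_tcls opO grV (e := 0)
    (t' := wrap (Node (a, inr v) (rcons done c ++ nseq (size cs) (id_tree O V))))) //.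
  - by rewrite scale1r -nlv_cat_rcons IHcs ?cat_rcons // all_rcons; apply/andP.
  - rewrite /admissible /wrap admissible_node okid all_seq1.
    rewrite admissible_node all_cat ad -[_ :: _]/(nseq (size cs).+1 (id_tree O V)).
    rewrite all_nseq adI orbT !andbT size_cat size_nseq.
    by rewrite size_cat in hv.
  - have [d [z [ds [cE hz _]]]] := admissible_root adc.
    have g : grafted c 0 (id_tree O V) 0 c.
      apply: (grafted_root (lft := [::]) (rgt := [::]) cE (erefl _) (erefl _)).
        by rewrite !tdegE; ring.
      by rewrite cats0 /join_labels /= add0r (circ_idl opO hz).
    have g' : grafted c (nlv done) (Node (a, inr v) (done ++ id_tree O V :: nseq (size cs) (id_tree O V)))
        0 (Node (a, inr v) (rcons done c ++ nseq (size cs) (id_tree O V))).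
      apply: (grafted_sub g (erefl _)); rewrite ?addn0 ?cat_rcons //.
      by rewrite fdeg_ids mulr0.
    apply: (grafted_sub (lft := [::]) (rgt := [::]) g' (erefl _)) => //.
    by rewrite tdegE mulr0.
exact: (H [::]).
Qed.

Lemma ucomp_in_label t : admissible t -> ucomp (Q := C) (@in_label k O V) t = tcls t.
Proof. by have [H _] := ucomp_in t. Qed.

Definition weight t : nat := count (fun l : label O V => if l.2 is inr _ then true else false) (labels t).

Lemma weight_node l cs : weight (Node l cs) =
  ((if l.2 is inr _ then 1 else 0) + sumn (map weight cs))%N.
Proof.
rewrite /weight /=; congr (_ + _)%N; first by case: l.2.
by elim: cs => //= c cs IH; rewrite count_cat IH.
Qed.

(** By [ucomp_in_label] a tree is a composition of generators, and weights add up under composition.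
    A constant family gives [gen_ind]; the weights serve for local nilpotence. *)
Lemma tree_ind (P : nat -> coprod O V -> Prop) :
  (forall n a (x : O), homog n a x -> P 0%N (inO V n a x)) ->
  (forall n a (v : V), homog n a v -> P 1%N (inV O n a v)) ->
  (forall i p q a b w w' (x y : C), (i < p)%N -> homog p a x -> homog q b y ->
     P w x -> P w' y -> P (w + w')%N (@circ k C i x y)) ->
  forall t, admissible t -> P (weight t) (tcls t).
Proof.
move=> PO PV Pc t adt; rewrite -(ucomp_in_label adt); rewrite /admissible in adt; move: true adt => b.
have gen := in_label_generator.
elim/ltree_nested_ind: t b => [|l cs IH] b; first by move=> _; apply: (PO 1%N 0 _ (op_id_homog opO)).
rewrite admissible_node => /andP[hl hcs].
rewrite ucomp_node weight_node.
have hl' := gen_homog gen hl.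
have Pl : P (if l.2 is inr _ then 1 else 0)%N (in_label (size cs) l).
  by case: l hl {hl'} => a [x|v] /andP[_ h]; [apply: PO | apply: PV].
suff H i p a w acc : (i + size cs <= p)%N -> @homog k C p a acc -> P w acc ->
    P (w + sumn (map weight cs))%N
      (gamma (Q := C) i acc (entries (Q := C) (@in_label k O V) cs)).
  exact: (H 0%N (size cs) l.1 _ _ (leqnn _) hl' Pl).
elim: cs i p a w acc IH hcs {hl hl' Pl} => [|c cs IHcs] i p a w acc /= IH hcs ip hacc Pacc.
  by rewrite addn0.
case: IH hcs => Hc Hcs /andP[adc adcs].
have hc := ucomp_homog opC gen adc.
rewrite addnA; apply: (IHcs _ (p + nleaves c).-1 (a + tdeg c)) => //; first by lia.
  by apply: (go_homog opC) => //; lia.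
by apply: (Pc _ _ _ _ _ _ _ _ _ _ hacc hc) => //; [lia | apply: Hc adc].
Qed.

Lemma gen_ind (P : coprod O V -> Prop) :
  P 0 -> (forall c x y, P x -> P y -> P (c *: x + y)) ->
  (forall n a (x : O), homog n a x -> P (inO V n a x)) ->
  (forall n a (v : V), homog n a v -> P (inV O n a v)) ->
  (forall i p q a b (x y : C), (i < p)%N -> homog p a x -> homog q b y ->
     P x -> P y -> P (@circ k C i x y)) ->
  forall x, P x.
Proof.
move=> P0 PD PO PV Pc; apply: coprod_ind => // t adt.
by apply: (@tree_ind (fun=> P)) => // i p q a b _ _; apply: Pc.
Qed.

End Generators.

(** * Dual numbers *)

Section Dual.
(** [tau] is the sign that e acquires when it moves to the left past an element. It is a parameter
    here and is realized for the coproduct on tree classes. *)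
Variables (k : comPzRingType) (Q : opSeq k) (tau : Q -> Q).
Hypothesis opQ : is_graded_operad Q.
Hypothesis tau_linear : linear tau.
Hypothesis tauE : forall n a (x : Q), homog n a x -> tau x = sg k a *: x.
Let grQ := go_graded opQ.

(* [(x, y)] stands for x + e y, where e has degree 1 and square 0. *)
Definition dual : opSeq k := {|
  op_seq := {|
    car := (Q * Q)%type : lmodType k;
    proj := fun n a u => (proj n a u.1, proj n (a - 1) u.2);
    diff := fun=> 0 |};
  circ := fun i u v => (circ i u.1 v.1, circ i u.2 v.1 + circ i (tau u.1) v.2);
  op_id := (op_id Q, 0) |}.

Lemma dual_homog n a (u : dual) :
  homog n a u = homog n a u.1 && homog n (a - 1) u.2.
Proof. by case: u. Qed.

Lemma dual_graded : is_graded dual.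
Proof.
split=> [n a c [x x'] [y y']|n a m b [x x']|[x x']] /=.
- by rewrite !(proj_linear grQ).
- rewrite !(proj_proj grQ) (inj_eq (addIr _)).
  by case: ifP.
have [s [us xE]] := proj_sum grQ x; have [s' [us' xE']] := proj_sum grQ x'.
pose up (j : nat * int) := (j.1, j.2 + 1); pose dn (j : nat * int) := (j.1, j.2 - 1).
exists (undup (s ++ map up s')); split; first exact: undup_uniq.
have fstE (r : seq (nat * int)) (F G : nat * int -> Q) :
  \sum_(j <- r) (F j, G j) = (\sum_(j <- r) F j, \sum_(j <- r) G j).
  by elim: r => [|j r IH]; rewrite ?big_nil // !big_cons IH.
rewrite fstE; congr (_, _).
  by apply: (graded_sub grQ us _ xE) => [|j js]; rewrite ?undup_uniq // mem_undup mem_cat js.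
have idn : injective dn by move=> [i1 j1] [i2 j2] [-> /addIr ->].
rewrite -(big_map dn xpredT (fun j => proj j.1 j.2 x')).
apply: (graded_sub grQ us' _ xE') => [|j js]; first by rewrite map_inj_uniq ?undup_uniq.
apply/mapP; exists (up j); last by rewrite /dn /up /= addrK -surjective_pairing.
by rewrite mem_undup mem_cat map_f ?orbT.
Qed.

Lemma tau_homog n a (x : Q) : homog n a x -> homog n a (tau x).
Proof. by move=> hx; rewrite (tauE hx) homogZ. Qed.

Lemma dual_operad : is_graded_operad dual.
Proof.
have ll := go_linl opQ; have lr := go_linr opQ; have gh := go_homog opQ.
split; first exact: dual_graded.
- move=> i [y y'] c [x x'] [z z']; congr (_, _) => /=; first exact: ll.
  by rewrite tau_linear !ll scalerDr addrACA.
- move=> i [x x'] c [y y'] [z z']; congr (_, _) => /=; first exact: lr.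
  by rewrite !lr scalerDr addrACA.
- move=> i p q a b [x x'] [y y'] ip; rewrite !dual_homog /=.
  case/andP=> hx hx' /andP[hy hy']; rewrite gh //= homogD //.
    by rewrite (_ : a + b - 1 = (a - 1) + b); [exact: gh | ring].
  by rewrite -addrA; apply: gh => //; apply: tau_homog.
- by rewrite dual_homog /= (go_id opQ) homog0.
- move=> i j p q r a b c [x x'] [y y'] [z z'] ip jq; rewrite !dual_homog /=.
  case/andP=> hx hx' /andP[hy hy'] /andP[hz hz']; congr (_, _) => /=.
    exact: (go_seq opQ ip jq hx hy hz).
  rewrite (linD (lr i _)) (linD (ll (i + j)%N _)) addrA.
  rewrite (tauE hx) (tauE hy) (tauE (gh _ _ _ _ _ _ _ ip hx hy)).
  rewrite !(linZ (ll _ _)) !(linZ (lr _ _)).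
  rewrite (go_seq opQ ip jq hx' hy hz) (go_seq opQ ip jq hx hy' hz).
  by rewrite (go_seq opQ ip jq hx hy hz') scalerA sgD.
- move=> i j p q n a b c [x x'] [y y'] [z z'] ji ip; rewrite !dual_homog /=.
  case/andP=> hx hx' /andP[hy hy'] /andP[hz hz'].
  have jp := ltn_trans ji ip; congr (_, _) => /=.
    exact: (go_par opQ ji ip hx hy hz).
  rewrite !(linD (ll _ _)) (tauE hx).
  rewrite (tauE (gh _ _ _ _ _ _ _ ip hx hy)) (tauE (gh _ _ _ _ _ _ _ jp hx hz)).
  rewrite !(linZ (ll _ _)) (go_par opQ ji ip hx' hy hz) (go_par opQ ji ip hx hy' hz).
  rewrite (go_par opQ ji ip hx hy hz') !scalerDr !scalerA -!sgD.
  rewrite -!addrA; congr (_ + _); rewrite addrC; congr (_ *: _ + _ *: _).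
    by apply: (sg_even _ (x := 0)); ring.
  by apply: (sg_even _ (x := - c)); ring.
- move=> n a [x x']; rewrite dual_homog /= => /andP[hx hx'].
  rewrite (lin0 (ll _ _)) add0r (tauE (go_id opQ)) sg0 scale1r.
  by congr (_, _); apply: (go_idl opQ); eassumption.
move=> i n a [x x'] iN; rewrite dual_homog /= => /andP[hx hx'].
by rewrite (lin0 (lr _ _)) addr0 (go_idr opQ iN hx) (go_idr opQ iN hx').
Qed.

End Dual.

(** * The Leibniz rule as a composition of dual numbers *)

Section LeibnizSum.
Variables (k : comPzRingType) (O : opSeq k) (V : dgSeq k) (Q : opSeq k) (tau : Q -> Q).
Hypothesis opQ : is_graded_operad Q.
Hypothesis tauE : forall n a (x : Q), homog n a x -> tau x = sg k a *: x.
Variables phi psi : nat -> label O V -> Q.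
Hypothesis genphi : is_generator_map phi.
Local Notation T := (ltree (label O V)).
Implicit Types (t : T) (cs : seq T).
Local Notation cf := (compose_forest (@circ k Q) (op_id Q)).

Let mark (j r n : nat) (l : label O V) : Q := if r == j then psi n l else phi n l.

(* The Leibniz rule along a tree whose first vertex has rank [off]. *)
Definition leibniz (off : nat) t : Q :=
  \sum_(j < size (labels t)) sg k (\sum_(l <- take j (labels t)) l.1) *:
    compose (@circ k Q) (op_id Q) (relabel (mark (off + j)) off t).

Let leibniz_forest (off : nat) i acc cs : Q :=
  \sum_(j < size (flatten (map (@labels _) cs)))
    sg k (\sum_(l <- take j (flatten (map (@labels _) cs))) l.1) *:
    cf i acc (relabel_forest (mark (off + j)) off cs).

Let relabel_mark j off t : (j < off)%N || (off + size (labels t) <= j)%N ->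
  relabel (mark j) off t = tmap phi t.
Proof.
elim/ltree_nested_ind: t off => // l cs IH off; rewrite [tmap _ _]/= relabel_node => joff.
have -> : mark j off (size cs) l = phi (size cs) l.
  by rewrite /mark; case: eqP => // E; move: joff; rewrite E /=; lia.
congr Node; have : (j < off.+1)%N || (off.+1 + size (flatten (map (@labels _) cs)) <= j)%N.
  by move: joff => /=; lia.
move: off.+1 => {joff} o; elim: cs o IH => //= c cs IHcs o [Hc Hcs]; rewrite size_cat => jo.
by rewrite Hc ?IHcs //; lia.
Qed.

Let relabel_forest_mark j off cs :
  (j < off)%N || (off + size (flatten (map (@labels _) cs)) <= j)%N ->
  relabel_forest (mark j) off cs = map (tmap phi) cs.
Proof.
elim: cs off => //= c cs IHcs off; rewrite size_cat => joff.
by rewrite relabel_mark ?IHcs //; lia.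
Qed.

Let cf_linear i (ds : seq (ltree Q)) : linear (fun acc => cf i acc ds).
Proof.
by elim: ds i => [|c ds IH] i d x y //=; rewrite (go_linl opQ) IH.
Qed.

Let leibniz_node off l cs : leibniz off (Node l cs) =
  cf 0 (psi (size cs) l) (map (tmap phi) cs) +
  sg k l.1 *: leibniz_forest off.+1 0 (phi (size cs) l) cs.
Proof.
rewrite /leibniz [size _]/= big_ord_recl [take _ _]/= big_nil sg0 scale1r.
rewrite addn0 relabel_node compose_node relabel_forest_mark ?leqnn // {1}/mark eqxx.
congr (_ + _); rewrite scaler_sumr; apply: eq_bigr => j _.
rewrite lift0 [take _ _]/= big_cons sgD scalerA; congr (_ *: _).
rewrite relabel_node compose_node {1}/mark addnS addSn.
by case: eqP => // /eqP; rewrite -[X in X == _]addn0 -addnS eqn_add2l.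
Qed.

Let leibniz_forest_cons off i acc c cs : leibniz_forest off i acc (c :: cs) =
  cf (i + nleaves c) (circ i acc (leibniz off c)) (map (tmap phi) cs) +
  sg k (tdeg c) *: leibniz_forest (off + size (labels c)) (i + nleaves c)
                     (circ i acc (ucomp phi c)) cs.
Proof.
have nl j : nleaves (relabel (mark j) off c) = nleaves c.
  elim/ltree_nested_ind: c off => // l ds IH off; rewrite relabel_node !nleaves_node.
  by elim: ds off.+1 IH => // d ds IHd o [Hd Hds] /=; rewrite !nlv_cons Hd IHd.
rewrite /leibniz_forest [flatten _]/= size_cat big_split_ord /=; congr (_ + _).
  rewrite (lin_sum (go_linr opQ i acc)) (lin_sum (cf_linear _ _)).
  apply: eq_bigr => j _; rewrite (linZ (go_linr opQ _ _)) (linZ (cf_linear _ _)).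
  rewrite takel_cat ?(ltnW (ltn_ord j)) // nl relabel_forest_mark //.
  by rewrite ltn_add2l ltn_ord.
rewrite scaler_sumr; apply: eq_bigr => j _.
rewrite take_cat ltnNge leq_addr /= addKn big_cat /= sgD scalerA -/(tdeg c).
rewrite nl relabel_mark; last by rewrite leq_add2l leq_addr orbT.
by rewrite addnA.
Qed.

(** Since e squares to 0, the coefficient of e collects the compositions with exactly one label
    taken from [psi]; [tau] produces the sign of the labels before it. *)
Lemma compose_dual b t off : admissible_at b t ->
  compose (@circ k (dual tau)) (op_id (dual tau))
    (tmap (fun n l => (phi n l, psi n l) : dual tau) t) = (ucomp phi t, leibniz off t).
Proof.
elim/ltree_nested_ind: t b off => [|l cs IH] b off.
  by rewrite /leibniz big_ord0.
rewrite admissible_node => /andP[hl hcs].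
rewrite [tmap _ _]/= compose_node leibniz_node /ucomp [tmap _ _]/= compose_node.
(* Generalized to a partial composition [acc] + e [acc']: either the replaced label is already in
   [acc'], or e still has to pass [acc], of degree [a]. *)
suff H p a i acc acc' : (i + size cs <= p)%N -> homog p a acc ->
    compose_forest (@circ k (dual tau)) (op_id (dual tau)) i (acc, acc')
      (map (tmap (fun n l => (phi n l, psi n l) : dual tau)) cs) =
    (cf i acc (map (tmap phi) cs),
     cf i acc' (map (tmap phi) cs) + sg k a *: leibniz_forest off.+1 i acc cs).
  by apply: (H (size cs)) => //; apply: (gen_homog genphi hl).
elim: cs p a i acc acc' off.+1 IH hcs {hl} => [|c cs IHcs] p a i acc acc' o /=.
  by move=> _ _ _ _; rewrite /leibniz_forest big_ord0 scaler0 addr0.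
case=> Hc Hcs /andP[adc adcs] ip hacc; rewrite /= in ip.
have hc := ucomp_homog opQ genphi adc.
rewrite (Hc _ o adc) /= !nleaves_tmap (tauE hacc).
rewrite (IHcs (p + nleaves c).-1 (a + tdeg c) _ _ _ (o + size (labels c))%N) //;
  [|by lia|by apply: (go_homog opQ) => //; lia].
rewrite leibniz_forest_cons scalerDr addrA scalerA -sgD.
congr (_, _ + _); rewrite (linD (cf_linear _ _)) (linZ (go_linl opQ _ _)).
by rewrite (linZ (cf_linear _ _)).
Qed.

End LeibnizSum.

(** * Derivations of the coproduct *)

(** These are the conditions under which [(in_label n l, D n l)] is a generator map into the dual
    numbers over the coproduct. *)
Record is_der (k : comPzRingType) (O : opSeq k) (V : dgSeq k)
    (D : nat -> label O V -> coprod O V) : Prop := IsDer {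
  der_homog : forall b n l, label_ok b n l ->
    @homog k (graded_coprod O V) n (l.1 - 1) (D n l);
  der_linO : forall n a c (x y : O), homog n a x -> homog n a y ->
    D n (a, inl (c *: x + y)) = c *: D n (a, inl x) + D n (a, inl y);
  der_linV : forall n a c (x y : V), homog n a x -> homog n a y ->
    D n (a, inr (c *: x + y)) = c *: D n (a, inr x) + D n (a, inr y);
  der_circ : forall i p q a b (x y : O), (i < p)%N ->
    homog p a x -> homog q b y ->
    D (p + q).-1 (a + b, inl (circ i x y)) =
    coprod_circ i (D p (a, inl x)) (inO V q b y) +
    sg k a *: coprod_circ i (inO V p a x) (D q (b, inl y));
  der_id : D 1 (0, inl (op_id O)) = 0 }.

Section Derivation.
Variables (k : comPzRingType) (O : opSeq k) (V : dgSeq k).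
Hypothesis opO : is_dg_operad O.
Hypothesis grV : is_graded V.
Let grO : is_graded O := dg_graded (operad_seq opO).
Local Notation T := (ltree (label O V)).
Local Notation C := (graded_coprod O V).
Let opC : is_graded_operad C := coprod_operad opO grV.
Let gen := in_label_generator opO grV.

Let tau : C -> C := ext (fun t : T => sg k (tdeg t) *: tcls t : coprod O V).

Let tau_multilinear : multilinear (fun t : T => sg k (tdeg t) *: tcls t : coprod O V).
Proof.
move=> c t1 t2 t ad1 ad2 L; have [_ _ -> -> _] := lin_label_shape grO grV L.
by rewrite (multilinear_tcls opO grV ad1 ad2 L) scalerDr !scalerA mulrC.
Qed.

Let tau_linear : linear tau := ext_linear tau_multilinear.

Let tauE n a (x : C) : homog n a x -> tau x = sg k a *: x.
Proof.
move: x; apply: (homog_ind opO grV) => [|c x y Hx Hy|t adt _ <-].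
- by rewrite (lin0 tau_linear) scaler0.
- by rewrite tau_linear Hx Hy scalerDr !scalerA mulrC.
by rewrite [tau _](ext_tcls tau_multilinear).
Qed.

Let opD : is_graded_operad (dual tau) := dual_operad opC tau_linear tauE.

Variable D : nat -> label O V -> coprod O V.
Hypothesis derD : is_der D.

Let phiD n l : dual tau := (in_label n l, D n l).

Let genD : is_generator_map phiD.
Proof.
split=> [b n l ok|n a c x y hx hy|n a c x y hx hy|i p q a b x y ip hx hy|].
- by rewrite dual_homog; apply/andP; split; [exact: (gen_homog gen ok) | exact: (der_homog derD ok)].
- by congr (_, _); [apply: (gen_linO gen) hx hy | apply: (der_linO derD) hx hy].
- by congr (_, _); [apply: (gen_linV gen) hx hy | apply: (der_linV derD) hx hy].
- congr (_, _); first exact: (gen_circ gen ip hx hy).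
  have okx : label_ok true p ((a, inl x) : label O V) by [].
  rewrite (der_circ derD ip hx hy) /= (tauE (gen_homog gen okx)).
  by congr (_ + _); symmetry; apply: (linZ (go_linl opC i _)).
by congr (_, _); apply: (der_id derD).
Qed.

Lemma ext_pair (f g : T -> C) (q : coprod O V) :
  ext (fun t => (f t, g t) : dual tau) q = (ext f q, ext g q).
Proof.
rewrite /ext /eval; elim: (rep q) => [|e u IH]; first by rewrite !big_nil.
by rewrite !big_cons; case: ifP => // _; rewrite IH.
Qed.

(** By [compose_dual] the sum defining [derivation D] is the coefficient of e of the induced operad
    map, whose other component is the identity. All the properties of [derivation D] are read off
    the second component. *)
Let umap_derivation x : umap phiD x = (x, derivation D x).
Proof.
transitivity (ext (fun t : T =>
    (tcls t, leibniz (Q := C) (@in_label k O V) D 0 t) : dual tau) x); last first.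
  by rewrite ext_pair ext_tclsK.
apply: ext_eq => t adt; rewrite /ucomp (compose_dual opC tauE D gen 0 adt).
by rewrite (ucomp_in_label opO grV adt).
Qed.

Lemma derivation_tcls t : admissible t ->
  derivation D (tcls t) = leibniz (Q := C) (@in_label k O V) D 0 t.
Proof.
move=> adt; have := umap_derivation (tcls t).
rewrite (umap_tcls opO grV opD genD adt) /ucomp (compose_dual opC tauE D gen 0 adt).
by move/(congr1 snd).
Qed.

Lemma derivation_linear : linear (derivation D).
Proof.
move=> c x y; have /= := umap_linear opO grV opD genD c x y.
by rewrite !umap_derivation => -[].
Qed.

Lemma derivation_homog n a (x : C) : homog n a x ->
  @homog k C n (a - 1) (derivation D x).
Proof.
move=> hx; have := umap_homog opO grV opD genD hx.
by rewrite umap_derivation dual_homog => /andP[].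
Qed.

Lemma derivation_circ i p q a b (x y : C) : (i < p)%N ->
  homog p a x -> homog q b y ->
  derivation D (@circ k C i x y) =
  @circ k C i (derivation D x) y + sg k a *: @circ k C i x (derivation D y).
Proof.
move=> ip hx hy; have := umap_circ opO grV opD genD ip hx hy.
rewrite !umap_derivation => /(congr1 snd) E; rewrite [LHS]E; congr (_ + _).
by rewrite /= (tauE hx); apply: (linZ (go_linl opC i _)).
Qed.

Lemma derivation_inO n a (x : O) : homog n a x ->
  derivation D (inO V n a x) = D n (a, inl x).
Proof.
move=> hx; have := umap_inO opO grV opD genD hx.
by rewrite umap_derivation => -[].
Qed.

Lemma derivation_inV n a (v : V) : homog n a v ->
  derivation D (inV O n a v) = D n (a, inr v).
Proof.
move=> hv; have := umap_inV opO grV opD genD hv.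
by rewrite umap_derivation => -[].
Qed.

End Derivation.

Section InLabel.
Variables (k : comPzRingType) (O : opSeq k) (V : dgSeq k).
Hypothesis opO : is_dg_operad O.
Hypothesis grV : is_graded V.
Let grO : is_graded O := dg_graded (operad_seq opO).
Local Notation C := (graded_coprod O V).
Let opC : is_graded_operad C := coprod_operad opO grV.
Let gen := in_label_generator opO grV.

Lemma inO_linear n a c (x y : O) : homog n a x -> homog n a y ->
  inO V n a (c *: x + y) = c *: inO V n a x + inO V n a y.
Proof. exact: (gen_linO gen). Qed.

Lemma inV_linear n a c (x y : V) : homog n a x -> homog n a y ->
  inV O n a (c *: x + y) = c *: inV O n a x + inV O n a y.
Proof. exact: (gen_linV gen). Qed.

Lemma inOD n a (x y : O) : homog n a x -> homog n a y ->
  inO V n a (x + y) = inO V n a x + inO V n a y.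
Proof. by move=> hx hy; rewrite -{1}[x]scale1r inO_linear ?scale1r. Qed.

Lemma inO0 n a : inO V n a (0 : O) = 0.
Proof.
have := inOD (homog0 grO n a) (homog0 grO n a); rewrite addr0 => /esym/eqP.
by rewrite -subr_eq0 addrK => /eqP.
Qed.

Lemma inV0 n a : inV O n a (0 : V) = 0.
Proof.
have := inV_linear 1 (homog0 grV n a) (homog0 grV n a).
rewrite !scale1r addr0 => /esym/eqP.
by rewrite -subr_eq0 addrK => /eqP.
Qed.

Lemma inO_homog n a (x : O) : homog n a x -> @homog k C n a (inO V n a x).
Proof. by move=> hx; have := gen_homog gen (hx : label_ok true n ((a, inl x) : label O V)). Qed.

Lemma inV_homog n a (v : V) : homog n a v -> @homog k C n a (inV O n a v).
Proof. by move=> hv; have := gen_homog gen (hv : label_ok false n ((a, inr v) : label O V)). Qed.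

Lemma inO_circ i p q a b (x y : O) : (i < p)%N -> homog p a x -> homog q b y ->
  inO V (p + q).-1 (a + b) (circ i x y) = @circ k C i (inO V p a x) (inO V q b y).
Proof. by move=> ip hx hy; apply: (gen_circ gen ip hx hy). Qed.

Section TwistedDerivations.
Hypothesis dgV : is_dg_seq V.
Variable del : V -> O.
Hypothesis deg_del : is_deg_map (-1) del.

(** The Leibniz rule for id o id gives d(id) = d(id) + d(id). *)
Lemma diff_op_id : diff (op_id O) = 0.
Proof.
have hid := op_id_homog opO.
have := diff_circ opO (i := 0) (ltn0Sn 0) hid hid.
rewrite (circ_idl opO hid) sg0 scale1r (circ_idr opO (n := 1) (a := 0 + -1)) //; last first.
  exact: deg_map_homog (dg_deg (operad_seq opO)) hid.
rewrite (circ_idl opO (n := 1) (a := 0 + -1)); last first.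
  exact: deg_map_homog (dg_deg (operad_seq opO)) hid.
by move/esym/eqP; rewrite -subr_eq0 addrK => /eqP.
Qed.

Lemma del_ext_der : is_der (fun n (l : label O V) => match l.2 with
    | inl x => 0 : coprod O V
    | inr v => inO V n (l.1 - 1) (del v)
    end).
Proof.
split=> [b n [a [x|v]] /andP[_ ok]|n a c x y hx hy|n a c x y hx hy|i p q a b x y ip hx hy|] //=.
- exact: homog0 (coprod_graded opO grV) _ _.
- exact/inO_homog/deg_map_homog.
- by rewrite scaler0 addr0.
- by case: deg_del => ld hd; rewrite ld inO_linear //; apply: hd.
have := lin0 (go_linl opC i (inO V q b y)); have := lin0 (go_linr opC i (inO V p a x)).
by move=> /= -> ->; rewrite scaler0 addr0.
Qed.

Lemma twisted_diff_der : is_der (fun n (l : label O V) => match l.2 with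
    | inl x => inO V n (l.1 - 1) (diff x)
    | inr v => inV O n (l.1 - 1) (diff v) + inO V n (l.1 - 1) (del v)
    end).
Proof.
have dO := dg_deg (operad_seq opO); have dV := dg_deg dgV.
split=> [b n [a [x|v]] /andP[_ ok]|n a c x y hx hy|n a c x y hx hy|i p q a b x y ip hx hy|] /=.
- exact/inO_homog/deg_map_homog.
- apply: homogD (coprod_graded opO grV) _ _ _ _ _ _.
    exact/inV_homog/deg_map_homog.
  exact/inO_homog/deg_map_homog.
- by case: dO => ld hd; rewrite ld inO_linear //; apply: hd.
- case: dV => ld hd; case: deg_del => ld' hd'.
  have [dx dy dx' dy'] := And4 (hd _ _ _ hx) (hd _ _ _ hy) (hd' _ _ _ hx) (hd' _ _ _ hy).
  by rewrite ld ld' (inV_linear c dx dy) (inO_linear c dx' dy') scalerDr addrACA.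
- have hdx : homog p (a - 1) (diff x) by apply: deg_map_homog.
  have hdy : homog q (b - 1) (diff y) by apply: deg_map_homog.
  rewrite (diff_circ opO ip hx hy) [circ i (diff x) y + _]addrC.
  have E1 : a - 1 + b = a + b - 1 by ring.
  have E2 : a + (b - 1) = a + b - 1 by ring.
  rewrite inO_linear; first rewrite addrC.
  + by rewrite -{1}E1 -E2 !inO_circ.
  + by rewrite -E2; apply: (circ_homog opO).
  by rewrite -E1; apply: (circ_homog opO).
by rewrite diff_op_id inO0.
Qed.

End TwistedDerivations.
End InLabel.

(** * Twisted coproducts and their maps *)

Section TwistedOperad.
Variables (k : comPzRingType) (O : opSeq k) (V : dgSeq k) (del : V -> O).
Hypothesis opO : is_dg_operad O.
Hypothesis dgV : is_dg_seq V.
Hypothesis tw : is_twisting del.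
Let grO : is_graded O := dg_graded (operad_seq opO).
Let grV : is_graded V := dg_graded dgV.
Local Notation C := (graded_coprod O V).
Let opC : is_graded_operad C := coprod_operad opO grV.
Let deg_del : is_deg_map (-1) del := proj1 tw.
Let derD := twisted_diff_der opO grV dgV deg_del.

Lemma twisted_diff_linear : linear (twisted_diff del).
Proof. exact: (derivation_linear opO grV derD). Qed.

Lemma twisted_diff_homog n a (x : C) : homog n a x ->
  @homog k C n (a - 1) (twisted_diff del x).
Proof. exact: (derivation_homog opO grV derD). Qed.

Lemma twisted_diff_circ i p q a b (x y : C) : (i < p)%N ->
  homog p a x -> homog q b y ->
  twisted_diff del (@circ k C i x y) =
  @circ k C i (twisted_diff del x) y + sg k a *: @circ k C i x (twisted_diff del y).
Proof. exact: (derivation_circ opO grV derD). Qed.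

Lemma twisted_diff_inO n a (x : O) : homog n a x ->
  twisted_diff del (inO V n a x) = inO V n (a - 1) (diff x).
Proof. exact: (derivation_inO opO grV derD). Qed.

Lemma twisted_diff_inV n a (v : V) : homog n a v ->
  twisted_diff del (inV O n a v) = inV O n (a - 1) (diff v) + inO V n (a - 1) (del v).
Proof. exact: (derivation_inV opO grV derD). Qed.

(** On a generator from [V] what remains is [del (diff v) + diff (del v)], zero by hypothesis; on a
    composition the two mixed terms have opposite signs, as the differential changes the parity of
    [x]. *)
Lemma twisted_diff2 (x : coprod O V) : twisted_diff del (twisted_diff del x) = 0.
Proof.
have ld := twisted_diff_linear; have dO := dg_deg (operad_seq opO); have dV := dg_deg dgV.
move: x; apply: (gen_ind opO grV) => [|c x y Hx Hy|n a x hx|n a v hv|i p q a b x y ip hx hy Hx Hy].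
- by rewrite !(lin0 ld).
- by rewrite !ld Hx Hy scaler0 addr0.
- rewrite twisted_diff_inO // twisted_diff_inO; last exact: deg_map_homog dO hx.
  by rewrite (dg_diff2 (operad_seq opO)) inO0.
- have hdv := deg_map_homog dV hv; have hv' := deg_map_homog deg_del hv.
  rewrite twisted_diff_inV // (linD ld) twisted_diff_inV // twisted_diff_inO //.
  rewrite (dg_diff2 dgV) inV0 // add0r -inOD //; last 2 first.
  + exact: deg_map_homog deg_del hdv.
  + exact: deg_map_homog dO hv'.
  by rewrite (proj2 tw) inO0.
have hx' := twisted_diff_homog hx; have hy' := twisted_diff_homog hy.
rewrite (twisted_diff_circ ip hx hy) (linD ld) (linZ ld).
rewrite (twisted_diff_circ ip hx' hy) (twisted_diff_circ ip hx hy') Hx Hy.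
rewrite (lin0 (go_linl opC _ _)) (lin0 (go_linr opC _ _)) add0r scaler0 addr0.
by rewrite sgB1 scaleNr addNr.
Qed.

Lemma twisted_coprod_operad : is_dg_operad (twisted_coprod del).
Proof.
split; [split| ..].
- by case: (go_graded opC) => g1 g2 g3; split; [exact: g1 | exact: g2 | exact: g3].
- by split; [exact: twisted_diff_linear | exact: twisted_diff_homog].
- exact: twisted_diff2.
- exact: (go_linl opC).
- exact: (go_linr opC).
- exact: (go_homog opC).
- exact: (go_id opC).
- exact: (go_seq opC).
- exact: (go_par opC).
- exact: (go_idl opC).
- exact: (go_idr opC).
exact: twisted_diff_circ.
Qed.

End TwistedOperad.

(** * Functoriality of the coproduct *)

Section CoprodMap.
Variables (k : comPzRingType) (O P : opSeq k) (V W : dgSeq k).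
Variables (f : O -> P) (g : V -> W).
Hypothesis opO : is_dg_operad O.
Hypothesis opP : is_dg_operad P.
Hypothesis grV : is_graded V.
Hypothesis grW : is_graded W.
Hypothesis opf : is_operad_map f.
Hypothesis degg : is_deg_map 0 g.
Let grO : is_graded O := dg_graded (operad_seq opO).
Local Notation C := (graded_coprod O V).
Local Notation E := (graded_coprod P W).
Let opC : is_graded_operad C := coprod_operad opO grV.
Let opE : is_graded_operad E := coprod_operad opP grW.

Definition map_label (l : label O V) : label P W :=
  (l.1, match l.2 with inl x => inl (f x) | inr v => inr (g v) end).

Let f_homog n a (x : O) : homog n a x -> homog n a (f x).
Proof.
by move=> hx; have := deg_map_homog (opmap_chain opf).1 hx; rewrite addr0.
Qed.

Let g_homog n a (v : V) : homog n a v -> homog n a (g v).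
Proof. by move=> hv; have := deg_map_homog degg hv; rewrite addr0. Qed.

Lemma map_label_ok b n l : label_ok b n l -> label_ok b n (map_label l).
Proof.
case: l => a [x|v] /andP[/= b' h]; rewrite /label_ok /= b' /=;
  [exact: f_homog | exact: g_homog].
Qed.

Let gen := in_label_generator opP grW.
Let phi n l : E := in_label n (map_label l).

Let genphi : is_generator_map phi.
Proof.
split=> [b n l ok|n a c x y hx hy|n a c x y hx hy|i p q a b x y ip hx hy|].
- exact: (gen_homog gen (map_label_ok ok)).
- rewrite /phi /map_label /= (opmap_chain opf).1.1.
  by apply: (gen_linO gen); apply: f_homog.
- rewrite /phi /map_label /= degg.1.
  by apply: (gen_linV gen); apply: g_homog.
- rewrite /phi /map_label /= (opmap_circ opf ip hx hy).
  by apply: (gen_circ gen ip); apply: f_homog.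
by rewrite /phi /map_label /= (opmap_id opf); apply: (gen_id gen).
Qed.

Lemma tmap_admissible b t : admissible_at b t ->
  admissible_at b (tmap (fun=> map_label) t).
Proof.
elim/ltree_nested_ind: t b => // l cs IH b; rewrite admissible_node => /andP[ok hcs].
rewrite [tmap _ _]/= admissible_node size_map map_label_ok //=.
by elim: cs IH hcs {ok} => //= c cs IHcs [Hc Hcs] /andP[/Hc -> /=]; apply: IHcs.
Qed.

(** The composition of the images of the labels is the class of the relabeled tree, by
    [ucomp_in_label] in the target; so [coprod_map] inherits everything from the universal
    property. *)
Lemma coprod_map_umap x : coprod_map f g x = umap phi x.
Proof.
apply: ext_eq => t adt; rewrite (relabel_tmap (fun=> map_label)).
rewrite -(ucomp_in_label opP grW (tmap_admissible adt)).
by rewrite /ucomp tmap_tmap.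
Qed.

Lemma coprod_map_tcls t : admissible t ->
  coprod_map f g (tcls t) = tcls (tmap (fun=> map_label) t).
Proof.
move=> adt; rewrite coprod_map_umap (umap_tcls opO grV opE genphi adt).
by rewrite -(ucomp_in_label opP grW (tmap_admissible adt)) /ucomp tmap_tmap.
Qed.

Lemma coprod_map_linear : linear (coprod_map f g).
Proof. by move=> c x y; rewrite !coprod_map_umap (umap_linear opO grV opE genphi). Qed.

Lemma coprod_map_homog n a (x : C) : homog n a x -> @homog k E n a (coprod_map f g x).
Proof. by rewrite coprod_map_umap; apply: (umap_homog opO grV opE genphi). Qed.

Lemma coprod_map_circ i p q a b (x y : C) : (i < p)%N ->
  homog p a x -> homog q b y ->
  coprod_map f g (@circ k C i x y) = @circ k E i (coprod_map f g x) (coprod_map f g y).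
Proof. by rewrite !coprod_map_umap; apply: (umap_circ opO grV opE genphi). Qed.

Lemma coprod_map_inO n a (x : O) : homog n a x ->
  coprod_map f g (inO V n a x) = inO W n a (f x).
Proof. by rewrite coprod_map_umap; apply: (umap_inO opO grV opE genphi). Qed.

Lemma coprod_map_inV n a (v : V) : homog n a v ->
  coprod_map f g (inV O n a v) = inV P n a (g v).
Proof. by rewrite coprod_map_umap; apply: (umap_inV opO grV opE genphi). Qed.

Lemma coprod_map_id : coprod_map f g (coprod_id O V) = coprod_id P W.
Proof. by rewrite coprod_map_umap (umap_id opO grV opE genphi). Qed.

(** Used twice, for the twisted differentials and for the extensions of the twisting maps; agreement
    on generators propagates along compositions by the two Leibniz rules. *)
Lemma coprod_map_derivation (D : nat -> label O V -> coprod O V)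
    (D' : nat -> label P W -> coprod P W) :
  is_der D -> is_der D' ->
  (forall b n l, label_ok b n l -> coprod_map f g (D n l) = D' n (map_label l)) ->
  forall x, coprod_map f g (derivation D x) = derivation D' (coprod_map f g x).
Proof.
move=> derD derD' DD'; have lf := coprod_map_linear.
have ld := derivation_linear opO grV derD; have ld' := derivation_linear opP grW derD'.
apply: (gen_ind opO grV) => [|c x y Hx Hy|n a x hx|n a v hv|i p q a b x y ip hx hy Hx Hy].
- by rewrite (lin0 ld) (lin0 lf) (lin0 ld').
- by rewrite ld !lf ld' Hx Hy.
- rewrite (derivation_inO opO grV derD hx) (DD' true) // coprod_map_inO //.
  by rewrite (derivation_inO opP grW derD') //; apply: f_homog.
- rewrite (derivation_inV opO grV derD hv) (DD' false) // coprod_map_inV //.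
  by rewrite (derivation_inV opP grW derD') //; apply: g_homog.
have hx' := derivation_homog opO grV derD hx; have hy' := derivation_homog opO grV derD hy.
have hfx := coprod_map_homog hx; have hfy := coprod_map_homog hy.
rewrite (derivation_circ opO grV derD ip hx hy) (linD lf) (linZ lf).
rewrite (coprod_map_circ ip hx' hy) (coprod_map_circ ip hx hy') (coprod_map_circ ip hx hy).
by rewrite (derivation_circ opP grW derD' ip hfx hfy) Hx Hy.
Qed.

End CoprodMap.

Section CoprodMapTwisted.
Variables (k : comPzRingType) (O P : opSeq k) (V W : dgSeq k).
Variables (f : O -> P) (g : V -> W) (del : V -> O) (del' : W -> P).
Hypothesis opO : is_dg_operad O.
Hypothesis opP : is_dg_operad P.
Hypothesis dgV : is_dg_seq V.
Hypothesis dgW : is_dg_seq W.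
Hypothesis opf : is_operad_map f.
Hypothesis chg : is_chain_map g.
Hypothesis deg_del : is_deg_map (-1) del.
Hypothesis deg_del' : is_deg_map (-1) del'.
Hypothesis fdel : forall v, f (del v) = del' (g v).
Let grV := dg_graded dgV.
Let grW := dg_graded dgW.

Lemma coprod_map_twisted_diff x :
  coprod_map f g (twisted_diff del x) = twisted_diff del' (coprod_map f g x).
Proof.
apply: (coprod_map_derivation opO opP grV grW opf (proj1 chg)).
- exact: twisted_diff_der.
- exact: twisted_diff_der.
have lf := coprod_map_linear opO opP grV grW opf (proj1 chg).
move=> b n [a [x'|v]] /andP[/= _ h].
  rewrite (coprod_map_inO opO opP grV grW opf (proj1 chg)); last first.
    exact: deg_map_homog (dg_deg (operad_seq opO)) h.
  by rewrite (proj2 (opmap_chain opf)).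
rewrite (linD lf) (coprod_map_inO opO opP grV grW opf (proj1 chg)); last first.
  exact: deg_map_homog deg_del h.
rewrite (coprod_map_inV opO opP grV grW opf (proj1 chg)); last first.
  exact: deg_map_homog (dg_deg dgV) h.
by rewrite (proj2 chg) fdel.
Qed.

Lemma coprod_map_del_ext x :
  coprod_map f g (del_ext del x) = del_ext del' (coprod_map f g x).
Proof.
have lf := coprod_map_linear opO opP grV grW opf (proj1 chg).
apply: (coprod_map_derivation opO opP grV grW opf (proj1 chg)).
- exact: del_ext_der.
- exact: del_ext_der.
move=> b n [a [x'|v]] /andP[/= _ h]; first by rewrite (lin0 lf).
rewrite (coprod_map_inO opO opP grV grW opf (proj1 chg)) ?fdel //.
exact: deg_map_homog deg_del h.
Qed.

Lemma coprod_map_operad_map : @is_operad_map k (twisted_coprod del) (twisted_coprod del')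
  (coprod_map f g).
Proof.
split; [split; [split|] | ..].
- exact: (coprod_map_linear opO opP grV grW opf (proj1 chg)).
- by move=> n a x hx; rewrite addr0; apply: (coprod_map_homog opO opP grV grW opf (proj1 chg)).
- exact: coprod_map_twisted_diff.
- exact: (coprod_map_id opO opP grV grW opf (proj1 chg)).
exact: (coprod_map_circ opO opP grV grW opf (proj1 chg)).
Qed.

End CoprodMapTwisted.

Section SplitTwisted.
Variables (k : comPzRingType) (O : opSeq k) (V : dgSeq k) (del : V -> O).
Hypothesis opO : is_dg_operad O.
Hypothesis dgV : is_dg_seq V.
Hypothesis deg_del : is_deg_map (-1) del.
Let grV : is_graded V := dg_graded dgV.
Let grO : is_graded O := dg_graded (operad_seq opO).
Local Notation C := (graded_coprod O V).
Let opC : is_graded_operad C := coprod_operad opO grV.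

(** The untwisted differential is handled as the twisted one for the zero map. *)
Lemma zero_twisting : is_twisting ((fun=> 0) : V -> O).
Proof.
split; first split.
- by move=> c x y; rewrite scaler0 addr0.
- by move=> n a x _; apply: homog0.
by move=> v; rewrite (lin0 (proj1 (dg_deg (operad_seq opO)))) addr0.
Qed.

Lemma twisted_diffE (x : coprod O V) :
  twisted_diff del x = twisted_diff ((fun=> 0) : V -> O) x + del_ext del x.
Proof.
have derD := twisted_diff_der opO grV dgV deg_del.
have derd := twisted_diff_der opO grV dgV (proj1 zero_twisting).
have dere := del_ext_der opO grV deg_del.
have lD : linear (twisted_diff del) := derivation_linear opO grV derD.
have ld : linear (twisted_diff ((fun=> 0) : V -> O)) := derivation_linear opO grV derd.
have le : linear (del_ext del) := derivation_linear opO grV dere.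
move: x; apply: (gen_ind opO grV) => [|c x y Hx Hy|n a x hx|n a v hv|i p q a b x y ip hx hy Hx Hy].
- by rewrite (lin0 lD) (lin0 ld) (lin0 le) addr0.
- by rewrite lD ld le Hx Hy scalerDr addrACA.
- rewrite /twisted_diff /del_ext (derivation_inO opO grV derD hx).
  by rewrite (derivation_inO opO grV derd hx) (derivation_inO opO grV dere hx) /= addr0.
- rewrite /twisted_diff /del_ext (derivation_inV opO grV derD hv).
  by rewrite (derivation_inV opO grV derd hv) (derivation_inV opO grV dere hv) /= inO0 // addr0.
rewrite [LHS](derivation_circ opO grV derD ip hx hy).
rewrite [X in _ = X + _](derivation_circ opO grV derd ip hx hy).
rewrite [X in _ = _ + X](derivation_circ opO grV dere ip hx hy).
rewrite addrACA -scalerDr -(linD (go_linl opC i y)) -(linD (go_linr opC i x)).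
by congr (@circ k C i _ y + _ *: @circ k C i x _); [exact: Hx | exact: Hy].
Qed.

End SplitTwisted.

(** * The canonical cylinder *)

Section Cylinder.
Variables (k : comPzRingType) (V : dgSeq k).
Hypothesis dgV : is_dg_seq V.
Let grV := dg_graded dgV.
Let ldV : linear (@diff k V) := proj1 (dg_deg dgV).

Lemma cyl_homog n a (u : cyl V) :
  homog n a u = [&& homog n a u.1.1, homog n (a - 1) u.1.2 & homog n a u.2].
Proof. by case: u => [[x s] y]; rewrite andbA. Qed.

Lemma cyl_graded : is_graded (cyl V).
Proof.
split=> [n a c [[x s] y] [[x' s'] y']|n a m b [[x s] y]|[[x s] y]] /=.
- by rewrite !(proj_linear grV).
- rewrite !(proj_proj grV) (inj_eq (addIr _)).
  by case: ifP.
have [r1 [u1 xE]] := proj_sum grV x; have [r2 [u2 sE]] := proj_sum grV s.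
have [r3 [u3 yE]] := proj_sum grV y.
pose up (j : nat * int) := (j.1, j.2 + 1); pose dn (j : nat * int) := (j.1, j.2 - 1).
exists (undup (r1 ++ map up r2 ++ r3)); split; first exact: undup_uniq.
have pairE (r : seq (nat * int)) (F G H : nat * int -> V) :
  \sum_(j <- r) (F j, G j, H j) = (\sum_(j <- r) F j, \sum_(j <- r) G j, \sum_(j <- r) H j).
  by elim: r => [|j r IH]; rewrite ?big_nil // !big_cons IH.
rewrite pairE; congr (_, _, _).
- by apply: (graded_sub grV u1 _ xE) => [|j js]; rewrite ?undup_uniq // mem_undup mem_cat js.
- have idn : injective dn by move=> [i1 j1] [i2 j2] [-> /addIr ->].
  rewrite -(big_map dn xpredT (fun j => proj j.1 j.2 s)).
  apply: (graded_sub grV u2 _ sE) => [|j js]; first by rewrite map_inj_uniq ?undup_uniq.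
  apply/mapP; exists (up j); last by rewrite /dn /up /= addrK -surjective_pairing.
  by rewrite mem_undup !mem_cat map_f ?orbT.
by apply: (graded_sub grV u3 _ yE) => [|j js]; rewrite ?undup_uniq // mem_undup !mem_cat js !orbT.
Qed.

Lemma cyl_dg : is_dg_seq (cyl V).
Proof.
have hd := deg_map_homog (dg_deg dgV).
split; first exact: cyl_graded.
  split=> [c [[x s] y] [[x' s'] y']|n a [[x s] y]] /=.
    rewrite !ldV; congr (_, _, _) => /=.
    - by rewrite scalerDr addrACA.
    - by rewrite scalerN opprD.
    by rewrite opprD scalerBr addrACA.
  rewrite !cyl_homog /= => /and3P[hx hs hy].
  by rewrite homogD ?homogN ?hd //= homogD ?homogN ?hd.
move=> [[x s] y] /=; rewrite !(linD ldV) !(linN ldV) !(dg_diff2 dgV).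
by rewrite !add0r subrr !opprK addNr.
Qed.

Lemma cyl_in0_chain : is_chain_map (@cyl_in0 k V).
Proof.
split; last by move=> x; rewrite /= (lin0 ldV) /cyl_in0 oppr0 !addr0.
split=> [c x y|n a x hx]; first by congr (_, _, _) => /=; rewrite scaler0 addr0.
by rewrite addr0 cyl_homog /= hx !homog0.
Qed.

Lemma cyl_in1_chain : is_chain_map (@cyl_in1 k V).
Proof.
split; last by move=> x; rewrite /= (lin0 ldV) /cyl_in1 oppr0 !addr0.
split=> [c x y|n a x hx]; first by congr (_, _, _) => /=; rewrite scaler0 addr0.
by rewrite addr0 cyl_homog /= hx !homog0.
Qed.

Lemma cyl_p_chain : is_chain_map (@cyl_p k V).
Proof.
split; last by move=> [[x s] y]; rewrite /cyl_p /= (linD ldV) addrACA subrr addr0.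
split=> [c [[x s] y] [[x' s'] y']|n a [[x s] y]] /=.
  by rewrite /cyl_p /= scalerDr addrACA.
by rewrite cyl_homog /= => /and3P[hx _ hy]; rewrite addr0 homogD.
Qed.

Lemma cyl_h_deg : is_deg_map 1 (@cyl_h k V).
Proof.
split=> [c [[x s] y] [[x' s'] y']|n a [[x s] y]].
  by congr (_, _, _) => /=; rewrite scaler0 addr0.
by rewrite !cyl_homog /= => /and3P[_ _ hy]; rewrite addrK hy !homog0.
Qed.

Lemma cyl_is_sdr : is_sdr (@cyl_in0 k V) (@cyl_p k V) (@cyl_h k V).
Proof.
split; [exact: cyl_in0_chain|exact: cyl_p_chain|exact: cyl_h_deg|..] => //=.
- move=> [[x s] y]; rewrite /cyl_in0 /cyl_p /cyl_h /cyl_sigma /=.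
  congr (_, _, _) => /=; rewrite ?(lin0 ldV).
  + by rewrite add0r addr0 addrAC subrr add0r.
  + by rewrite addrA addNr add0r.
  by rewrite addr0.
- by move=> x; rewrite /cyl_p /= addr0.
by move=> y; rewrite /cyl_p /= addr0.
Qed.

End Cylinder.

Section CylinderTwisting.
Variables (k : comPzRingType) (O P : opSeq k) (V : dgSeq k).
Variables (i0 i1 : O -> P) (p : P -> O) (h : P -> P) (del : V -> O).
Hypothesis cylP : is_operad_cylinder i0 i1 p h.
Hypothesis tw : is_twisting del.
Let opP := opcyl_operad cylP.
Let sdr := cyl_sdr (opcyl_cyl cylP).
Let grP : is_graded P := dg_graded (operad_seq opP).
Let li0 : linear i0 := proj1 (proj1 (sdr_i sdr)).
Let li1 : linear i1 := proj1 (proj1 (opmap_chain (opcyl_i1 cylP))).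
Let lh : linear h := proj1 (sdr_h sdr).
Let ldel : linear del := proj1 (proj1 tw).
Let ldP : linear (@diff k P) := proj1 (dg_deg (operad_seq opP)).

(** The outer components hold since [i0] and [i1] are chain maps. The component of [sigma s] is the
    homotopy identity of [P] at [i1 (del s)], where p i1 = 1 turns i0 p i1 into i0. *)
Lemma del_cyl_twisting : is_twisting (del_cyl i0 i1 h del).
Proof.
split; first split=> [c [[x s] y] [[x' s'] y']|n a [[x s] y]].
- rewrite /del_cyl /= !ldel !li0 !li1 lh !scalerDr !scalerN opprD.
  by rewrite (addrACA (c *: i0 _)) [LHS]addrACA.
- rewrite cyl_homog /= => /and3P[hx hs hy]; rewrite /del_cyl /=.
  have hdel := deg_map_homog (proj1 tw).
  apply: homogD => //; first apply: homogD => //.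
  + by rewrite -[_ - 1]addr0; apply: deg_map_homog (proj1 (sdr_i sdr)) (hdel _ _ _ hx).
  + apply: homogN => //; rewrite (_ : a - 1 = a - 1 - 1 + 0 + 1); last by ring.
    apply: deg_map_homog (sdr_h sdr) _.
    exact: deg_map_homog (proj1 (opmap_chain (opcyl_i1 cylP))) (hdel _ _ _ hs).
  rewrite -[_ - 1]addr0.
  exact: deg_map_homog (proj1 (opmap_chain (opcyl_i1 cylP))) (hdel _ _ _ hy).
have ch0 := proj2 (sdr_i sdr); have ch1 := proj2 (opmap_chain (opcyl_i1 cylP)).
have dd v : del (diff v) = - diff (del v).
  by apply/eqP; rewrite -subr_eq0 opprK (proj2 tw).
move=> [[x s] y]; rewrite /del_cyl /=.
have := sdr_homotopy sdr (i1 (del s)); rewrite (cyl_pi1 (opcyl_cyl cylP)).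
rewrite -ch1 => E.
rewrite !(linD ldel) !(linN ldel) !dd.
rewrite !(linD li0) !(linD li1) !(linN li0) !(linN li1) opprK (linD ldP) (linB ldP) -ch0 -ch1.
move: E; move: (i0 (del s)) (i1 (del s)) (diff (h (i1 (del s)))) (h (i1 (diff (del s))))
  (i0 (diff (del x))) (i1 (diff (del y))) => A B C D X Y E.
(* The terms in [x] and in [y] cancel in pairs; the other four form the homotopy identity [E]. *)
rewrite [LHS](AC (3 * 2 * 3) ((1 * 6) * (4 * 8) * ((2 * 5) * (7 * 3)))) /=.
by rewrite !addNr !add0r E -opprD subrr.
Qed.

End CylinderTwisting.

(** * Relabeling by rank in the path order *)

Section Relabel.
Variables (X Y Z : Type).
Implicit Types (t : ltree X) (cs : seq (ltree X)).

Lemma size_relabel_forest (f : nat -> nat -> X -> Y) k cs :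
  size (relabel_forest f k cs) = size cs.
Proof. by elim: cs k => //= c cs IH k; rewrite IH. Qed.

Lemma eq_relabel x0 (f g : nat -> nat -> X -> Y) k t :
  (forall r n, (r < size (labels t))%N ->
     f (k + r)%N n (nth x0 (labels t) r) = g (k + r)%N n (nth x0 (labels t) r)) ->
  relabel f k t = relabel g k t.
Proof.
elim/ltree_nested_ind: t k => // x cs IH k fg; rewrite !relabel_node.
have := fg 0%N (size cs) (ltn0Sn _); rewrite addn0 /= => ->; congr Node.
have {}fg r n : (r < size (flatten (map (@labels X) cs)))%N ->
    f (k.+1 + r)%N n (nth x0 (flatten (map (@labels X) cs)) r) =
    g (k.+1 + r)%N n (nth x0 (flatten (map (@labels X) cs)) r).
  by move=> rs; have := fg r.+1 n rs; rewrite addnS -addSn.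
elim: cs k.+1 IH fg => //= c cs IHcs {}k [Hc Hcs] fg; congr (_ :: _).
  apply: Hc => r n rc; have := fg r n; rewrite size_cat nth_cat rc; apply.
  exact: ltn_addr.
apply: IHcs => // r n rs; have := fg (size (labels c) + r)%N n.
rewrite size_cat nth_cat (ltnNge _ (size (labels c))) leq_addr /= addKn addnA; apply.
by rewrite ltn_add2l.
Qed.

Lemma size_labels_relabel (f : nat -> nat -> X -> Y) k t :
  size (labels (relabel f k t)) = size (labels t).
Proof.
elim/ltree_nested_ind: t k => // x cs IH k; rewrite relabel_node /=; congr S.
by elim: cs k.+1 IH => //= c cs IHcs {}k [Hc Hcs]; rewrite !size_cat Hc IHcs.
Qed.

Lemma nth_labels_relabel x0 y0 (f : nat -> X -> Y) k t r :
  (r < size (labels t))%N ->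
  nth y0 (labels (relabel (fun r _ => f r) k t)) r = f (k + r)%N (nth x0 (labels t) r).
Proof.
elim/ltree_nested_ind: t k r => // x cs IH k [|r]; rewrite relabel_node /=.
  by rewrite addn0.
rewrite addnS -addSn ltnS; elim: cs k.+1 r IH => //= c cs IHcs {}k r [Hc Hcs].
rewrite size_cat !nth_cat size_labels_relabel => rs.
case: ltnP => rc; first exact: Hc.
rewrite IHcs //; last by lia.
by congr f; lia.
Qed.

Lemma nleaves_relabel (f : nat -> nat -> X -> Y) k t :
  nleaves (relabel f k t) = nleaves t.
Proof.
elim/ltree_nested_ind: t k => // x cs IH k; rewrite relabel_node !nleaves_node.
by elim: cs k.+1 IH => //= c cs IHcs {}k [Hc Hcs]; rewrite !nlv_cons Hc IHcs.
Qed.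

Lemma relabel_relabel (f : nat -> nat -> X -> Y) (g : nat -> nat -> Y -> Z) k t :
  relabel g k (relabel f k t) = relabel (fun r n x => g r n (f r n x)) k t.
Proof.
elim/ltree_nested_ind: t k => // x cs IH k; rewrite !relabel_node size_relabel_forest.
congr Node; elim: cs k.+1 IH => //= c cs IHcs {}k [Hc Hcs].
by rewrite Hc size_labels_relabel IHcs.
Qed.

(** The elementary tensor [zs] on the shape of [t]. For a fixed [t] this presents the corresponding
    summand of the coproduct through lists of labels. *)
Definition fill (y0 : Y) (zs : seq Y) t : ltree Y := relabel (fun r _ _ => nth y0 zs r) 0 t.

Lemma labels_fill y0 zs t : size zs = size (labels t) -> labels (fill y0 zs t) = zs.
Proof.
move=> szs; apply: (@eq_from_nth _ y0); first by rewrite size_labels_relabel.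
move=> r; rewrite size_labels_relabel => rt.
have x0 : X by case: (labels t) rt.
by rewrite (nth_labels_relabel x0 y0 (fun r _ => nth y0 zs r)).
Qed.

Lemma relabel_fill x0 y0 (f : nat -> X -> Y) t zs :
  size zs = size (labels t) ->
  (forall r, (r < size (labels t))%N -> f r (nth x0 (labels t) r) = nth y0 zs r) ->
  relabel (fun r _ => f r) 0 t = fill y0 zs t.
Proof. by move=> _ fE; apply: (@eq_relabel x0) => r n rt; rewrite add0n fE. Qed.

End Relabel.

Section LinRelabel.
Variables (k : comPzRingType) (O : opSeq k) (V : dgSeq k) (X : Type).
Local Notation L := (label O V).

Variant lin_comb (c : k) : L -> L -> L -> Prop :=
| LinCombO a (x y : O) : lin_comb c (a, inl x) (a, inl y) (a, inl (c *: x + y))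
| LinCombV a (x y : V) : lin_comb c (a, inr x) (a, inr y) (a, inr (c *: x + y)).

(** Turns a linear relation in one entry of a list into one between trees: each subtree that does
    not contain the rank [r0] is relabeled identically three times. *)
Lemma lin_relabel c (f1 f2 f : nat -> nat -> X -> L) off r0 (t : ltree X) :
  (forall r n x, r != r0 -> f1 r n x = f r n x /\ f2 r n x = f r n x) ->
  (forall n x, lin_comb c (f1 r0 n x) (f2 r0 n x) (f r0 n x)) ->
  (off <= r0 < off + size (labels t))%N ->
  lin_label c (relabel f1 off t) (relabel f2 off t) (relabel f off t).
Proof.
move=> ne lc.
have same t' o : (r0 < o)%N || (o + size (labels t') <= r0)%N ->
    relabel f1 o t' = relabel f o t' /\ relabel f2 o t' = relabel f o t'.
  move=> ro; case: t' ro => // x cs ro.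
  by split; apply: (@eq_relabel _ _ x) => r n rs; apply ne; apply/eqP => E; rewrite -E in ro; lia.
have sames cs o : (r0 < o)%N || (o + size (flatten (map (@labels X) cs)) <= r0)%N ->
    relabel_forest f1 o cs = relabel_forest f o cs /\
    relabel_forest f2 o cs = relabel_forest f o cs.
  elim: cs o => //= d cs IHcs o; rewrite size_cat => ro.
  by have [-> ->] := same d o ltac:(lia); have [-> ->] := IHcs (o + size (labels d))%N ltac:(lia).
elim/ltree_nested_ind: t off => [|x cs IH] off; first by rewrite /= addn0 => /andP[]; lia.
rewrite !relabel_node [size _]/= => ro; have [E|ne0] := eqVneq off r0.
  have [-> ->] := sames cs off.+1 ltac:(lia).
  by rewrite E; case: (lc (size cs) x) => *; constructor.
have [-> ->] := ne off (size cs) x ne0.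
suff [lft [rgt [t1 [t2 [t3 [-> -> -> L]]]]]] : exists lft rgt t1 t2 t3,
    [/\ relabel_forest f1 off.+1 cs = lft ++ t1 :: rgt,
        relabel_forest f2 off.+1 cs = lft ++ t2 :: rgt,
        relabel_forest f off.+1 cs = lft ++ t3 :: rgt & lin_label c t1 t2 t3].
  exact: LinSub.
have {ro ne0} : (off.+1 <= r0 < off.+1 + size (flatten (map (@labels X) cs)))%N by lia.
elim: cs off.+1 IH => [|d cs IHcs] o IH /=; first by lia.
case: IH => Hd Hcs; rewrite size_cat => ro.
have [rd|rd] := ltnP r0 (o + size (labels d)).
  have [-> ->] := sames cs (o + size (labels d))%N ltac:(lia).
  exists [::]; do 4 eexists; split; try reflexivity.
  by apply: Hd; lia.
have [-> ->] := same d o ltac:(lia).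
have [|lft [rgt [t1 [t2 [t3 [-> -> -> L]]]]]] := IHcs (o + size (labels d))%N Hcs; first by lia.
by exists (relabel f o d :: lft), rgt, t1, t2, t3.
Qed.

End LinRelabel.

(** * The homotopy of a tensor product *)

(** A strong deformation retraction seen from the big complex, with [e] in the role of i p. Labels
    in the two kinds of factors are then treated alike, without their small complexes. *)
Record is_contraction (k : comPzRingType) (M : dgSeq k) (e h : M -> M) : Prop :=
  IsContraction {
  con_e : is_chain_map e;
  con_h : is_deg_map 1 h;
  con_homotopy : forall y, e y - y = diff (h y) + h (diff y);
  con_he : forall y, h (e y) = 0;
  con_eh : forall y, e (h y) = 0;
  con_hh : forall y, h (h y) = 0 }.

Lemma sdr_contraction (k : comPzRingType) (X Y : dgSeq k) (i : X -> Y) (p : Y -> X) h :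
  is_sdr i p h -> is_contraction (fun y => i (p y)) h.
Proof.
case=> [[[li hi] ci] [[lp hp] cp] hh ho pi ph hi0 hh0].
split=> // [|y]; last by rewrite ph (lin0 li).
split; last by move=> y; rewrite cp ci.
split=> [c x y|n a y hy]; first by rewrite lp li.
by rewrite -[0]addr0 addrA; apply/hi/hp.
Qed.

Section TensorTrick.
Variables (k : comPzRingType) (P : opSeq k) (W : dgSeq k).
Variables (eP hP : P -> P) (eW hW : W -> W).
Hypothesis conP : is_contraction eP hP.
Hypothesis conW : is_contraction eW hW.
Hypothesis dgP : is_dg_seq P.
Hypothesis dgW : is_dg_seq W.
Local Notation L := (label P W).

Definition label_e (l : L) : L :=
  (l.1, match l.2 with inl x => inl (eP x) | inr u => inr (eW u) end).
Definition label_htpy (l : L) : L :=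
  (l.1 + 1, match l.2 with inl x => inl (hP x) | inr u => inr (hW u) end).
Definition label_diff (l : L) : L :=
  (l.1 - 1, match l.2 with inl x => inl (diff x) | inr u => inr (diff u) end).
Definition label0 (l : L) : L :=
  (l.1, match l.2 with inl x => inl 0 | inr u => inr 0 end).

(** Homogeneity relative to a reference label, which spares the arity and the level of the vertex: a
    list that is [good] for the labels of an admissible tree fills it admissibly. *)
Definition ok_rel (l l' : L) : Prop := forall b n, label_ok b n l -> label_ok b n l'.

Lemma ok_rel_e l : ok_rel l (label_e l).
Proof.
case: l => a [x|u] b n /andP[/= bb hx]; rewrite /label_ok /= bb /= -[a]addr0.
  exact: deg_map_homog (con_e conP).1 hx.
exact: deg_map_homog (con_e conW).1 hx.
Qed.

Lemma ok_rel_h l : ok_rel l (label_htpy l).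
Proof.
case: l => a [x|u] b n /andP[/= bb hx]; rewrite /label_ok /= bb /=.
  exact: deg_map_homog (con_h conP) hx.
exact: deg_map_homog (con_h conW) hx.
Qed.

Lemma ok_rel_diff l : ok_rel l (label_diff l).
Proof.
case: l => a [x|u] b n /andP[/= bb hx]; rewrite /label_ok /= bb /=.
  exact: deg_map_homog (dg_deg dgP) hx.
exact: deg_map_homog (dg_deg dgW) hx.
Qed.

Lemma ok_rel_trans l1 l2 l3 : ok_rel l1 l2 -> ok_rel l2 l3 -> ok_rel l1 l3.
Proof. by move=> H1 H2 b n /H1/H2. Qed.

Fixpoint good (K ls : seq L) : Prop :=
  match K, ls with
  | k0 :: K', l :: ls' => ok_rel k0 l /\ good K' ls'
  | [::], [::] => True
  | _, _ => False
  end.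

(* A multilinear map on the tensors of a fixed shape is encoded as a functional
   on lists of labels; [hsum] and [dsum] are its composites with the homotopy and
   with the differential of the tensor product. *)
Section Functional.
Variable M : lmodType k.
Implicit Types (F G : seq L -> M) (K ls : seq L).

Fixpoint hsum F ls : M :=
  if ls is y :: ys then
    F (label_htpy y :: ys) + sg k y.1 *: hsum (fun zs => F (label_e y :: zs)) ys
  else 0.

Fixpoint dsum F ls : M :=
  if ls is y :: ys then
    F (label_diff y :: ys) + sg k y.1 *: dsum (fun zs => F (y :: zs)) ys
  else 0.

Definition mlin K F : Prop := forall c us l1 l2 l ws,
  lin_comb c l1 l2 l -> good K (us ++ l1 :: ws) -> good K (us ++ l2 :: ws) ->
  F (us ++ l :: ws) = c *: F (us ++ l1 :: ws) + F (us ++ l2 :: ws).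

Lemma mlin_tail k0 K F y : mlin (k0 :: K) F -> ok_rel k0 y -> mlin K (fun zs => F (y :: zs)).
Proof. by move=> mF ok c us l1 l2 l ws lc g1 g2; apply: (mF c (y :: us)). Qed.

Lemma hsum_lin c F G ls :
  hsum (fun zs => c *: F zs + G zs) ls = c *: hsum F ls + hsum G ls.
Proof.
elim: ls F G => [|y ys IH] F G /=; first by rewrite scaler0 addr0.
by rewrite IH !scalerDr !scalerA [c * _]mulrC addrACA.
Qed.

Lemma dsum_lin c F G ls :
  dsum (fun zs => c *: F zs + G zs) ls = c *: dsum F ls + dsum G ls.
Proof.
elim: ls F G => [|y ys IH] F G /=; first by rewrite scaler0 addr0.
by rewrite IH !scalerDr !scalerA [c * _]mulrC addrACA.
Qed.

Lemma eq_hsum K F G ls : good K ls -> (forall zs, good K zs -> F zs = G zs) ->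
  hsum F ls = hsum G ls.
Proof.
elim: K ls F G => [|k0 K IH] [|y ys] F G //= [ok gys] FG.
rewrite FG; last by split=> //; apply: ok_rel_trans ok (ok_rel_h (l := y)).
congr (_ + _ *: _); apply: IH => // zs gzs; apply: FG; split=> //.
exact: ok_rel_trans ok (ok_rel_e (l := y)).
Qed.

Lemma eq_dsum K F G ls : good K ls -> (forall zs, good K zs -> F zs = G zs) ->
  dsum F ls = dsum G ls.
Proof.
elim: K ls F G => [|k0 K IH] [|y ys] F G //= [ok gys] FG.
rewrite FG; last by split=> //; apply: ok_rel_trans ok (ok_rel_diff (l := y)).
by congr (_ + _ *: _); apply: IH => // zs gzs; apply: FG.
Qed.

Lemma mlin_label0 k0 K F y ys : mlin (k0 :: K) F -> ok_rel k0 (label0 y) -> good K ys ->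
  F (label0 y :: ys) = 0.
Proof.
move=> mF ok g; have lc : lin_comb 1 (label0 y) (label0 y) (label0 y).
  case: y {ok} => a [x|u]; rewrite /label0 /=.
    by have := @LinCombO k P W 1 a 0 0; rewrite scaler0 addr0.
  by have := @LinCombV k P W 1 a 0 0; rewrite scaler0 addr0.
have := mF 1 [::] _ _ _ ys lc (conj ok g) (conj ok g).
by rewrite scale1r /= => /esym/eqP; rewrite -subr_eq0 addrK => /eqP.
Qed.

Lemma homotopy_label k0 K F y ys : mlin (k0 :: K) F -> ok_rel k0 y -> good K ys ->
  F (label_diff (label_htpy y) :: ys) + F (label_htpy (label_diff y) :: ys) =
  F (label_e y :: ys) - F (y :: ys).
Proof.
move=> mF ok g.
have okdh : ok_rel k0 (label_diff (label_htpy y)).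
  exact: ok_rel_trans ok (ok_rel_trans (ok_rel_h (l := _)) (ok_rel_diff (l := _))).
have okhd : ok_rel k0 (label_htpy (label_diff y)).
  exact: ok_rel_trans ok (ok_rel_trans (ok_rel_diff (l := _)) (ok_rel_h (l := _))).
(* [s] carries d h + h d of the vector, of the same degree as [y]. The functional is split along
   this sum and then along e y = s + y. *)
pose s : L := (y.1, match y.2 with
  | inl x => inl (diff (hP x) + hP (diff x)) | inr u => inr (diff (hW u) + hW (diff u)) end).
have E1 : F (s :: ys) = 1 *: F (label_diff (label_htpy y) :: ys) + F (label_htpy (label_diff y) :: ys).
  apply: (mF 1 [::]) => //; case: y @s {ok okdh okhd} => a [x|u] /=;
  rewrite /label_diff /label_htpy /= addrK subrK -[X in X + _]scale1r; constructor.
have oks : ok_rel k0 s.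
  move=> b n okb; have := okdh _ _ okb; have := okhd _ _ okb; rewrite /s.
  case: y @s {E1 ok okdh okhd} => a [x|u] /=;
    rewrite /label_diff /label_htpy /label_ok /= ?addrK ?subrK.
    by move=> /andP[-> h1] /andP[_ h2]; apply: homogD (dg_graded dgP) _ _ _ _ h2 h1.
  by move=> /andP[-> h1] /andP[_ h2]; apply: homogD (dg_graded dgW) _ _ _ _ h2 h1.
have E2 : F (label_e y :: ys) = 1 *: F (s :: ys) + F (y :: ys).
  apply: (mF 1 [::]) => //; case: y @s {E1 ok okdh okhd oks} => a [x|u] /=; rewrite /label_e /=.
    rewrite -(subrK x (eP x)) (con_homotopy conP) -[X in X + x]scale1r; constructor.
  rewrite -(subrK u (eW u)) (con_homotopy conW) -[X in X + u]scale1r; constructor.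
by rewrite E2 E1 !scale1r addrK.
Qed.

(** Induction on the first factor: terms where one operator acts on the head and the other on the
    tail cancel by sign, since e commutes with d. What remains, (e y - y) on the head plus e y times
    the identity for the tail, telescopes. *)
Lemma hsum_dsum K F ls : mlin K F -> good K ls ->
  hsum (dsum F) ls + dsum (hsum F) ls = F (map label_e ls) - F ls.
Proof.
elim: K ls F => [|k0 K IH] [|y ys] F // mF; first by rewrite /= subrr addr0.
case=> ok g; rewrite /=.
have eqH : hsum (fun zs => F (label_diff (label_e y) :: zs) +
      sg k y.1 *: dsum (fun zs => F (label_e y :: zs)) zs) ys =
    hsum (fun zs => F (label_diff (label_e y) :: zs)) ys +
      sg k y.1 *: hsum (dsum (fun zs => F (label_e y :: zs))) ys.
  by rewrite addrC -hsum_lin; congr hsum; apply/funext => zs; rewrite addrC.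
have eqD : dsum (fun zs => F (label_htpy y :: zs) +
      sg k y.1 *: hsum (fun zs => F (label_e y :: zs)) zs) ys =
    dsum (fun zs => F (label_htpy y :: zs)) ys +
      sg k y.1 *: dsum (hsum (fun zs => F (label_e y :: zs))) ys.
  by rewrite addrC -dsum_lin; congr dsum; apply/funext => zs; rewrite addrC.
rewrite eqH eqD !scalerDr !scalerA !sg2 !scale1r sgS sgB1 !scaleNr.
have -> : label_e (label_diff y) = label_diff (label_e y).
  case: (y) => a [x|u]; rewrite /label_e /label_diff /=.
    by rewrite (proj2 (con_e conP)).
  by rewrite (proj2 (con_e conW)).
have IHy := IH ys _ (mlin_tail mF (ok_rel_trans ok (ok_rel_e (l := y)))) g.
have hl := homotopy_label mF ok g.
move: IHy hl; set A := hsum (dsum _) ys; set B := dsum (hsum _) ys.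
set a := F _; set b := F _; set c := F (label_htpy _ :: _); set d := F (y :: ys).
set u := _ *: _; set v := _ *: _ => IHy hl.
(* The first two pairs are [homotopy_label] and the induction hypothesis, the last two are the
   cancelling mixed terms. *)
rewrite [LHS](AC ((2 * 2) * (2 * 2)) (((1 * 5) * (4 * 8)) * ((7 * 2) * (3 * 6)))) /=.
by rewrite !subrr !addr0 hl IHy addrC addrA subrK.
Qed.

(** Terms with h h, e h or h e on the head vanish by the side conditions; the rest is the same
    statement for the tail. *)
Lemma hsum_hsum K F ls : mlin K F -> good K ls -> hsum (hsum F) ls = 0.
Proof.
elim: K ls F => [|k0 K IH] [|y ys] F //= mF [ok g].
have ok' l : ok_rel k0 l -> ok_rel k0 (label0 l).
  by move=> okl; apply: ok_rel_trans okl _ => b n; case: l => a [x|u] /andP[/= bb _];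
     rewrite /label_ok /= bb homog0 //; [exact: dg_graded | exact: dg_graded].
have z l zs : ok_rel k0 l -> l = label0 l -> good K zs -> F (l :: zs) = 0.
  by move=> okl lE gzs; rewrite lE; apply: mlin_label0 mF _ gzs; apply: ok'.
have okh := ok_rel_trans ok (ok_rel_h (l := y)).
have oke := ok_rel_trans ok (ok_rel_e (l := y)).
rewrite z //; last 2 first.
- exact: ok_rel_trans okh (ok_rel_h (l := _)).
- by case: (y) => a [x|u]; rewrite /label_htpy /label0 /= ?(con_hh conP) ?(con_hh conW).
rewrite (eq_hsum (G := fun zs => 0 : M) g); last first.
  move=> zs gzs; apply: z gzs; first exact: ok_rel_trans okh (ok_rel_e (l := _)).
  by case: (y) => a [x|u]; rewrite /label_e /label_htpy /label0 /= ?(con_eh conP) ?(con_eh conW).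
have hsum0 zs : hsum (fun=> 0) zs = 0.
  by elim: zs => //= l zs ->; rewrite scaler0 addr0.
rewrite hsum0 scaler0 addr0 add0r.
rewrite (eq_hsum (G := fun zs => sg k y.1 *: hsum (fun ws => F (label_e (label_e y) :: ws)) zs
  + 0) g); last first.
  move=> zs gzs; rewrite addrC z ?add0r ?addr0 //.
  - exact: ok_rel_trans oke (ok_rel_h (l := _)).
  by case: (y) => a [x|u]; rewrite /label_e /label_htpy /label0 /= ?(con_he conP) ?(con_he conW).
rewrite hsum_lin hsum0 addr0 IH ?scaler0 //.
by apply: mlin_tail mF _; apply: ok_rel_trans oke (ok_rel_e (l := _)).
Qed.

Lemma hsumE l0 F ls : hsum F ls = \sum_(j < size ls)
  sg k (\sum_(l <- take j ls) l.1) *: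
    F (map label_e (take j ls) ++ label_htpy (nth l0 ls j) :: drop j.+1 ls).
Proof.
elim: ls F => [|y ys IH] F /=; first by rewrite big_ord0.
rewrite big_ord_recl /= big_nil sg0 scale1r drop0; congr (_ + _).
rewrite IH scaler_sumr; apply: eq_bigr => j _.
by rewrite /= big_cons sgD scalerA.
Qed.

Lemma dsumE l0 F ls : dsum F ls = \sum_(j < size ls)
  sg k (\sum_(l <- take j ls) l.1) *:
    F (take j ls ++ label_diff (nth l0 ls j) :: drop j.+1 ls).
Proof.
elim: ls F => [|y ys IH] F /=; first by rewrite big_ord0.
rewrite big_ord_recl /= big_nil sg0 scale1r drop0; congr (_ + _).
rewrite IH scaler_sumr; apply: eq_bigr => j _.
by rewrite /= big_cons sgD scalerA.
Qed.

End Functional.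

Lemma hsum_comp (M N : lmodType k) (f : M -> N) F ls : linear f ->
  f (hsum F ls) = hsum (fun zs => f (F zs)) ls.
Proof.
move=> lf; elim: ls F => [|y ys IH] F /=; first exact: lin0 lf.
by rewrite (linD lf) (linZ lf) IH.
Qed.

Lemma dsum_comp (M N : lmodType k) (f : M -> N) F ls : linear f ->
  f (dsum F ls) = dsum (fun zs => f (F zs)) ls.
Proof.
move=> lf; elim: ls F => [|y ys IH] F /=; first exact: lin0 lf.
by rewrite (linD lf) (linZ lf) IH.
Qed.

End TensorTrick.

(** * The tensor product homotopy on the coproduct *)

Section CoprodHomotopy.
Variables (k : comPzRingType) (P : opSeq k) (W : dgSeq k).
Variables (eP hP : P -> P) (eW hW : W -> W).
Hypothesis opP : is_dg_operad P.
Hypothesis dgW : is_dg_seq W.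
Hypothesis conP : is_contraction eP hP.
Hypothesis conW : is_contraction eW hW.
Let dgP := operad_seq opP.
Let grW := dg_graded dgW.
Local Notation L := (label P W).
Local Notation T := (ltree L).
Local Notation C := (graded_coprod P W).
Local Notation le := (label_e eP eW).
Local Notation lh := (label_htpy hP hW).
Local Notation ld := (@label_diff k P W).
Implicit Types (t s : T) (cs : seq T) (ls zs : seq L).

Let l0 : L := (0, inl 0).

(* [h_coprod i0 p h] is, up to conversion, the case of the contractions i0 p of P
   and of the canonical cylinder. *)
Definition coprod_htpy : coprod P W -> coprod P W :=
  ext (fun t => \sum_(j < size (labels t))
    sg k (\sum_(l <- take j (labels t)) l.1) *:
    tcls (relabel (fun r _ l =>
      if (r < j)%N then le l else if r == j then lh l else l) 0 t)).

Lemma relabel_admissible b (f : nat -> nat -> L -> L) off t :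
  (forall r n, (r < size (labels t))%N ->
     ok_rel (nth l0 (labels t) r) (f (off + r)%N n (nth l0 (labels t) r))) ->
  admissible_at b t -> admissible_at b (relabel f off t).
Proof.
elim/ltree_nested_ind: t b off => // x cs IH b off fok.
rewrite relabel_node !admissible_node size_relabel_forest => /andP[okx].
have := fok 0%N (size cs) (ltn0Sn _); rewrite addn0 => /(_ _ _ okx) /= ->.
have {}fok r n : (r < size (flatten (map (@labels L) cs)))%N ->
    ok_rel (nth l0 (flatten (map (@labels L) cs)) r)
      (f (off.+1 + r)%N n (nth l0 (flatten (map (@labels L) cs)) r)).
  by move=> rs; have := fok r.+1 n rs; rewrite addnS -addSn.
elim: cs off.+1 IH fok {okx} => //= c cs IHcs {}off [Hc Hcs] fok /andP[adc adcs].
apply/andP; split.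
  apply: Hc adc => r n rc; have := fok r n; rewrite size_cat nth_cat rc; apply.
  exact: ltn_addr.
apply: IHcs adcs => // r n rs; have := fok (size (labels c) + r)%N n.
rewrite size_cat nth_cat (ltnNge _ (size (labels c))) leq_addr /= addKn addnA; apply.
by rewrite ltn_add2l.
Qed.

Lemma good_nth K ls : good K ls -> size ls = size K /\
  (forall r, (r < size K)%N -> ok_rel (nth l0 K r) (nth l0 ls r)).
Proof.
elim: K ls => [|k0 K IH] [|l ls] //= [ok /IH[-> nthK]]; split=> // -[|r] //=.
exact: nthK.
Qed.

Lemma good_refl ls : good ls ls.
Proof. by elim: ls => //= l ls IH; split. Qed.

Definition tree_cls t zs : coprod P W := tcls (fill l0 zs t).

Lemma fill_admissible t zs : admissible t -> good (labels t) zs -> admissible (fill l0 zs t).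
Proof.
move=> adt /good_nth[szs nthz]; apply: relabel_admissible adt => r n rt.
by rewrite add0n; apply: nthz.
Qed.

Lemma mlin_tree_cls t : admissible t -> mlin (labels t) (tree_cls t).
Proof.
move=> adt c us l1 l2 l ws lc g1 g2; have [sz _] := good_nth g1.
apply: (multilinear_tcls opP grW); try exact: fill_admissible.
apply: (@lin_relabel k P W L c _ _ _ 0%N (size us)).
- move=> r _ _ ne; rewrite !nth_cat; case: ltnP => // ur.
  by case E : (r - size us)%N => [|m] //; case/eqP: ne; lia.
- by move=> _ _; rewrite !nth_cat ltnn subnn.
by rewrite /= add0n -sz size_cat /=; lia.
Qed.

Lemma htpy_tree_sum t : \sum_(j < size (labels t))
    sg k (\sum_(l <- take j (labels t)) l.1) *:
    tcls (relabel (fun r _ l =>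
      if (r < j)%N then le l else if r == j then lh l else l) 0 t) =
  hsum eP hP eW hW (tree_cls t) (labels t).
Proof.
rewrite (hsumE _ _ _ _ l0); apply: eq_bigr => -[j jt] _ /=; congr (_ *: tcls _).
apply: (relabel_fill (f := fun r l =>
    if (r < j)%N then le l else if r == j then lh l else l) (x0 := l0)).
  by rewrite size_cat size_map /= size_drop size_takel ?(ltnW jt) //; lia.
move=> r rt; rewrite nth_cat size_map size_takel ?(ltnW jt) //.
case: ltnP => rj; first by rewrite (nth_map l0) ?nth_take // size_takel ?(ltnW jt).
case: eqP => [->|ne]; first by rewrite subnn.
have -> : (r - j = (r - j.+1).+1)%N by lia.
by rewrite /= nth_drop; congr nth; lia.
Qed.

(** For the zero twisting each generator goes to a single generator of the same kind, so each term
    of the Leibniz sum is again the class of a labeled tree, with one label differentiated. *)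
Lemma diff_tree_sum t : admissible t ->
  twisted_diff ((fun=> 0) : W -> P) (tcls t) = dsum (tree_cls t) (labels t).
Proof.
move=> adt; have z := zero_twisting W opP.
rewrite /twisted_diff (derivation_tcls opP grW (twisted_diff_der opP grW dgW (proj1 z)) adt).
rewrite /leibniz (dsumE l0); apply: eq_bigr => -[j jt] _ /=; congr (_ *: _).
have g : good (labels t) (take j (labels t) ++ ld (nth l0 (labels t) j) :: drop j.+1 (labels t)).
  rewrite -{1}(cat_take_drop j (labels t)) (drop_nth l0 jt).
  elim: (take j _) => [|l ls IH] /=; last by split.
  by split; [apply: ok_rel_diff | apply: good_refl].
rewrite /tree_cls -(ucomp_in_label opP grW (fill_admissible adt g)) /ucomp.
rewrite -(relabel_tmap _ 0) relabel_relabel; congr compose.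
apply: (eq_relabel (x0 := l0)) => r n rt; rewrite !add0n nth_cat size_takel ?(ltnW jt) //.
case: ltnP => rj; first by rewrite nth_take // (ltn_eqF rj).
case: eqP => [->|ne].
  rewrite subnn /=; case: (nth _ _ _) => a [x|v] //=.
  by rewrite inO0 ?addr0.
have -> : (r - j = (r - j.+1).+1)%N by lia.
by rewrite /= nth_drop; congr (in_label _ (nth _ _ _)); lia.
Qed.

Lemma lin_label_degrees c t1 t2 t : lin_label c t1 t2 t ->
  map fst (labels t1) = map fst (labels t) /\ map fst (labels t2) = map fst (labels t).
Proof.
elim=> // {t1 t2 t} l lft t1 t2 t rgt _ [E1 E2] /=.
by rewrite !map_cat /= !flatten_cat /= !map_cat E1 E2.
Qed.

Lemma relabel_lin c (g : nat -> L -> L) off t1 t2 t : lin_label c t1 t2 t ->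
  (forall r l1 l2 l, lin_comb c l1 l2 l -> lin_comb c (g r l1) (g r l2) (g r l)) ->
  lin_label c (relabel (fun r _ => g r) off t1) (relabel (fun r _ => g r) off t2)
    (relabel (fun r _ => g r) off t).
Proof.
move=> Ll gl; elim: Ll off => {t1 t2 t} [a x y cs|a x y cs|l lft t1 t2 t rgt Ll IH] off;
  rewrite !relabel_node.
- by case: (gl off _ _ _ (@LinCombO k P W c a x y)) => *; constructor.
- by case: (gl off _ _ _ (@LinCombV k P W c a x y)) => *; constructor.
have sz : size (labels t1) = size (labels t) /\ size (labels t2) = size (labels t).
  by have [E1 E2] := lin_label_degrees Ll; rewrite -!(size_map fst) E1 E2.
have fE u o : relabel_forest (fun r _ => g r) o (lft ++ u :: rgt) =
    relabel_forest (fun r _ => g r) o lft ++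
    relabel (fun r _ => g r) (o + size (flatten (map (@labels L) lft))) u ::
    relabel_forest (fun r _ => g r)
      (o + size (flatten (map (@labels L) lft)) + size (labels u)) rgt.
  elim: lft o => [|d lft IHl] o /=; first by rewrite addn0.
  by rewrite IHl size_cat !addnA.
rewrite !fE sz.1 sz.2; exact: LinSub.
Qed.

Let lin_e c l1 l2 l : lin_comb c l1 l2 l -> lin_comb c (le l1) (le l2) (le l).
Proof.
by case=> a x y; rewrite /label_e /= ?(con_e conP).1.1 ?(con_e conW).1.1; constructor.
Qed.

Let lin_h c l1 l2 l : lin_comb c l1 l2 l -> lin_comb c (lh l1) (lh l2) (lh l).
Proof.
by case=> a x y; rewrite /label_htpy /= ?(con_h conP).1 ?(con_h conW).1; constructor.
Qed.

Lemma htpy_admissible j t : admissible t -> admissible (relabel (fun r _ l =>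
      if (r < j)%N then le l else if r == j then lh l else l) 0 t).
Proof.
apply: relabel_admissible => r n _; case: ltnP => _; first exact: (ok_rel_e conP conW).
by case: eqP => _; [apply: (ok_rel_h conP conW) | move=> ? ?].
Qed.

Let htpy_multilinear : multilinear (fun t => \sum_(j < size (labels t))
    sg k (\sum_(l <- take j (labels t)) l.1) *:
    tcls (relabel (fun r _ l =>
      if (r < j)%N then le l else if r == j then lh l else l) 0 t) : coprod P W).
Proof.
move=> c t1 t2 t ad1 ad2 Ll; have [E1 E2] := lin_label_degrees Ll.
have degE ls j : \sum_(l <- take j ls) l.1 = \sum_(a <- take j (map fst ls)) a :> int.
  by rewrite -map_take big_map.
rewrite -!(size_map fst (labels _)) E1 E2 scaler_sumr -big_split; apply: eq_bigr => j _ /=.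
rewrite !degE E1 E2 scalerA mulrC -scalerA -scalerDr; congr (_ *: _).
apply: (multilinear_tcls opP grW); try exact: htpy_admissible.
apply: (relabel_lin (g := fun r l => if (r < j)%N then le l else if r == j then lh l else l)) Ll _.
by move=> r l1 l2 l lc; case: ifP => _; [exact: lin_e | case: ifP => _ //; exact: lin_h].
Qed.

Lemma coprod_htpy_linear : linear coprod_htpy.
Proof. exact: ext_linear htpy_multilinear. Qed.

Lemma coprod_htpy_tcls t : admissible t ->
  coprod_htpy (tcls t) = \sum_(j < size (labels t))
    sg k (\sum_(l <- take j (labels t)) l.1) *:
    tcls (relabel (fun r _ l =>
      if (r < j)%N then le l else if r == j then lh l else l) 0 t).
Proof. exact: (ext_tcls htpy_multilinear). Qed.

Lemma coprod_htpy_sum t : admissible t ->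
  coprod_htpy (tcls t) = hsum eP hP eW hW (tree_cls t) (labels t).
Proof. by move=> adt; rewrite -htpy_tree_sum coprod_htpy_tcls. Qed.

Lemma tree_cls_fill t zs ws : size zs = size (labels t) ->
  tree_cls (fill l0 zs t) ws = tree_cls t ws.
Proof. by move=> sz; rewrite /tree_cls /fill relabel_relabel. Qed.

Lemma fill_labels t : fill l0 (labels t) t = t.
Proof.
rewrite /fill (eq_relabel (x0 := l0) (g := fun _ _ l => l)); last by move=> r n _; rewrite add0n.
rewrite (relabel_tmap (fun _ l => l)); elim/ltree_nested_ind: t => //= l cs IH; congr Node.
by elim: cs IH => //= c cs IHcs [-> /IHcs ->].
Qed.

Lemma coprod_htpy_homotopy t : admissible t ->
  twisted_diff ((fun=> 0) : W -> P) (coprod_htpy (tcls t)) +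
  coprod_htpy (twisted_diff ((fun=> 0) : W -> P) (tcls t)) =
  tcls (tmap (fun=> le) t) - tcls t.
Proof.
move=> adt; have z := zero_twisting W opP.
rewrite coprod_htpy_sum // diff_tree_sum //.
rewrite (hsum_comp _ _ _ _ _ _ (twisted_diff_linear opP dgW z)).
rewrite (dsum_comp _ _ coprod_htpy_linear).
have gt := good_refl (labels t).
(* The inner operator acts on the trees [fill l0 zs t], whose labels are [zs] and whose shape is
   that of [t]; so it is again a sum over lists for [tree_cls t]. *)
rewrite (eq_hsum conP conW (G := dsum (tree_cls t)) gt); last first.
  move=> zs gz; have [sz _] := good_nth gz.
  rewrite diff_tree_sum ?labels_fill //; last exact: fill_admissible.
  by congr dsum; apply/funext => ws; apply: tree_cls_fill.
rewrite (eq_dsum dgP dgW (G := hsum eP hP eW hW (tree_cls t)) gt); last first.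
  move=> zs gz; have [sz _] := good_nth gz.
  rewrite coprod_htpy_sum ?labels_fill //; last exact: fill_admissible.
  by congr hsum; apply/funext => ws; apply: tree_cls_fill.
rewrite (hsum_dsum conP conW dgP dgW (mlin_tree_cls adt) gt).
congr (_ - _); last by rewrite /tree_cls fill_labels.
rewrite /tree_cls -(relabel_tmap _ 0); congr tcls; symmetry.
by apply: (relabel_fill (f := fun=> le) (x0 := l0)) => [|r rt]; rewrite ?size_map // (nth_map l0).
Qed.

Lemma coprod_htpy2 x : coprod_htpy (coprod_htpy x) = 0.
Proof.
have lh := coprod_htpy_linear.
move: x; apply: coprod_ind => [|c x y Hx Hy|t adt]; first by rewrite !(lin0 lh).
  by rewrite !lh Hx Hy scaler0 addr0.
have gt := good_refl (labels t).
rewrite coprod_htpy_sum // (hsum_comp _ _ _ _ _ _ lh).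
rewrite (eq_hsum conP conW (G := hsum eP hP eW hW (tree_cls t)) gt); last first.
  move=> zs gz; have [sz _] := good_nth gz.
  rewrite coprod_htpy_sum ?labels_fill //; last exact: fill_admissible.
  by congr hsum; apply/funext => ws; apply: tree_cls_fill.
exact: (hsum_hsum conP conW dgP dgW (mlin_tree_cls adt) gt).
Qed.

(** As 0 = 1 * 0 + 0, multilinearity at the rank [r0] shows that the class equals twice itself. *)
Lemma tcls_label0 X (f : nat -> nat -> X -> L) (t : ltree X) r0 :
  (forall n x, f r0 n x = label0 (f r0 n x)) -> (r0 < size (labels t))%N ->
  tcls (relabel f 0 t) = 0.
Proof.
move=> f0 rt; case: (boolP (admissible (relabel f 0 t))) => [ad|/tcls_nadm //].
have L1 : lin_label 1 (relabel f 0 t) (relabel f 0 t) (relabel f 0 t).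
  apply: (lin_relabel (r0 := r0)) => // n x; rewrite f0.
  case: (f r0 n x) => a [y|u]; rewrite /label0 /=.
    by have := @LinCombO k P W 1 a 0 0; rewrite scaler0 addr0.
  by have := @LinCombV k P W 1 a 0 0; rewrite scaler0 addr0.
have := multilinear_tcls opP grW ad ad L1.
by rewrite scale1r => /esym/eqP; rewrite -subr_eq0 addrK => /eqP.
Qed.

Lemma coprod_htpy_homog n a (x : C) : homog n a x -> @homog k C n (a + 1) (coprod_htpy x).
Proof.
have grC := coprod_graded opP grW.
move: x; apply: (homog_ind opP grW) => [|c x y hx hy|t adt <- <-].
- by rewrite (lin0 coprod_htpy_linear); exact: (homog0 grC).
- by rewrite coprod_htpy_linear; exact: (homogZD grC _ hx hy).
rewrite [coprod_htpy _](ext_tcls htpy_multilinear adt).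
apply: (homog_sum grC) => -[j jt] /=; apply: (homogZ grC).
apply: (homog_tclsE opP grW); first by rewrite nleaves_relabel.
rewrite /tdeg (big_nth l0) size_labels_relabel big_mkord [in RHS](big_nth l0) big_mkord.
(* The degree is raised at the single rank [j]; the total degree is compared rank by rank with this
   indicator. *)
have E : \sum_(r < size (labels t)) (if r == j :> nat then 1 : int else 0) = 1.
  by rewrite -big_mkcond /= (big_pred1 (Ordinal jt)).
rewrite -[X in _ = _ + X]E.
rewrite -big_split; apply: eq_bigr => -[r rt] _ /=.
rewrite (nth_labels_relabel l0 _ (fun r l => if (r < j)%N then le l else if r == j then lh l else l)) // add0n.
case: ltnP => rj; first by rewrite (ltn_eqF rj) addr0.
by case: eqP => // _; rewrite addr0.
Qed.

End CoprodHomotopy.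

(** * The weight filtration and local nilpotence *)

Section Weight.
Variables (k : comPzRingType) (P : opSeq k) (W : dgSeq k).
Hypothesis opP : is_dg_operad P.
Hypothesis dgW : is_dg_seq W.
Let grW := dg_graded dgW.
Local Notation L := (label P W).
Local Notation T := (ltree L).
Local Notation C := (graded_coprod P W).
Let opC : is_graded_operad C := coprod_operad opP grW.
Implicit Types (t s : T) (cs : seq T).

(** The bound on weights is strict, so that level 0 of the filtration is zero and the descent ends
    there. *)
Inductive wspan (w : nat) : coprod P W -> Prop :=
| wspan0 : wspan w 0
| wspanD c x y : wspan w x -> wspan w y -> wspan w (c *: x + y)
| wspan_tcls t : admissible t -> (weight t < w)%N -> wspan w (tcls t).

Lemma wspan_zero x : wspan 0 x -> x = 0.
Proof. by elim=> // c y z _ -> _ ->; rewrite scaler0 addr0. Qed.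

Lemma wspanZ w c x : wspan w x -> wspan w (c *: x).
Proof. by move=> wx; rewrite -[c *: x]addr0; apply: wspanD => //; apply: wspan0. Qed.

Lemma wspan_add w x y : wspan w x -> wspan w y -> wspan w (x + y).
Proof. by move=> wx wy; rewrite -[x]scale1r; apply: wspanD. Qed.

Lemma wspan_sum w I (r : seq I) (F : I -> coprod P W) :
  (forall i, wspan w (F i)) -> wspan w (\sum_(i <- r) F i).
Proof. by move=> H; elim/big_ind: _ => //; [exact: wspan0 | exact: wspan_add]. Qed.

Lemma wspan_le w w' x : (w <= w')%N -> wspan w x -> wspan w' x.
Proof.
move=> ww; elim=> [|c y z _ Hy _ Hz|t adt tw].
- exact: wspan0.
- exact: wspanD.
by apply: wspan_tcls => //; apply: leq_trans ww.
Qed.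

Lemma wspan_ex x : exists w, wspan w x.
Proof.
move: x; apply: coprod_ind => [|c x y [w wx] [w' wy]|t adt].
- by exists 0%N; apply: wspan0.
- exists (maxn w w'); apply: wspanD; first exact: wspan_le (leq_maxl _ _) wx.
  exact: wspan_le (leq_maxr _ _) wy.
by exists (weight t).+1; apply: wspan_tcls.
Qed.

Lemma grafted_weight b s i t e t' : admissible s -> admissible_at b t ->
  grafted s i t e t' -> weight t' = (weight t + weight s)%N.
Proof.
move=> ads + g; elim: g b => {i t e t'} [l lft rgt m ds sE|l lft x xs rgt i e c ix g IH] b.
  case/admissible_leaf_parent=> a [y [-> _ _ _ _]].
  have [d [z [ds' [+ _ _]]]] := admissible_root ads; rewrite sE => -[-> _].
  have wl : weight (Leaf : T) = 0%N by [].
  by rewrite !weight_node /= !map_cat !sumn_cat /= wl; lia.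
case/admissible_child=> _ _ adx _.
by rewrite !weight_node !map_cat !sumn_cat /= (IH _ adx); lia.
Qed.

(** Weights add under grafting; the successor in the bound is due to the two strict inequalities. *)
Lemma wspan_circ i w w1 w2 (x y : C) : wspan w1 x -> wspan w2 y -> (w1 + w2 <= w.+1)%N ->
  wspan w (@circ k C i x y).
Proof.
move=> wx wy ww; elim: wx => [|c z z' _ Hz _ Hz'|t adt tw].
- by rewrite (lin0 (go_linl opC i y)); apply: wspan0.
- by rewrite (go_linl opC); apply: wspanD.
elim: wy => [|c z z' _ Hz _ Hz'|s ads sw].
- by rewrite (lin0 (go_linr opC i _)); apply: wspan0.
- by rewrite (go_linr opC); apply: wspanD.
case: (ltnP i (nleaves t)) => it; last by rewrite circ_tcls_out //; apply: wspan0.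
have [e [t' [g adt']]] := grafted_ex opP adt ads it.
rewrite (circ_tcls opP grW adt ads g); apply/wspanZ/wspan_tcls => //.
by rewrite (grafted_weight (b := true) ads adt g); lia.
Qed.

Lemma weight_relabel (g : nat -> L -> L) off t :
  (forall r l, (if (g r l).2 is inr _ then true else false) =
               (if l.2 is inr _ then true else false)) ->
  weight (relabel (fun r _ => g r) off t) = weight t.
Proof.
move=> gE; elim/ltree_nested_ind: t off => // l cs IH off.
rewrite relabel_node !weight_node; congr (_ + _)%N.
  by have := gE off l; case: (g off l).2 => ?; case: l.2.
by elim: cs off.+1 IH => //= c cs IHcs {}off [Hc Hcs]; rewrite Hc IHcs.
Qed.

Lemma weight_leaves n : sumn (map (@weight k P W) (nseq n (Leaf : T))) = 0%N.
Proof. by elim: n => //= n ->. Qed.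

Lemma wspan_inO n a (x : P) : homog n a x -> wspan 1 (inO W n a x).
Proof.
move=> hx; apply: wspan_tcls; first exact: admissible_inO.
by rewrite weight_node weight_leaves.
Qed.

Lemma wspan_inV n a (v : W) : homog n a v -> wspan 2 (inV P n a v).
Proof.
move=> hv; apply: wspan_tcls; first exact: admissible_inV.
rewrite !weight_node /= weight_node /= (_ : sumn _ = 0%N) //.
by elim: n {hv} => //= n ->.
Qed.

Variable del : W -> P.
Hypothesis deg_del : is_deg_map (-1) del.
Let derE := del_ext_der opP grW deg_del.

Lemma del_ext_linear : linear (del_ext del).
Proof. exact: (derivation_linear opP grW derE). Qed.

Lemma del_ext_homog n a (x : C) : homog n a x -> @homog k C n (a - 1) (del_ext del x).
Proof. exact: (derivation_homog opP grW derE). Qed.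

(** In the Leibniz rule only one factor loses weight; the conjunction in the induction keeps the
    bound on the other factor available. *)
Lemma del_ext_wspan w x : wspan w.+1 x -> wspan w (del_ext del x).
Proof.
have le := del_ext_linear.
elim=> [|c y z _ Hy _ Hz|t adt tw].
- by rewrite (lin0 le); apply: wspan0.
- by rewrite le; apply: wspanD.
suff [_ H] : wspan (weight t).+1 (tcls t) /\ wspan (weight t) (del_ext del (tcls t)).
  exact: wspan_le H.
apply: (tree_ind opP grW (P := fun w y => wspan w.+1 y /\ wspan w (del_ext del y))) adt.
- move=> n a y hy; split; first exact: wspan_inO.
  by rewrite /del_ext (derivation_inO opP grW derE hy); apply: wspan0.
- move=> n a v hv; split; first exact: wspan_inV.
  rewrite /del_ext (derivation_inV opP grW derE hv); apply: wspan_inO.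
  exact: deg_map_homog deg_del hv.
move=> i p q a b w1 w2 y z ip hy hz [wy wdy] [wz wdz]; split.
  by apply: wspan_circ wy wz _; lia.
rewrite /del_ext (derivation_circ opP grW derE ip hy hz); apply: wspan_add.
  by apply: wspan_circ wdy wz _; lia.
by apply: wspanZ; apply: wspan_circ wy wdz _; lia.
Qed.

Variables (eP hP : P -> P) (eW hW : W -> W).
Hypothesis conP : is_contraction eP hP.
Hypothesis conW : is_contraction eW hW.
Local Notation H := (coprod_htpy eP hP eW hW).

(** Each summand replaces labels by labels of the same kind, on the same shape. *)
Lemma coprod_htpy_wspan w x : wspan w x -> wspan w (H x).
Proof.
have lH := coprod_htpy_linear opP dgW conP conW.
elim=> [|c y z _ Hy _ Hz|t adt tw].
- by rewrite (lin0 lH); apply: wspan0.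
- by rewrite lH; apply: wspanD.
rewrite (coprod_htpy_tcls opP dgW conP conW adt); apply: wspan_sum => j; apply: wspanZ.
apply: wspan_tcls; first exact: (htpy_admissible conP conW).
by rewrite (weight_relabel (g := fun r l =>
  if (r < j)%N then label_e eP eW l else if r == j then label_htpy hP hW l else l)) // => r [a [z|u]]; do 2 (case: ifP => //).
Qed.

Lemma htpy_del_nilpotent x : exists N, forall n, (N <= n)%N ->
  iter n (H \o del_ext del) x = 0.
Proof.
have lH := coprod_htpy_linear opP dgW conP conW; have le := del_ext_linear.
have [w wx] := wspan_ex x; exists w => n wn; apply: wspan_zero.
elim: n w x wx wn => [|n IH] w x wx wn; first by move: wx; rewrite leqn0 in wn; rewrite (eqP wn).
rewrite iterSr; case: w wx wn => [|w] wx wn.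
  by rewrite (wspan_zero wx) /= (lin0 le) (lin0 lH); apply: (IH 0%N) => //; apply: wspan0.
apply: (IH w) => //; apply: coprod_htpy_wspan; exact: del_ext_wspan.
Qed.

End Weight.

(** * The perturbation lemma *)

Section Perturbation.
Variables (k : comPzRingType) (M : lmodType k).
Variables (d e D h E : M -> M).
Hypotheses (ld : linear d) (le : linear e) (lD : linear D) (lh : linear h) (lE : linear E).
Hypothesis DE : forall x, D x = d x + e x.
Hypothesis d2 : forall x, d (d x) = 0.
Hypothesis D2 : forall x, D (D x) = 0.
Hypothesis homotopy : forall x, d (h x) + h (d x) = E x - x.
Hypothesis h2 : forall x, h (h x) = 0.
Hypothesis heE : forall x, h (e (E x)) = 0.
Hypothesis Eeh : forall x, E (e (h x)) = 0.
Hypothesis nilpotent : forall x, exists N, forall n, (N <= n)%N -> iter n (h \o e) x = 0.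

Lemma iter_linear (f : M -> M) n : linear f -> linear (iter n f).
Proof. by move=> lf; elim: n => [|n IH] c x y //; rewrite !iterS IH lf. Qed.

(** Nilpotence is only local, so a bound is chosen for each element; any larger bound gives the same
    sum, by [pertE]. *)
Definition pert_bound x : nat := sval (cid (nilpotent (h x))).

Definition pert x : M := \sum_(n < pert_bound x) iter n (h \o e) (h x).

Let A := h \o e.
Let lA : linear A. Proof. by move=> c x y; rewrite /A /= le lh. Qed.

Lemma pert_boundP x n : (pert_bound x <= n)%N -> iter n (h \o e) (h x) = 0.
Proof. exact: (svalP (cid (nilpotent (h x)))). Qed.

(** Allows a common range of summation for several elements, so that their sums compare term by
    term. *)
Lemma pertE x m : (pert_bound x <= m)%N -> pert x = \sum_(n < m) iter n (h \o e) (h x).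
Proof.
move=> xm; rewrite -(subnKC xm) big_split_ord /= [X in _ = _ + X]big1 ?addr0 // => n _.
by apply: pert_boundP; apply: leq_addr.
Qed.

Lemma pert_linear : linear pert.
Proof.
move=> c x y; pose m := maxn (pert_bound (c *: x + y)) (maxn (pert_bound x) (pert_bound y)).
rewrite !(@pertE _ m) ?leq_max ?leqnn ?orbT // scaler_sumr -big_split.
by apply: eq_bigr => n _; rewrite lh (iter_linear _ lA).
Qed.

Lemma pert_ind (Q : M -> Prop) x : Q 0 -> (forall y z, Q y -> Q z -> Q (y + z)) ->
  (forall n, Q (iter n (h \o e) (h x))) -> Q (pert x).
Proof. by move=> Q0 QD Qn; apply: (big_ind Q). Qed.

Lemma iter_h n x : exists y, iter n (h \o e) (h x) = h y.
Proof. by case: n => [|n]; eexists; reflexivity. Qed.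

Lemma pertS x : pert x = h x + h (e (pert x)).
Proof.
(* One term beyond the bound makes the tail of the series the image under h e of the whole sum. *)
rewrite {1}(pertE (leqnSn (pert_bound x))) big_ord_recl /=; congr (_ + _).
by rewrite /pert (lin_sum le) (lin_sum lh).
Qed.

(** Both sides are the series without its first term, that is [pert x - h x]. *)
Lemma pert_right x : pert (e (h x)) = h (e (pert x)).
Proof.
have -> : h (e (pert x)) = pert x - h x by rewrite {2}pertS addrC addrA addNr add0r.
pose m := maxn (pert_bound (e (h x))) (pert_bound x).
rewrite (@pertE (e (h x)) m) ?leq_max ?leqnn // (@pertE x m.+1); last first.
  by rewrite leqW // leq_max leqnn orbT.
rewrite big_ord_recl /= addrC addKr; apply: eq_bigr => n _.
by rewrite -[RHS]/(iter n.+1 (h \o e) (h x)) iterSr.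
Qed.

Let fixed_nil x : x = h (e x) -> x = 0.
Proof.
move=> xE; have [N HN] := nilpotent x.
rewrite -(HN N (leqnn N)); elim: N {HN} => //= N <-.
exact: xE.
Qed.

(* 1 - h e is injective and 1 - e h is surjective; composed with them on the left
   and on the right, the identity becomes one between words in d, e and h. *)
Lemma pert_homotopy x : D (pert x) + pert (D x) = E x - x.
Proof.
pose Z x := D (pert x) + pert (D x) - (E x - x).
have lp := pert_linear.
have lZ : linear Z.
  move=> c y z; rewrite /Z lp !lD lp lE !scalerDr !scalerN !scalerDr !scalerN.
  rewrite !opprD !opprK.
  set a1 := c *: _; set a2 := D _; set a3 := c *: pert _; set a4 := pert _.
  set a5 := c *: E _; set a6 := E _; set a7 := c *: y.
  by rewrite [LHS](AC ((2 * 2) * ((2) * (2))) (((1 * 3) * (5 * 7)) * ((2 * 4) * (6 * 8)))).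
(* If [Z] vanishes on the image of 1 - e h, it is invariant under e h, and iterating e h reaches 0
   because e (h e)^N h does. *)
suff Z0 y : Z (y - e (h y)) = 0.
  have ZE y : Z y = Z (e (h y)) by apply/eqP; rewrite -subr_eq0 -(linB lZ) Z0.
  apply/eqP; rewrite -subr_eq0; apply/eqP; rewrite -/(Z x) ZE.
  have [N HN] := nilpotent (h x).
  have {HN} := HN N (leqnn N); elim: N x => [|N IH] y.
    by move=> /= ->; rewrite (lin0 le) (lin0 lZ).
  by rewrite iterSr ZE => /IH.
(* It remains to see that [Z w] is fixed by h e. The gain of working with [w] is that [pert w] is
   simply [h y], by [pert_right]. *)
apply: fixed_nil; have [w wE] : exists w, w = y - e (h y) by exists (y - e (h y)).
rewrite -wE.
have pw : pert w = h y by rewrite wE (linB lp) pert_right {1}pertS addrK.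
have Zw : Z w = D (h y) + pert (D w) - (E w - w) by rewrite /Z pw.
have pD : pert (D w) = h (D w) + h (e (pert (D w))) by rewrite {1}pertS.
apply/eqP; rewrite -subr_eq0 Zw.
rewrite (linB le) (linD le) (linB lh) (linD lh) {1}pD.
(* D D = 0 and d d = 0 give e d + d e + e e = 0; this is applied to [h y] and followed by h. *)
have DDe : h (e (d (h y))) + h (d (e (h y))) + h (e (e (h y))) = 0.
  have := D2 (h y); rewrite !DE (linD ld) (linD le) d2 add0r => /(congr1 h).
  by rewrite (lin0 lh) !(linD lh) => <-; rewrite addrCA addrA.
have -> : E w = E y by rewrite wE (linB lE) Eeh subr0.
rewrite (linB le) (linB lh) heE sub0r opprK.
rewrite DE !(linD le) !(linD lh).
have -> : h (D w) = h (d y) - h (d (e (h y))) + (h (e y) - h (e (e (h y)))).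
  by rewrite DE (linD lh) wE (linB ld) (linB le) !(linB lh).
have -> : h (e w) = h (e y) - h (e (e (h y))) by rewrite wE (linB le) (linB lh).
have -> : E y = d (h y) + h (d y) + y by rewrite homotopy subrK.
rewrite wE !(opprD, opprK); apply/eqP.
(* Of the seventeen terms, seven pairs cancel and the last three are [DDe] up to sign. *)
rewrite [LHS](AC (2 * ((2 * 2) * 1) * (3 * 2) * (3 * 2))
  ((1 * 8) * (2 * 12) * (3 * 9) * (5 * 16) * (7 * 15) * (11 * 10) * (17 * 6) * (13 * 4 * 14))) /=.
by rewrite !subrr !add0r -!opprD DDe oppr0.
Qed.

Lemma pert_h x : h (pert x) = 0.
Proof.
apply: (pert_ind (Q := fun y => h y = 0)); first exact: lin0 lh.
  by move=> y z hy hz; rewrite (linD lh) hy hz addr0.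
by move=> n; have [y ->] := iter_h n x; apply: h2.
Qed.

Lemma pert_kernel x : h x = 0 -> pert x = 0.
Proof.
move=> hx; rewrite /pert hx big1 // => n _.
exact: (lin0 (iter_linear _ lA)).
Qed.

Lemma pert2 x : pert (pert x) = 0.
Proof. exact/pert_kernel/pert_h. Qed.

End Perturbation.

(** * The induced strong pseudo-cylinder *)

Section InducedCylinder.
Variables (k : comPzRingType) (O P : opSeq k) (V : dgSeq k).
Variables (i0 i1 : O -> P) (p : P -> O) (hO : P -> P) (del : V -> O).
Hypothesis opO : is_dg_operad O.
Hypothesis cylP : is_operad_cylinder i0 i1 p hO.
Hypothesis dgV : is_dg_seq V.
Hypothesis tw : is_twisting del.
Let opP : is_dg_operad P := opcyl_operad cylP.
Let sdrP : is_sdr i0 p hO := cyl_sdr (opcyl_cyl cylP).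
Let sdrV := cyl_is_sdr dgV.
Let dgI : is_dg_seq (cyl V) := cyl_dg dgV.
Let delI := del_cyl i0 i1 hO del.
Let twI : is_twisting delI := del_cyl_twisting cylP tw.
Let conP := sdr_contraction sdrP.
Let conV := sdr_contraction sdrV.
Let grV := dg_graded dgV.
Let grI := dg_graded dgI.
Let ldel : linear del := (proj1 tw).1.
Local Notation h := (@h_coprod k O P V i0 p hO).
Local Notation j0 := (coprod_map i0 (@cyl_in0 k V)).
Local Notation j1 := (coprod_map i1 (@cyl_in1 k V)).
Local Notation q := (coprod_map p (@cyl_p k V)).

Let del_i0 v : i0 (del v) = delI (cyl_in0 v).
Proof.
rewrite /delI /del_cyl /= (lin0 ldel) (lin0 (opmap_chain (opcyl_i1 cylP)).1.1).
by rewrite (lin0 (sdr_h sdrP).1) subr0 addr0.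
Qed.

Let del_i1 v : i1 (del v) = delI (cyl_in1 v).
Proof.
rewrite /delI /del_cyl /= (lin0 ldel) (lin0 (opmap_chain (opcyl_i1 cylP)).1.1).
by rewrite (lin0 (sdr_i sdrP).1.1) (lin0 (sdr_h sdrP).1) subr0 add0r.
Qed.

(** p h = 0 removes the suspended component, and p i0 = p i1 = 1 reduces the other two to [del]. *)
Let del_p u : p (delI u) = del (cyl_p u).
Proof.
have lp := (sdr_p sdrP).1.1.
rewrite /delI /del_cyl /cyl_p (linD lp) (linB lp) (sdr_pi sdrP) (sdr_ph sdrP).
by rewrite (cyl_pi1 (opcyl_cyl cylP)) subr0 (linD ldel).
Qed.

Let map_i0 := coprod_map_operad_map opO opP dgV dgI (opcyl_i0 cylP)
  (sdr_i sdrV) (proj1 tw) (proj1 twI) del_i0.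
Let map_i1 := coprod_map_operad_map opO opP dgV dgI (opcyl_i1 cylP)
  (cyl_in1_chain dgV) (proj1 tw) (proj1 twI) del_i1.
Let map_p := coprod_map_operad_map opP opO dgI dgV (opcyl_p cylP)
  (sdr_p sdrV) (proj1 twI) (proj1 tw) del_p.

Let lj0 : linear j0 := (opmap_chain map_i0).1.1.
Let lj1 : linear j1 := (opmap_chain map_i1).1.1.
Let lq : linear q := (opmap_chain map_p).1.1.
Let lh : linear h := coprod_htpy_linear opP dgI conP conV.
Let le : linear (del_ext delI) := del_ext_linear opP dgI (proj1 twI).

Let j0_tcls t := coprod_map_tcls opO opP grV grI (opcyl_i0 cylP) (sdr_i sdrV).1 (t := t).
Let j1_tcls t := coprod_map_tcls opO opP grV grI (opcyl_i1 cylP) (cyl_in1_chain dgV).1 (t := t).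
Let q_tcls t := coprod_map_tcls opP opO grI grV (opcyl_p cylP) (sdr_p sdrV).1 (t := t).

Let q_j0 x : q (j0 x) = x.
Proof.
move: x; apply: coprod_ind => [|c x y Hx Hy|t adt]; first by rewrite (lin0 lj0) (lin0 lq).
  by rewrite lj0 lq Hx Hy.
rewrite j0_tcls // q_tcls; last exact: tmap_admissible (opcyl_i0 cylP) (sdr_i sdrV).1 _ _ adt.
rewrite tmap_tmap (tmap_id (f := fun l => map_label p (@cyl_p k V) (map_label i0 (@cyl_in0 k V) l))) //.
by case=> a [x|v]; rewrite /map_label /= ?(sdr_pi sdrP) ?(sdr_pi sdrV).
Qed.

Let q_j1 x : q (j1 x) = x.
Proof.
move: x; apply: coprod_ind => [|c x y Hx Hy|t adt]; first by rewrite (lin0 lj1) (lin0 lq).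
  by rewrite lj1 lq Hx Hy.
rewrite j1_tcls // q_tcls; last exact: tmap_admissible (opcyl_i1 cylP) (cyl_in1_chain dgV).1 _ _ adt.
rewrite tmap_tmap (tmap_id (f := fun l => map_label p (@cyl_p k V) (map_label i1 (@cyl_in1 k V) l))) //.
case=> a [x|v]; rewrite /map_label /= ?(cyl_pi1 (opcyl_cyl cylP)) //.
by rewrite /cyl_p /= add0r.
Qed.

(** Each summand has one label in the image of a homotopy; p sends it to 0, and a tree with a zero
    label has zero class. *)
Let q_h x : q (h x) = 0.
Proof.
move: x; apply: coprod_ind => [|c x y Hx Hy|t adt]; first by rewrite (lin0 lh) (lin0 lq).
  by rewrite lh lq Hx Hy scaler0 addr0.
rewrite [h _](coprod_htpy_tcls opP dgI conP conV adt) (lin_sum lq) big1 // => -[j jt] _ /=.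
rewrite (linZ lq) q_tcls; last exact: (htpy_admissible conP conV).
rewrite -(relabel_tmap _ 0) relabel_relabel (tcls_label0 opO dgV (r0 := j)) ?scaler0 //.
move=> n l; rewrite ltnn eqxx; case: l => a [x|u]; rewrite /map_label /label_htpy /label0 /=.
  by rewrite (sdr_ph sdrP).
by rewrite (sdr_ph sdrV).
Qed.

(** As for [q_h], with the side condition h i0 = 0 at the label hit by the homotopy. *)
Let h_j0 x : h (j0 x) = 0.
Proof.
move: x; apply: coprod_ind => [|c x y Hx Hy|t adt]; first by rewrite (lin0 lj0) (lin0 lh).
  by rewrite lj0 lh Hx Hy scaler0 addr0.
have adt' := tmap_admissible (opcyl_i0 cylP) (sdr_i sdrV).1 adt.
rewrite j0_tcls // [h _](coprod_htpy_tcls opP dgI conP conV adt') big1 // => -[j jt] _ /=.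
rewrite -(relabel_tmap _ 0) size_labels_relabel in jt.
rewrite -[tmap _ t](relabel_tmap _ 0) relabel_relabel (tcls_label0 opP dgI (r0 := j)) ?scaler0 //.
move=> n l; rewrite ltnn eqxx; case: l => a [x|u]; rewrite /map_label /label_htpy /label0 /=.
  by rewrite (sdr_hi sdrP).
by rewrite (sdr_hi sdrV).
Qed.

Let h_h x : h (h x) = 0.
Proof. exact: (coprod_htpy2 opP dgI conP conV). Qed.

Let d0 : coprod P (cyl V) -> coprod P (cyl V) := twisted_diff (fun=> 0).
Let tw0 := zero_twisting (cyl V) opP.
Let ld0 : linear d0 := twisted_diff_linear opP dgI tw0.

Let h_homotopy x : d0 (h x) + h (d0 x) = j0 (q x) - x.
Proof.
move: x; apply: coprod_ind => [|c x y Hx Hy|t adt].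
- by rewrite (lin0 lh) (lin0 ld0) (lin0 lh) (lin0 lq) (lin0 lj0) subr0 addr0.
- by rewrite lh !ld0 lh lq lj0 addrACA -scalerDr Hx Hy scalerBr opprD addrACA.
rewrite [LHS](coprod_htpy_homotopy opP dgI conP conV adt) q_tcls // j0_tcls; last first.
  exact: tmap_admissible (opcyl_p cylP) (sdr_p sdrV).1 _ _ adt.
congr (tcls _ - _); rewrite tmap_tmap; congr tmap; apply/funext => _; apply/funext.
by case=> a [x|u].
Qed.

Let e_q x : q (del_ext delI x) = del_ext del (q x).
Proof.
exact: (coprod_map_del_ext opP opO dgI dgV (opcyl_p cylP) (sdr_p sdrV)
  (proj1 twI) (proj1 tw) del_p).
Qed.

Let e_j0 x : j0 (del_ext del x) = del_ext delI (j0 x).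
Proof.
exact: (coprod_map_del_ext opO opP dgV dgI (opcyl_i0 cylP) (sdr_i sdrV)
  (proj1 tw) (proj1 twI) del_i0).
Qed.

Let nilpotent x : exists N, forall n, (N <= n)%N -> iter n (h \o del_ext delI) x = 0.
Proof. exact: (htpy_del_nilpotent opP dgI (proj1 twI) conP conV). Qed.

Let hd := pert nilpotent.

Lemma induced_homotopy : is_perturbed_homotopy i0 i1 p hO del hd.
Proof.
by move=> x; exists (pert_bound nilpotent x); split=> // n; apply: pert_boundP.
Qed.

(** The homotopy has degree 1 and the extension of the twisting map degree -1, so every term of the
    series has the degree of its first one. *)
Let hd_deg n a (x : graded_coprod P (cyl V)) : homog n a x ->
  @homog k (graded_coprod P (cyl V)) n (a + 1) (hd x).
Proof.
have grC := coprod_graded opP grI.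
move=> hx; apply: (homog_sum grC) => -[m _] /=; elim: m => [|m IH] /=.
  exact: (coprod_htpy_homog opP dgI conP conV hx).
have := coprod_htpy_homog opP dgI conP conV (del_ext_homog opP dgI (proj1 twI) IH).
by rewrite addrK.
Qed.

Lemma induced_cylinder : is_operad_cylinder
  (O := twisted_coprod del) (P := twisted_coprod delI) j0 j1 q hd.
Proof.
have opD : is_dg_operad (twisted_coprod delI) := twisted_coprod_operad opP dgI twI.
have lE : linear (fun x => j0 (q x)) by move=> c x y; rewrite lq lj0.
split=> //; split; [|exact: (opmap_chain map_i1)|exact: q_j1].
split; [exact: (opmap_chain map_i0)|exact: (opmap_chain map_p)|..].
- by split; [exact: (pert_linear le lh nilpotent) | exact: hd_deg].
- move=> x; symmetry.
  apply: (pert_homotopy ld0 le (twisted_diff_linear opP dgI twI) lh lE).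
  + exact: (twisted_diffE opP dgI (proj1 twI)).
  + exact: (twisted_diff2 opP dgI tw0).
  + exact: (twisted_diff2 opP dgI twI).
  + exact: h_homotopy.
  (* The extensions of the twisting maps commute with [j0] and [q], which brings the two side
     conditions of the perturbation down to [h_j0] and [q_h]. *)
  + by move=> y; rewrite -e_j0 h_j0.
  by move=> y; rewrite e_q q_h (lin0 (del_ext_linear opO dgV (proj1 tw))) (lin0 lj0).
- exact: q_j0.
(* Every term of the series lies in the image of [h], which [q] annihilates. *)
- move=> x; apply: (@pert_ind _ _ _ _ nilpotent (fun y => q y = 0)); first exact: lin0 lq.
    by move=> y z hy hz; rewrite (linD lq) hy hz addr0.
  by move=> n; have [y ->] := iter_h (del_ext delI) h n x; apply: q_h.
- by move=> x; apply: (pert_kernel le lh nilpotent); apply: h_j0.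
exact: (pert2 le lh h_h nilpotent).
Qed.

End InducedCylinder.

Theorem theorem1p21 (k : comPzRingType) (O P : opSeq k)
    (i0 i1 : O -> P) (p : P -> O) (hO : P -> P) (V : dgSeq k) (del : V -> O)
    (operad_O : is_dg_operad O)
    (cyl_P : is_operad_cylinder i0 i1 p hO)
    (dg_V : is_dg_seq V)
    (twisting_del : is_twisting del) :
  is_dg_operad (twisted_coprod del) /\
  is_twisting (del_cyl i0 i1 hO del) /\
  exists h_del : coprod P (cyl V) -> coprod P (cyl V),
    is_perturbed_homotopy i0 i1 p hO del h_del /\
    is_operad_cylinder
      (O := twisted_coprod del) (P := twisted_coprod (del_cyl i0 i1 hO del))
      (coprod_map i0 (@cyl_in0 k V)) (coprod_map i1 (@cyl_in1 k V))
      (coprod_map p (@cyl_p k V)) h_del.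
Proof.
split; first exact: twisted_coprod_operad.
split; first exact: (del_cyl_twisting cyl_P twisting_del).
eexists; split; first exact: (induced_homotopy cyl_P dg_V twisting_del).
exact: induced_cylinder.
Qed.
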